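(* Let $X$ be a Banach space, $n>1$ an integer, $\Omega_1,\ldots,\Omega_n\subset X$ nonempty closed sets, $\widehat\Omega:=\Omega_1\times\cdots\times\Omega_n$, and $\sigma_{\mathbf{x}_0}:=\{\mathbf{x}_0^k\}\subset\widehat\Omega$, $\mathbf{x}_0^k:=(x_{01}^k,\ldots,x_{0n}^k)$ $(k\in\mathbb{N})$. Suppose that $\{\Omega_1,\ldots,\Omega_n\}$ is approximately stationary (particularly, stationary or extremal) at $\sigma_{\mathbf{x}_0}$. Then there exist $x_i^k\in\Omega_i$ and $x_i^{*k}\in N_{\Omega_i}(x_i^k)$ $(i=1,\ldots,n,\ k=1,2,\ldots)$ such that $x_i^k-x_{0i}^k\to0$ $(i=1,\ldots,n)$ as $k\to+\infty$, $$\lim_{k\to+\infty}\sum_{i=1}^n x_i^{*k}=0\quad\text{and}\quad\sum_{i=1}^n\|x_i^{*k}\|=1\quad(k\in\mathbb{N}).$$ Furthermore, if the assumed property holds with respect to some $\sigma_{\mathbf{a}}:=\{\mathbf{a}^k\}\subset X^n\setminus\{0\}$, $\mathbf{a}^k:=(a_1^k,\ldots,a_n^k)$, such that $\mathbf{a}^k\to0$ as $k\to+\infty$, then there exist such sequences $\{x_i^k\}$ and $\{x_i^{*k}\}$ together with $\mathbf{u}^k:=(u_1^k,\ldots,u_n^k)\in\widehat\Omega$ and $v^k\in X$ $(k\in\mathbb{N})$ such that $\mathbf{u}^k-\mathbf{x}_0^k\to0$ (and $\mathbf{u}^k=\mathbf{x}_0^k$ for all $k$ if $\{\Omega_1,\ldots,\Omega_n\}$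 is stationary or extremal at $\sigma_{\mathbf{x}_0}$ with respect to $\sigma_{\mathbf{a}}$), $v^k\to0$ as $k\to+\infty$, and, with $\mathbf{x}^{*k}:=(x_1^{*k},\ldots,x_n^{*k})$, $z_i^k:=v^k-x_i^k+u_i^k+a_i^k$ $(i=1,\ldots,n)$ and $\mathbf{z}^k:=(z_1^k,\ldots,z_n^k)$, one has $$\mathbf{z}^k\ne0\ \text{ for all large }k\in\mathbb{N},\quad\text{and}\quad \lim_{k\to+\infty}\frac{\langle\mathbf{x}^{*k},\mathbf{z}^k\rangle}{\|\mathbf{z}^k\|}=1.$$
   Context: Notation. $X^n$ carries the maximum norm, and $(X^* )^n$ the dual norm $\|(x_1^*,\ldots,x_n^* )\|=\sum_i\|x_i^*\|$; $\langle\mathbf{x}^*,\mathbf{z}\rangle=\sum_i\langle x_i^*,z_i\rangle$. $d(x,S)$ is the point-to-set distance, $d(x,\emptyset)=+\infty$. For $\mathbf{x}=(x_1,\ldots,x_n)\in X^n$, $\zeta(\mathbf{x}):=d\big(0,\bigcap_{i=1}^n(\Omega_i-x_i)\big)$. For $c>0$, $c/0:=+\infty$ and $c/(+\infty):=0$. Normal cones. $N$ denotes the Clarke normal cone $N^C$ if $X$ is a general Banach space, and the Fréchet normal cone $N^F$ if $X$ is Asplund (i.e. both assertions are made: with $N=N^C$ in any Banach space, and with $N=N^F$ in any Asplund space). Here, for $\bar x\in\Omega$, $N^F_\Omega(\bar x)$ is the set of $x^*\in X^*$ with $\limsup_{\Omega\ni x\to\bar x,\,x\neq\bar x}\langle x^*,x-\bar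 x\rangle/\|x-\bar x\|\le0$, and $N^C_\Omega(\bar x)$ is the set of $x^*\in X^*$ with $\langle x^*,z\rangle\le0$ for all $z$ in the Clarke tangent cone $T^C_\Omega(\bar x)$. Extremality and stationarity. Let $\sigma_{\mathbf{x}}=\{\mathbf{x}^k\}\subset\widehat\Omega$ and $\sigma_{\mathbf{a}}=\{\mathbf{a}^k\}\subset X^n\setminus\{0\}$ with $\mathbf{a}^k\to0$. Put $$\rho(\sigma_{\mathbf{x}};\sigma_{\mathbf{a}}):=\liminf_{k\to+\infty}\zeta(\mathbf{x}^k+\mathbf{a}^k),\qquad\alpha(\sigma_{\mathbf{x}};\sigma_{\mathbf{a}}):=\limsup_{k\to+\infty}\frac{\|\mathbf{a}^k\|}{\zeta(\mathbf{x}^k+\mathbf{a}^k)},$$ $$\widetilde\alpha(\sigma_{\mathbf{x}};\sigma_{\mathbf{a}}):=\inf\big\{\alpha(\sigma_{\mathbf{u}};\sigma_{\mathbf{a}})\mid \sigma_{\mathbf{u}}=\{\mathbf{u}^k\}\subset\widehat\Omega,\ \mathbf{u}^k-\mathbf{x}^k\to0\big\}.$$ The collection $\{\Omega_1,\ldots,\Omega_n\}$ is extremal, stationary, approximately stationary at $\sigma_{\mathbf{x}}$ with respect to $\sigma_{\mathbf{a}}$ if, respectively, $\rho(\sigma_{\mathbf{x}};\sigma_{\mathbf{a}})>0$, $\alpha(\sigma_{\mathbf{x}};\sigma_{\mathbf{a}})=0$, $\widetilde\alpha(\sigma_{\mathbf{x}};\sigma_{\mathbf{a}})=0$. It has one of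 these properties at $\sigma_{\mathbf{x}}$ if it has it with respect to some $\sigma_{\mathbf{a}}=\{\mathbf{a}^k\}\subset X^n\setminus\{0\}$ with $\mathbf{a}^k\to0$. *)

(* Defs.v *)
From mathcomp Require Export all_boot all_order all_algebra.
From mathcomp Require Export all_classical all_reals all_analysis.
Export Order.TTheory GRing.Theory Num.Theory.
Export numFieldNormedType.Exports.

Set Implicit Arguments.
Unset Strict Implicit.
Unset Printing Implicit Defensive.

Local Open Scope classical_set_scope.
Local Open Scope ring_scope.

Section Dual.
Context {R : realType} {X : normedModType R}.

(* The topological dual X^*, as a set of linear forms. *)
Definition dual_space : set {linear X -> R^o} := [set f | continuous f].

(* To be used only for f in X^*: [sup] of an unbounded set is 0. *)
Definition dual_norm (f : X -> R) : R :=
  sup [set `|f z| | z in [set z : X | `|z| <= 1]].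

End Dual.

Section NormalCones.
Context {R : realType} {X : normedModType R}.
Implicit Types (Omega : set X) (x : X).

(* If x is isolated in Omega, the upper limit is -oo and every element of the
   dual is a Frechet normal. *)
Definition frechet_normal_cone Omega x : set {linear X -> R^o} :=
  [set f | dual_space f /\
    (limf_esup (fun y => (f (y - x) / `|y - x|)%:E) (within Omega x^') <= 0)%E].

Definition clarke_tangent_cone Omega x : set X :=
  [set z | forall (y : nat -> X) (t : nat -> R),
    (forall k, Omega (y k)) -> y @ \oo --> x ->
    (forall k, 0 < t k) -> t @ \oo --> (0 : R) ->
    exists2 w : nat -> X, w @ \oo --> z & forall k, Omega (y k + t k *: w k)].

Definition clarke_normal_cone Omega x : set {linear X -> R^o} :=
  [set f | dual_space f /\ forall z, clarke_tangent_cone Omega x z -> f z <= 0].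

End NormalCones.

Definition asplund {R : realType} (X : completeNormedModType R) : Prop :=
  forall (D : set X) (f : X -> R^o), open D -> convex_set D ->
    convex_function D f -> {in D, continuous f} ->
    D `<=` closure [set x | D x /\ differentiable f x].

(* Points of X^n are functions 'I_n -> X; 0, + and - on them are pointwise. *)
Section Extremality.
Context {R : realType} {X : normedModType R} {n : nat}.
Variable Omega : 'I_n -> set X.
Implicit Types (x z : 'I_n -> X) (sx su sa : nat -> 'I_n -> X).

Definition max_norm z : R := \big[Num.max/0]_(i < n) `|z i|.

Definition product_set : set ('I_n -> X) := [set x | forall i, Omega i (x i)].

(* [edist_inf A z] is the distance from z to A; it is +oo if A is empty. *)
Definition zeta x : \bar R :=
  edist_inf (\bigcap_(i : 'I_n) [set w - x i | w in Omega i]) 0.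

Definition rho sx sa : \bar R := limn_einf (fun k => zeta (sx k + sa k)).

(* In [\bar R], 0^-1 = +oo and +oo^-1 = 0, so the quotients follow the
   conventions c / 0 = +oo and c / +oo = 0 for c > 0. *)
Definition alpha sx sa : \bar R :=
  limn_esup (fun k => (max_norm (sa k))%:E / zeta (sx k + sa k)%R)%E.

Definition alpha_tilde sx sa : \bar R :=
  ereal_inf [set alpha su sa | su in [set su |
    (forall k, product_set (su k)) /\
    (fun k => max_norm (su k - sx k)) @ \oo --> (0 : R)]].

Definition null_perturbation sa : Prop :=
  (forall k, sa k <> 0) /\ (fun k => max_norm (sa k)) @ \oo --> (0 : R).

Definition extremal_wrt sx sa : Prop := (0 < rho sx sa)%E.
Definition stationary_wrt sx sa : Prop := alpha sx sa = 0%E.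
Definition approx_stationary_wrt sx sa : Prop := alpha_tilde sx sa = 0%E.

Definition extremal sx : Prop :=
  exists2 sa, null_perturbation sa & extremal_wrt sx sa.
Definition stationary sx : Prop :=
  exists2 sa, null_perturbation sa & stationary_wrt sx sa.
Definition approx_stationary sx : Prop :=
  exists2 sa, null_perturbation sa & approx_stationary_wrt sx sa.

End Extremality.

(* Main.v *)
(* If the sets [Omega i - u i - a i] have no common point in a ball whose radius
   is large compared with [max_norm a], then [(x, v) |-> |v - x + u + a|] is
   positive on [Omega^ x X] near [(u, 0)], where it equals [max_norm a].  The
   Borwein-Preiss principle gives a nearby minimiser of this function plus a
   convex perturbation of small slope; the components of a dual functional at
   that point are normals with almost zero sum, and they almost attain their
   norm at [z = v - x + u + a].

   With the Clarke cones, convexity of the tangent cones lets Hahn-Banach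
   separation produce the functional.  With the Frechet cones, the minimisation
   takes place in a separable subspace [Y]: if [X] is Asplund, the restrictions
   to [Y] of its dual ball are norm-separable, hence [X^n] has an almost
   isometric gauge that is Frechet smooth along [Y^n], and smoothness turns a
   subgradient into normals relative to [Y].  By Hahn-Banach, the existence of
   normals with given estimates amounts to inequalities between finitely many
   vectors; [Y] is closed under the choice of vectors violating them with
   rational data, so the inequalities extend from [Y] to [X]. *)
From HB Require Import structures.
Require Import Defs.
From mathcomp Require Import ring lra.

Set Implicit Arguments.
Unset Strict Implicit.
Unset Printing Implicit Defensive.

Local Open Scope classical_set_scope.
Local Open Scope ring_scope.

(** * Sublinear functionals *)

Section Sublinear.
Context {R : realType} {V : lmodType R}.
Implicit Types (p q : V -> R) (x y : V).

(** The obstacle in the Frechet case is that a functional normal relative to [Y] cannot simply be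
    extended to [X]: an extension says nothing about the points of the sets outside [Y]. Hence what
    passes from [Y] to [X] is the solvability of a system of inequalities, and a new functional is
    produced on [X]. For this, the condition that values be [o(|h|)] is turned into one monotone
    modulus [mu]; the rounding to rational data then merely replaces [mu t] by [mu (4 * t)].

    Smoothness is measured by second differences, which bound all subgradients of a convex function
    at once without naming a derivative. Minimality gives a lower bound of the increments on
    feasible displacements, and a small second difference turns it into the upper bound that a
    normal must satisfy. A gauge is not smooth at 0: the minimiser escapes this by [z <> 0], and the
    variational principle by using the square of the gauge.

    The estimates concern a single pair [(u, a)] and are governed by the ratio [max_norm a / lam];
    sequences enter only in the final diagonal choice. Functionals stay bare functions until they
    are normalised, since Hahn-Banach is applied in its algebraic form. *)

Definition is_linear (f : V -> R) : Prop :=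
  forall a x y, f (a *: x + y) = a * f x + f y.

Definition sublinear p : Prop :=
  (forall x y, p (x + y) <= p x + p y) /\
  (forall t x, 0 < t -> p (t *: x) = t * p x).

Lemma is_linearD f x y : is_linear f -> f (x + y) = f x + f y.
Proof. by move=> fl; rewrite -[x in LHS]scale1r fl mul1r. Qed.

Lemma is_linear0 f : is_linear f -> f 0 = 0.
Proof. by move=> fl; have := is_linearD 0 0 fl; rewrite addr0; lra. Qed.

Lemma is_linearZ f a x : is_linear f -> f (a *: x) = a * f x.
Proof.
by move=> fl; have := fl a x 0; rewrite (is_linear0 fl) !addr0.
Qed.

Lemma is_linearN f x : is_linear f -> f (- x) = - f x.
Proof. by move=> fl; rewrite -scaleN1r (is_linearZ _ _ fl) mulN1r. Qed.

Lemma is_linearB f x y : is_linear f -> f (x - y) = f x - f y.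
Proof. by move=> fl; rewrite (is_linearD _ _ fl) (is_linearN _ fl). Qed.

Lemma sublinear0 p : sublinear p -> p 0 = 0.
Proof.
move=> [_ ph]; have : p (2%:R *: 0) = 2 * p 0 by apply: ph.
by rewrite scaler0; lra.
Qed.

Lemma sublinear_geN p x : sublinear p -> - p (- x) <= p x.
Proof.
by move=> ps; have := ps.1 x (- x); rewrite subrr (sublinear0 ps); lra.
Qed.

(* [B] lists lower constraints [b <= p y] that the minimal [p] must keep. *)
Definition sublinear_above (B : set (V * R)) (p0 p : V -> R) : Prop :=
  [/\ sublinear p, (forall x, p x <= p0 x) & forall y b, B (y, b) -> b <= p y].

(** By Zorn's lemma: a chain is bounded below by its pointwise infimum, finite because
    [- p0 (- x) <= p x] for each member. With [B] empty the minimal elements are linear, which is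
    the Hahn-Banach theorem; with the constraints of [dentable_over] they need not be, and
    minimality is used directly. *)
Lemma ex_minimal_sublinear (B : set (V * R)) p0 : sublinear_above B p0 p0 ->
  exists2 p, sublinear_above B p0 p &
    forall q, sublinear_above B p0 q -> (forall x, q x <= p x) ->
      forall x, q x = p x.
Proof.
move=> p0B; pose T := {p : V -> R | sublinear_above B p0 p}.
pose r (p q : T) := `[< forall x, sval q x <= sval p x >].
have [|||A totA|p pmin] := @Zorn T r.
- by move=> p; apply/asboolP.
- move=> p q s /asboolP pq /asboolP qs; apply/asboolP => x.
  exact: le_trans (qs x) (pq x).
- move=> [p Pp] [q Pq] /asboolP /= pq /asboolP /= qp.
  by apply: eq_exist; apply/funext => x; apply/eqP; rewrite eq_le qp pq.
- have [A0|/set0P[a Aa]] := eqVneq A set0.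
    by exists (exist _ p0 p0B) => s; rewrite A0.
  pose S x := [set sval p x | p in A].
  have S0 x : S x !=set0 by exists (sval a x); exists a.
  have Slb x : has_lbound (S x).
    exists (- p0 (- x)) => _ [[p [ps pp0 _]] _ <-] /=.
    by apply: le_trans (sublinear_geN _ ps); rewrite lerN2.
  have Sle x (p : T) : A p -> inf (S x) <= sval p x.
    by move=> Ap; apply: ge_inf => //; exists p.
  suff Pt : sublinear_above B p0 (fun x => inf (S x)).
    by exists (exist _ _ Pt) => p Ap; apply/asboolP => x /=; exact: Sle.
  split; first split.
  + move=> x y; apply/ler_addgt0Pr => e e0.
    have e2 : 0 < e / 2 by rewrite divr_gt0.
    have [_ [p Ap <-] pe] := inf_adherent e2 (conj (S0 x) (Slb x)).
    have [_ [q Aq <-] qe] := inf_adherent e2 (conj (S0 y) (Slb y)).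
    (* Two members of a chain are comparable, and the smaller one serves at both points. *)
    have [/asboolP pq|/asboolP qp] := totA _ _ Ap Aq.
    * have [[qs _] _ _] := svalP q.
      by have := Sle (x + y) _ Aq; have := qs x y; have := pq x; lra.
    * have [[ps _] _ _] := svalP p.
      by have := Sle (x + y) _ Ap; have := ps x y; have := qp y; lra.
  + move=> t x t0; apply/eqP; rewrite eq_le; apply/andP; split.
      rewrite -ler_pdivrMl //; apply: lb_le_inf => // _ [p Ap <-].
      have [[_ ph] _ _] := svalP p.
      by rewrite ler_pdivrMl // -ph //; exact: Sle.
    apply: lb_le_inf => // _ [p Ap <-]; have [[_ ph] _ _] := svalP p.
    by rewrite ph // ler_pM2l //; exact: Sle.
  + move=> x; apply: le_trans (Sle _ _ Aa) _.
    by have [_ + _] := svalP a; apply.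
  + move=> y b yb; apply: lb_le_inf => // _ [p Ap <-].
    by have [_ _ +] := svalP p; apply.
exists (sval p); first exact: svalP.
move=> q qB qp x; suff -> : p = exist _ q qB by [].
by apply/esym/pmin; apply/asboolP.
Qed.

(** [q y] is the infimum of [p (y - t *: x) + t * c] over [t >= 0], that is, the largest sublinear
    minorant of [p] with value at most [c] at [x]. The condition on [c] keeps the infimum finite. *)
Lemma sublinear_tilt p x c : sublinear p -> 0 <= p (- x) + c ->
  exists2 q, sublinear q &
    (forall y t, 0 <= t -> q y <= p (y - t *: x) + t * c) /\
    (forall y b, (forall t, 0 <= t -> b <= p (y - t *: x) + t * c) -> b <= q y).
Proof.
move=> ps xc; pose S y := [set p (y - t *: x) + t * c | t in [set t | 0 <= t]].
have S0 y : S y !=set0 by exists (p (y - 0 *: x) + 0 * c); exists 0 => /=.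
have Slb y : has_lbound (S y).
  exists (- p (- y)) => _ [t /= t0 <-].
  have [->|tn0] := eqVneq t 0.
    by rewrite scale0r subr0 mul0r addr0; exact: sublinear_geN.
  have tp : 0 < t by rewrite lt_def tn0.
  have := ps.1 (y - t *: x) (- y).
  rewrite addrAC subrr add0r -scalerN ps.2 //.
  have : 0 <= t * (p (- x) + c) by rewrite mulr_ge0.
  by rewrite mulrDr; lra.
have Sle y t : 0 <= t -> inf (S y) <= p (y - t *: x) + t * c.
  by move=> t0; apply: ge_inf => //; exists t.
have Sge y b : (forall t, 0 <= t -> b <= p (y - t *: x) + t * c) -> b <= inf (S y).
  by move=> bt; apply: lb_le_inf => // _ [t t0 <-]; exact: bt.
exists (fun y => inf (S y)) => //; split.
- move=> y z; apply/ler_addgt0Pr => e e0.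
  have e2 : 0 < e / 2 by rewrite divr_gt0.
  have [_ [s s0 <-] se] := inf_adherent e2 (conj (S0 y) (Slb y)).
  have [_ [t t0 <-] te] := inf_adherent e2 (conj (S0 z) (Slb z)).
  have := Sle (y + z) (s + t) (addr_ge0 s0 t0).
  have := ps.1 (y - s *: x) (z - t *: x).
  by rewrite scalerDl opprD addrACA mulrDl; lra.
- have half t y : 0 < t -> t * inf (S y) <= inf (S (t *: y)).
    move=> t0; apply: Sge => s s0; rewrite -ler_pdivlMl //.
    apply: le_trans (Sle y (t^-1 * s) _) _; first by rewrite mulr_ge0 // invr_ge0 ltW.
    rewrite mulrDr mulrA lerD2r -ps.2 ?invr_gt0 //.
    by rewrite scalerBr !scalerA mulVf ?gt_eqF // scale1r.
  move=> t y t0; apply/eqP; rewrite eq_le half // andbT.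
  rewrite -[leLHS]mul1r -[1](@mulfV _ t) ?gt_eqF // -mulrA ler_pM2l //.
  apply: le_trans (half _ _ _) _; rewrite ?invr_gt0 //.
  by rewrite scalerA mulVf ?gt_eqF // scale1r.
Qed.

(** A minimal [f] below [p] is odd, because tilting it to the value [- f x] at [- x] cannot lower
    it; an odd sublinear functional is linear. *)
Lemma hahn_banach p : sublinear p ->
  exists2 f, is_linear f & forall x, f x <= p x.
Proof.
move=> ps; have [|f [fs fp _] fmin] := @ex_minimal_sublinear set0 p; first by split.
have fN x : f (- x) = - f x.
  have [|q qs [qle _]] := @sublinear_tilt f (- x) (- f x) fs; first by rewrite opprK subrr.
  have qf : forall y, q y <= f y.
    by move=> y; apply: le_trans (qle y 0 (lexx 0)) _; rewrite scale0r subr0 mul0r addr0.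
  have -> : f (- x) = q (- x).
    by apply/esym/fmin => //; split=> // y; apply: le_trans (qf y) (fp y).
  apply/eqP; rewrite eq_le; apply/andP; split.
    by have := qle (- x) 1 ler01; rewrite scale1r subrr (sublinear0 fs) mul1r add0r.
  have -> : q (- x) = f (- x).
    by apply: fmin => //; split=> // y; apply: le_trans (qf y) (fp y).
  by have := sublinear_geN (- x) fs; rewrite opprK.
have fD x y : f (x + y) = f x + f y.
  apply/eqP; rewrite eq_le fs.1 /=.
  by have := fs.1 (- x) (- y); rewrite -opprD !fN; lra.
have fZ a x : f (a *: x) = a * f x.
  have [a0|a0|->] := ltgtP a 0.
  - by rewrite -[a]opprK scaleNr fN fs.2 ?oppr_gt0 // !mulNr.
  - exact: fs.2.
  - by rewrite scale0r (sublinear0 fs) mul0r.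
by exists f => // a x y; rewrite fD fZ.
Qed.

Definition convex_cone (C : set (V * R)) : Prop :=
  (forall g h r s, C (g, r) -> C (h, s) -> C (g + h, r + s)) /\
  (forall t g r, 0 < t -> C (g, r) -> C (t *: g, t * r)).

(** A system of inequalities [f g <= r], closed under sums and positive multiples, is solvable
    unless it contains [0 <= r] with [r < 0]: the infimum of the [r] paired with [g] is then finite
    and sublinear in [g]. *)
Lemma linear_below_cone (C : set (V * R)) : convex_cone C ->
  (forall g, exists r, C (g, r)) -> (forall r, C (0, r) -> 0 <= r) ->
  exists2 f, is_linear f & forall g r, C (g, r) -> f g <= r.
Proof.
move=> [CD CZ] Cex C0; pose S g := [set r | C (g, r)].
have S0 g : S g !=set0 by have [r Cr] := Cex g; exists r.
have Slb g : has_lbound (S g).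
  have [s Cs] := Cex (- g); exists (- s) => r /= Cr.
  by have := CD _ _ _ _ Cr Cs; rewrite subrr => /C0; lra.
have Sle g r : C (g, r) -> inf (S g) <= r by move=> Cr; exact: ge_inf.
have half t g : 0 < t -> t * inf (S g) <= inf (S (t *: g)).
  move=> t0; apply: lb_le_inf => // r /= Cr; rewrite -ler_pdivlMl //.
  apply: Sle; rewrite -[g]scale1r -[1](@mulVf _ t) ?gt_eqF // -scalerA.
  by apply: CZ; rewrite ?invr_gt0.
have [|f fl fS] := @hahn_banach (fun g => inf (S g)).
  split=> [g h|t g t0].
    apply/ler_addgt0Pr => e e0; have e2 : 0 < e / 2 by rewrite divr_gt0.
    have [r /= Cr re] := inf_adherent e2 (conj (S0 g) (Slb g)).
    have [s /= Cs se] := inf_adherent e2 (conj (S0 h) (Slb h)).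
    by have := Sle _ _ (CD _ _ _ _ Cr Cs); lra.
  apply/eqP; rewrite eq_le half // andbT.
  rewrite -[leLHS]mul1r -[1](@mulfV _ t) ?gt_eqF // -mulrA ler_pM2l //.
  apply: le_trans (half _ _ _) _; rewrite ?invr_gt0 //.
  by rewrite scalerA mulVf ?gt_eqF // scale1r.
by exists f => // g r Cr; apply: le_trans (fS g) (Sle _ _ Cr).
Qed.

End Sublinear.

(** * Separable restrictions of the dual of an Asplund space *)

Section AsplundSublinear.
Context {R : realType} {X : completeNormedModType R}.

(** For a continuous convex [p], second differences of order [o(|h|)] at [x] amount to Frechet
    differentiability at [x]. *)
Definition second_difference {V : lmodType R} (p : V -> R) (x h : V) : R :=
  p (x + h) + p (x - h) - 2 * p x.

(** Such a [p] is convex and 1-Lipschitz, so the Asplund property provides a point of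
    differentiability; adding the expansions at [h] and [- h] cancels the derivative. *)
Lemma asplund_second_difference (p : X -> R) : asplund X -> sublinear p ->
  (forall x, p x <= `|x|) ->
  exists x, forall e, 0 < e -> exists2 d, 0 < d &
    forall h, `|h| <= d -> second_difference p x h <= e * `|h|.
Proof.
move=> aX ps p1.
have plip x y : p x - p y <= `|x - y|.
  by apply: le_trans (p1 _); have := ps.1 (x - y) y; rewrite subrK; lra.
have pc : continuous (p : X -> R^o).
  move=> x; apply/cvgrPdist_le => e e0.
  near=> y; apply: (@le_trans _ _ `|x - y|).
    by rewrite ler_norml plip andbT; have := plip y x; rewrite distrC; lra.
  by near: y; exact: cvgr_dist_le.
have [|||||x [[_ dx] _]] := aX setT (p : X -> R^o) openT _ _ _ 0 _ setT _.
- by move=> x y t _ _; rewrite inE.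
- move=> t x y _ _; rewrite convRE.
  have t0 : 0 <= t%:num by [].
  have t1 : 0 <= 1 - t%:num by rewrite subr_ge0.
  have pZ s z : 0 <= s -> p (s *: z) = s * p z.
    rewrite le_eqVlt => /predU1P[<-|s0]; last exact: ps.2.
    by rewrite scale0r mul0r (sublinear0 ps).
  by rewrite -(pZ _ x t0) -(pZ _ y t1); exact: ps.1.
- by move=> x _; exact: pc.
- by [].
- exact: filterT.
exists x => e e0; have e2 : 0 < e / 2 by rewrite divr_gt0.
have [_ /eqaddoP /(_ _ e2)] := (diff_locallyP x (p : X -> R^o)).1 dx.
move=> /nbhs_ballP[d /= d0 dball]; exists (d / 2); first by rewrite divr_gt0.
have diffle h : `|h| <= d / 2 -> p (x + h) <= p x + 'd (p : X -> R^o) x h + e / 2 * `|h|.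
  move=> hd; have : ball 0 d h.
    by rewrite -ball_normE /= sub0r normrN; apply: le_lt_trans hd _; lra.
  move=> /dball /= H; rewrite -lerBlDl; apply: le_trans H; apply: le_trans (ler_norm _).
  by rewrite !fctE /= [h + x]addrC.
move=> h hd; have := diffle h hd; have := diffle (- h); rewrite normrN => /(_ hd).
by rewrite linearN /second_difference; lra.
Unshelve. all: by end_near. Qed.

Definition dual_ball : set (X -> R) :=
  [set f | is_linear f /\ forall x, `|f x| <= `|x|].

Definition subspace (Y : set X) : Prop :=
  [/\ Y 0, forall x y, Y x -> Y y -> Y (x + y) & forall t x, Y x -> Y (t *: x)].

Section SeparableDual.
Variables (Y : set X) (d : R).
Hypotheses (aX : asplund X) (sY : subspace Y) (d0 : 0 < d).

Let countably_covered (S : set (X -> R)) : Prop :=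
  exists D : set (X -> R), [/\ countable D, D `<=` dual_ball &
    forall f, S f -> exists2 g, D g & forall y, Y y -> `|f y - g y| <= d * `|y|].

(* A minimal sublinear majorant of the support function of [A] on [Y] is
   differentiable at some [x]; minimality turns the corresponding slice of [A],
   which [x] need not define within [Y], into one given by a vector of [Y]. *)
Lemma dentable_over (A : set (X -> R)) : A `<=` dual_ball -> A !=set0 ->
  exists y c, [/\ Y y, (exists2 f, A f & c < f y) &
    forall f g, A f -> A g -> c < f y -> c < g y ->
      forall h, Y h -> `|f h - g h| <= d * `|h|].
Proof.
move=> Adual [f0 Af0]; have [Y0 YD YZ] := sY.
pose B := [set yb : X * R | Y yb.1 /\ exists2 f, A f & yb.2 = f yb.1].
have [|p [ps p1 pB] pmin] := @ex_minimal_sublinear R X B (fun x => `|x|).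
  split=> [||y b [_ [f /Adual[_ fb] /= ->]]] //; last by apply: le_trans (fb _); exact: ler_norm.
  by split=> [x y|t x t0]; [exact: ler_normD|rewrite normrZ gtr0_norm].
have pA f y : A f -> Y y -> f y <= p y by move=> Af Yy; apply: pB; split=> //; exists f.
have [x /(_ (d / 2))[|r r0 pr]] := asplund_second_difference aX ps p1.
  by rewrite divr_gt0.
(* In [main], one functional is tested at [y + h] and the other at [y - h]. Each loses at most
   [d * r / 4], and the second difference adds [d / 2 * r]: together [d * r]. *)
pose c := p x - d * r / 4.
have dr0 : 0 < d * r by rewrite mulr_gt0.
have cx : c < p x by rewrite /c; lra.
have [y Yy [f Af fy]] : exists2 y, Y y & exists2 f, A f & p (y - x) + c < f y.
  have [xc|xc] := ltP (p (- x) + c) 0.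
    exists 0 => //.
    by exists f0 => //; rewrite sub0r (is_linear0 (Adual _ Af0).1).
  (* Lowering [p] at [x] to [c] must break a constraint of [B], by minimality. The vector [z] of the
     broken constraint, divided by the [t] that shows the violation, is the required [y]. *)
  have [q qs [qle qge]] := sublinear_tilt ps xc.
  have qp z : q z <= p z.
    by apply: le_trans (qle z 0 (lexx 0)) _; rewrite scale0r subr0 mul0r addr0.
  have qx : q x < p x.
    apply: le_lt_trans (qle x 1 ler01) _.
    by rewrite scale1r subrr (sublinear0 ps) add0r mul1r.
  have [z [Yz [f Af fz]]] : exists z, Y z /\ exists2 f, A f & q z < f z.
    apply: contrapT => nex; suff : q x = p x by move: qx => /[swap] ->; rewrite ltxx.
    apply: pmin => //; split=> // [z|y b [/= Yy [f Af /= ->]]].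
      exact: le_trans (qp z) (p1 z).
    rewrite leNgt; apply/negP => qf; apply: nex.
    by exists y; split=> //; exists f.
  have [t t0 tz] : exists2 t, 0 <= t & p (z - t *: x) + t * c < f z.
    apply: contrapT => nex; move: fz; rewrite ltNge => /negP; apply.
    apply: qge => t t0; rewrite leNgt; apply/negP => tz; apply: nex.
    by exists t.
  have tp : 0 < t.
    rewrite lt_def t0 andbT; apply/eqP => tE; move: tz.
    by rewrite tE scale0r subr0 mul0r addr0 ltNge pA.
  exists (t^-1 *: z); first exact: YZ.
  exists f => //; rewrite (is_linearZ _ _ (Adual _ Af).1).
  rewrite -(ltr_pM2l tp) mulrA mulfV ?gt_eqF // mul1r mulrDr -ps.2 //.
  by rewrite scalerBr scalerA mulfV ?gt_eqF // scale1r.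
exists y, (p (y - x) + c); split=> //; first by exists f.
move=> {f Af fy} f g Af Ag fy gy.
have main f1 g1 : A f1 -> A g1 -> p (y - x) + c < f1 y -> p (y - x) + c < g1 y ->
    forall h, Y h -> `|h| = r -> f1 h - g1 h <= d * `|h|.
  move=> {}Af {}Ag {}fy {}gy h Yh hr.
  have Yh' : Y (- h) by rewrite -scaleN1r; exact: YZ.
  have := pA _ _ Af (YD _ _ Yy Yh); have := pA _ _ Ag (YD _ _ Yy Yh').
  rewrite (is_linearD _ _ (Adual _ Af).1) (is_linearB _ _ (Adual _ Ag).1).
  have := ps.1 (y - x) (x + h); rewrite addrA subrK.
  have := ps.1 (y - x) (x - h); rewrite addrA subrK.
  have := pr h; rewrite hr lexx /second_difference => /(_ isT).
  by move: fy gy; rewrite /c; lra.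
have main' f1 g1 : A f1 -> A g1 -> p (y - x) + c < f1 y -> p (y - x) + c < g1 y ->
    forall h, Y h -> f1 h - g1 h <= d * `|h|.
  move=> Af1 Ag1 f1y g1y h Yh; have [->|h0] := eqVneq h 0.
    by rewrite (is_linear0 (Adual _ Af1).1) (is_linear0 (Adual _ Ag1).1) subrr normr0 mulr0.
  have hp : 0 < `|h| by rewrite normr_gt0.
  have tp : 0 < r / `|h| by rewrite divr_gt0.
  have nE : `|(r / `|h|) *: h| = r by rewrite normrZ gtr0_norm // divfK // gt_eqF.
  have := main _ _ Af1 Ag1 f1y g1y _ (YZ (r / `|h|) _ Yh) nE.
  rewrite (is_linearZ _ _ (Adual _ Af1).1) (is_linearZ _ _ (Adual _ Ag1).1).
  by rewrite normrZ gtr0_norm // -mulrBr mulrCA ler_pM2l.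
move=> h Yh; rewrite ler_norml -lerNl opprB !main' //.
Qed.

Variable e : nat -> X.
Hypothesis edense :
  forall y r, Y y -> 0 < r -> exists j, `|y - e j| < r.

(** [U] collects the slices with rational data that have countable nets. If something were left, a
    slice of the rest of diameter at most [d] could be replaced by a rational slice [H (j, q)]; the
    net of [U] together with one functional [f] of the rest would cover it, so that it would already
    lie in [U]. *)
Lemma dual_ball_covered : countably_covered dual_ball.
Proof.
pose H (jq : nat * rat) := [set f | dual_ball f /\ ratr jq.2 < f (e jq.1)].
pose U := \bigcup_(jq in [set jq | countably_covered (H jq)]) H jq.
have [DU [DUc DUb DUp]] : countably_covered U.
  have /choice[D DP] : forall jq, exists D, countably_covered (H jq) ->
      [/\ countable D, D `<=` dual_ball &
        forall f, H jq f -> exists2 g, D g & forall y, Y y -> `|f y - g y| <= d * `|y|].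
    move=> jq; have [[D ?]|?] := pselect (countably_covered (H jq)); first by exists D.
    by exists set0.
  exists (\bigcup_(jq in [set jq | countably_covered (H jq)]) D jq); split.
  - by apply: bigcup_countable => [|jq /DP[]//]; exact: countableP.
  - by move=> f [jq /DP[_ Db _]]; exact: Db.
  - move=> f [jq cjq Hf]; have [_ _ /(_ f Hf)[g Dg gP]] := DP _ cjq.
    by exists g => //; exists jq.
have [A0|/set0P An] := eqVneq (dual_ball `\` U) set0.
  exists DU; split=> // f fb; apply: DUp; apply: contrapT => nU.
  by have : (dual_ball `\` U) f by []; rewrite A0.
have [|y [c [Yy [f [fb nUf] cf] slice]]] := dentable_over _ An; first by move=> f [].
(* Passing from [y] to [e j] costs one third of the gap between [c] and [f y]; the threshold [q] is
   taken in the middle third. *)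
have g3 : 0 < (f y - c) / 3 by rewrite divr_gt0 // subr_gt0.
have [j yj] := edense Yy g3.
have [q] : exists q, ratr q \in `]c + (f y - c) / 3, c + 2 * ((f y - c) / 3)[.
  by apply: rat_in_itvoo; lra.
rewrite in_itv /= => /andP[q1 q2].
have dist g : dual_ball g -> `|g y - g (e j)| < (f y - c) / 3.
  by move=> [gl gb]; rewrite -(is_linearB _ _ gl); apply: le_lt_trans (gb _) yj.
exfalso; apply: (nUf); exists (j, q); last first.
  by split=> //=; have := dist _ fb; rewrite ltr_norml => /andP[]; lra.
exists (\bigcup_(b in [set: bool]) (if b then [set f] else DU)); split.
- by apply: bigcup_countable => [|[] _]; [exact: countableP|exact: countable1|].
- by move=> g [[] _]; [move=> ->|exact: DUb].
move=> g [/= gb qg]; have [/DUp[k Dk kP]|nUg] := pselect (U g).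
  by exists k => //; exists false.
exists f; first by exists true.
apply: slice => //; move: qg => /= qg.
by have := dist _ gb; rewrite ltr_norml => /andP[]; lra.
Qed.

End SeparableDual.

Lemma separable_dual (Y : set X) (e : nat -> X) : asplund X -> subspace Y ->
  (forall y r, Y y -> 0 < r -> exists j, `|y - e j| < r) ->
  exists2 g : nat -> X -> R, (forall j, dual_ball (g j)) &
    forall f r, dual_ball f -> 0 < r ->
      exists j, forall y, Y y -> `|f y - g j y| <= r * `|y|.
Proof.
move=> aX sY edense.
have ip (m : nat) : 0 < m.+1%:R^-1 :> R by rewrite invr_gt0.
have /choice[D DP] := fun m => dual_ball_covered aX sY (ip m) edense.
have Dc : countable (\bigcup_m D m).
  by apply: bigcup_countable => [|m _]; [exact: countableP|case: (DP m)].
have Db : \bigcup_m D m `<=` dual_ball by move=> f [m _]; case: (DP m) => _ + _; apply.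
have /countable_injP[c cinj] := Dc.
have z0 : dual_ball (fun=> 0 : R).
  by split=> [a x y|x]; rewrite ?mulr0 ?addr0 // normr0.
have /choice[g gP] : forall j, exists g, dual_ball g /\
    forall f, (\bigcup_m D m) f -> c f = j -> g = f.
  move=> j; have [[f Df fj]|nex] := pselect (exists2 f, (\bigcup_m D m) f & c f = j).
    exists f; split=> [|h Dh hj]; first exact: Db.
    by apply: cinj; rewrite ?inE // hj.
  by exists (fun=> 0); split=> // f Df fj; case: nex; exists f.
exists g => [j|f r fb r0]; first by case: (gP j).
have [m mr] : exists m : nat, m.+1%:R^-1 < r.
  by exists (Num.truncn r^-1); rewrite invf_plt ?posrE // truncnS_gt.
have [_ _ /(_ f fb)[h Dh hP]] := DP m.
exists (c h) => y Yy; have [_ /(_ h)->//] := gP (c h); last by exists m.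
by apply: le_trans (hP y Yy) _; rewrite ler_wpM2r // ltW.
Qed.

End AsplundSublinear.

(** * A gauge smooth along a subspace *)

(** Stands in for weak-star compactness of the dual ball: bounded coordinates converge along an
    ultrafilter. *)
Lemma ultra_bounded_cvg {R : realType} {T : Type} (G : set_system T) (f : T -> R)
    (B : R) : UltraFilter G -> (\forall t \near G, `|f t| <= B) ->
  exists l : R, f t @[t --> G] --> l.
Proof.
move=> GU fB; have PG := @ultra_proper _ _ GU.
have [|l [_ lcl]] := @segment_compact R (- B) B (f x @[x --> G]) _ _.
  near=> t; rewrite /= in_itv /= -ler_norml.
  by near: t.
exists l => U Ul; have [//|GnU] := in_ultra_setVsetC (f @^-1` U) GU.
by have [x [/= nUx Ux]] := lcl (~` U) U GnU Ul.
Unshelve. all: by end_near. Qed.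

Lemma sum_half {R : realFieldType} (J : nat) :
  \sum_(j < J) 2^-1 ^+ j = 2 - 2 * 2^-1 ^+ J :> R.
Proof.
elim: J => [|J IH]; first by rewrite big_ord0 expr0; lra.
by rewrite big_ord_recr /= IH exprS; lra.
Qed.

Section Seminorm.
Context {R : realType} {V : lmodType R}.

Definition seminorm (nrm : V -> R) : Prop :=
  (forall x y, nrm (x + y) <= nrm x + nrm y) /\
  (forall t x, nrm (t *: x) = `|t| * nrm x).

Variables (nrm : V -> R) (nrms : seminorm nrm).

Lemma seminormN x : nrm (- x) = nrm x.
Proof. by rewrite -scaleN1r nrms.2 normrN1 mul1r. Qed.

Lemma seminorm0 : nrm 0 = 0.
Proof. by rewrite -(scale0r 0) nrms.2 normr0 mul0r. Qed.

Lemma seminorm_ge0 x : 0 <= nrm x.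
Proof. by have := nrms.1 x (- x); rewrite subrr seminorm0 seminormN; lra. Qed.

Lemma seminormB x y : nrm (x - y) <= nrm x + nrm y.
Proof. by rewrite -(seminormN y) nrms.1. Qed.

Lemma seminorm_distC x y : nrm (x - y) = nrm (y - x).
Proof. by rewrite -seminormN opprB. Qed.

Lemma seminorm_sublinear : sublinear nrm.
Proof. by split=> [|t x t0]; [exact: nrms.1|rewrite nrms.2 gtr0_norm]. Qed.

Lemma is_linear_norm (f : V -> R) : is_linear f -> (forall x, f x <= nrm x) ->
  forall x, `|f x| <= nrm x.
Proof.
move=> fl fn x; rewrite ler_norml fn andbT.
by have := fn (- x); rewrite (is_linearN _ fl) seminormN; lra.
Qed.

End Seminorm.

(** Tilting [p] to the value [- p z] at [- z] forces every linear minorant to be at least [p z] at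
    [z]. *)
Lemma hahn_banach_at {R : realType} {V : lmodType R} (p : V -> R) z :
  sublinear p -> exists f, [/\ is_linear f, forall x, f x <= p x & f z = p z].
Proof.
move=> ps; have [|q qs [qle _]] := @sublinear_tilt _ _ p (- z) (- p z) ps.
  by rewrite opprK subrr.
have qp x : q x <= p x.
  by apply: le_trans (qle x 0 (lexx 0)) _; rewrite scale0r subr0 mul0r addr0.
have [f fl fq] := hahn_banach qs; exists f.
have fp x : f x <= p x by apply: le_trans (fq x) (qp x).
split=> //; apply/eqP; rewrite eq_le fp /=.
have := fq (- z); have := qle (- z) 1 ler01.
by rewrite scale1r subrr (sublinear0 ps) (is_linearN _ fl); lra.
Qed.

Section SmoothNorm.
Context {R : realType} {V : lmodType R}.
Variables (nrm : V -> R) (M : set V) (d : nat -> V -> R) (B eps : R).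
Hypotheses (nrms : seminorm nrm)
  (dB : forall j x, `|d j x| <= B * nrm x)
  (ddense : forall f r, is_linear f -> (forall x, `|f x| <= nrm x) -> 0 < r ->
     exists j, forall y, M y -> `|f y - d j y| <= r * nrm y)
  (B0 : 0 <= B) (eps0 : 0 < eps) (eps1 : eps <= 1).

(** Small enough for [1 - eps] times the dual ball to satisfy the conditions of [LL] with all [a j]
    equal to [1 + B]: the weights sum to at most 2, and [(1 - eps) ^+ 2 + eps <= 1]. *)
Let tau : R := eps / (2 * (1 + B) ^+ 2).

Let tau0 : 0 < tau.
Proof. by rewrite divr_gt0 // mulr_gt0 // exprn_gt0 // ltr_pwDl. Qed.

Let tau1 : tau <= 1.
Proof.
have B1 : 1 <= (1 + B) ^+ 2 by rewrite expr_ge1 ?addr_ge0 // lerDl.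
by rewrite ler_pdivrMr ?mul1r; have := eps1; lra.
Qed.

Let w (j : nat) : R := 2^-1 ^+ j.
Let w0 j : 0 < w j. Proof. by rewrite exprn_gt0 // invr_gt0. Qed.

Implicit Types t : (V -> R) * R * (nat -> R).

(* [t = (f, s, a)] records a functional [f] with a bound [s] for its norm and
   bounds [a j] for the norms of [f - d j] on [M]; being conditions on finitely
   many coordinates, these pass to pointwise limits of triples. *)
Let LL : set ((V -> R) * R * (nat -> R)) := [set t |
  [/\ is_linear t.1.1, 0 <= t.1.2 & forall j, 0 <= t.2 j] /\
  [/\ forall x, `|t.1.1 x| <= t.1.2 * nrm x,
      forall j y, M y -> `|t.1.1 y - d j y| <= t.2 j * nrm y &
      forall J, t.1.2 ^+ 2 + tau * (\sum_(j < J) w j * t.2 j ^+ 2) <= 1]].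

Let LL_s1 t : LL t -> t.1.2 <= 1.
Proof.
move=> [[_ s0 _] [_ _ /(_ 0%N)]]; rewrite big_ord0 mulr0 addr0.
by rewrite expr_le1.
Qed.

Let LL_nrm t x : LL t -> `|t.1.1 x| <= nrm x.
Proof.
move=> Lt; have [_ [tn _ _]] := Lt; apply: le_trans (tn x) _.
by rewrite ler_piMl ?LL_s1 // seminorm_ge0.
Qed.

(** Only boundedness matters here, for the limits in [smooth_norm_attained]; the added 1 avoids a
    square root. *)
Let LL_a t j : LL t -> t.2 j <= 1 + (tau * w j)^-1.
Proof.
move=> [[_ s0 a0] [_ _ /(_ j.+1)]]; rewrite big_ord_recr /= mulrDr => H.
have tw : 0 < tau * w j by rewrite mulr_gt0.
have : t.2 j ^+ 2 <= (tau * w j)^-1.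
  rewrite -[leRHS]mul1r ler_pdivlMr // mulrC -mulrA.
  have : 0 <= tau * \sum_(i < j) w i * t.2 i ^+ 2.
    apply: mulr_ge0; first exact: ltW.
    by apply: sumr_ge0 => i _; apply: mulr_ge0; [exact: ltW|exact: sqr_ge0].
  by have := sqr_ge0 t.1.2; lra.
by have := sqr_ge0 (t.2 j - 1); have := a0 j; nra.
Qed.

(** The support function of a convex body lying between [1 - eps] times the dual ball and the dual
    ball. The squared distances to the dense family [d] give this body a local uniform convexity
    along [M], which is dual to smoothness of [Nn]. The [d j] are not arranged symmetrically, so
    [Nn] is treated as sublinear and not as a norm. *)
Let Nn z : R := sup [set t.1.1 z | t in LL].

Let LL_scaled f : is_linear f -> (forall x, `|f x| <= nrm x) ->
  LL (fun x => (1 - eps) * f x, 1 - eps, fun=> 1 + B).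
Proof.
move=> fl fn; have e1 : 0 <= 1 - eps by rewrite subr_ge0.
have BB : 0 < (1 + B) ^+ 2 by rewrite exprn_gt0 // ltr_pwDl.
split; split => //=.
- by move=> a x y; rewrite fl; ring.
- by rewrite addr_ge0.
- by move=> x; rewrite normrM ger0_norm // ler_wpM2l.
- move=> j y My; apply: le_trans (ler_normB _ _) _; rewrite [leRHS]mulrDl mul1r lerD // normrM ger0_norm //.
  apply: le_trans (ler_wpM2l e1 (fn y)) _; rewrite ler_piMl ?seminorm_ge0 //.
  by rewrite gerBl ltW.
- move=> J; rewrite -mulr_suml; have WJ : \sum_(j < J) w j <= 2.
    by rewrite /w sum_half; have := w0 J; rewrite /w; lra.
  have : tau * ((\sum_(j < J) w j) * (1 + B) ^+ 2) <= eps.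
    apply: (@le_trans _ _ (tau * (2 * (1 + B) ^+ 2))).
      by rewrite ler_pM2l // ler_pM2r.
    by rewrite /tau divfK // gt_eqF // mulr_gt0.
  have : eps * (1 - eps) >= 0 by rewrite mulr_ge0 // ltW.
  by nra.
Qed.

Let LLn : LL !=set0.
Proof.
eexists; apply: (@LL_scaled (fun=> 0)) => [a x y|x]; first by rewrite mulr0 addr0.
by rewrite normr0 seminorm_ge0.
Qed.

Let S0 z : [set t.1.1 z | t in LL] !=set0.
Proof. by have [t Lt] := LLn; exists (t.1.1 z); exists t. Qed.

Let Sub z : has_ubound [set t.1.1 z | t in LL].
Proof.
by exists (nrm z) => _ [t Lt <-]; apply: le_trans (ler_norm _) (LL_nrm _ Lt).
Qed.

Let le_Nn t z : LL t -> t.1.1 z <= Nn z.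
Proof. by move=> Lt; apply: ub_le_sup => //; exists t. Qed.

Let Nn_le z b : (forall t, LL t -> t.1.1 z <= b) -> Nn z <= b.
Proof. by move=> tb; apply: ge_sup => // _ [t /tb ? <-]. Qed.

Let smooth_norm_sublinear : sublinear Nn.
Proof.
split=> [x y|c x c0].
  apply: Nn_le => t Lt; have [[tl _ _] _] := Lt.
  by rewrite (is_linearD _ _ tl) lerD // le_Nn.
apply/eqP; rewrite eq_le; apply/andP; split.
  apply: Nn_le => t Lt; have [[tl _ _] _] := Lt.
  by rewrite (is_linearZ _ _ tl) ler_pM2l // le_Nn.
rewrite -ler_pdivlMl //; apply: Nn_le => t Lt; have [[tl _ _] _] := Lt.
by rewrite ler_pdivlMl // -(is_linearZ _ _ tl) le_Nn.
Qed.

Let smooth_norm_le z : Nn z <= nrm z.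
Proof.
by apply: Nn_le => t Lt; apply: le_trans (ler_norm _) (LL_nrm _ Lt).
Qed.

(** Near-maximisers are refined to an ultrafilter, along which [LL_nrm], [LL_s1] and [LL_a] make
    every coordinate converge; the limit is a maximiser. *)
Let smooth_norm_attained z : exists2 t, LL t & t.1.1 z = Nn z.
Proof.
pose F := filter_from [set r : R | 0 < r] (fun r => [set t | LL t /\ Nn z - r < t.1.1 z]).
have FF : ProperFilter F.
  apply: filter_from_proper => [|r /= r0].
    apply: filter_from_filter; first by exists 1 => /=.
    move=> r s /= r0 s0; exists (Num.min r s); first by rewrite /= lt_min r0.
    move=> t [Lt tz]; split; split=> //; apply: le_lt_trans tz; rewrite lerD2l lerN2.
      by rewrite ge_min lexx.
    by rewrite ge_min lexx orbT.
  have [_ [t Lt <-] tz] := sup_adherent r0 (conj (S0 z) (Sub z)).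
  by exists t.
have [G [GU FG]] := ultraFilterLemma FF; have PG := @ultra_proper _ _ GU.
have GL : \forall t \near G, LL t.
  by apply: FG; exists 1 => //= t [].
have lec (P : set ((V -> R) * R * (nat -> R))) (g h : (V -> R) * R * (nat -> R) -> R) (l l' : R) :
    G P -> g t @[t --> G] --> l -> h t @[t --> G] --> l' ->
    (forall t, P t -> g t <= h t) -> l <= l'.
  move=> GP gl hl gh; rewrite -subr_ge0; apply: (cvgr_to_ge (cvgB hl gl)).
  by near=> t; rewrite subr_ge0; apply: gh; near: t.
have /choice[f fE] : forall x, exists l, t.1.1 x @[t --> G] --> (l : R).
  move=> x; apply: (@ultra_bounded_cvg _ _ _ _ (nrm x)).
  by apply: filterS GL => t; exact: LL_nrm.
have [s sE] : exists l, t.1.2 @[t --> G] --> (l : R).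
  apply: (@ultra_bounded_cvg _ _ _ _ 1); apply: filterS GL => t Lt.
  by rewrite ger0_norm ?LL_s1 //; case: Lt => [[]].
have /choice[a aE] : forall j, exists l, t.2 j @[t --> G] --> (l : R).
  move=> j; apply: (@ultra_bounded_cvg _ _ _ _ (1 + (tau * w j)^-1)).
  by apply: filterS GL => t Lt; rewrite ger0_norm ?LL_a //; case: Lt => [[_ _ +] _].
exists (f, s, a) => /=; last first.
  apply/eqP; rewrite eq_le; apply/andP; split.
    by apply: (lec _ _ _ _ _ GL (fE z) (cvg_cst (Nn z))) => t Lt; exact: le_Nn.
  apply/ler_addgt0Pr => e e0; rewrite -lerBlDr.
  have Ge : G [set t | LL t /\ Nn z - e < t.1.1 z] by apply: FG; exists e.
  by apply: (lec _ _ _ _ _ Ge (cvg_cst (Nn z - e)) (fE z)) => t [_ /ltW].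
split; split.
- move=> c x y /=; 
  have cE : c * t.1.1 x + t.1.1 y @[t --> G] --> c * f x + f y.
    by apply: cvgD; [apply: cvgM; [exact: cvg_cst|]|].
  have fxyE := fE (c *: x + y).
  apply/eqP; rewrite eq_le; apply/andP; split.
    by apply: (lec _ _ _ _ _ GL fxyE cE) => t [[tl _ _] _] /=; rewrite tl.
  by apply: (lec _ _ _ _ _ GL cE fxyE) => t [[tl _ _] _] /=; rewrite tl.
- by apply: (lec _ _ _ _ _ GL (cvg_cst 0) sE) => t [[]].
- by move=> j; apply: (lec _ _ _ _ _ GL (cvg_cst 0) (aE j)) => t [[]].
- move=> x.
  have nE : `|t.1.1 x| @[t --> G] --> `|f x| by exact: cvg_norm.
  have mE : t.1.2 * nrm x @[t --> G] --> s * nrm x by apply: cvgM; [|exact: cvg_cst].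
  by apply: (lec _ _ _ _ _ GL nE mE) => t [_ []].
- move=> j y My.
  have nE : `|t.1.1 y - d j y| @[t --> G] --> `|f y - d j y|.
    by apply: cvg_norm; apply: cvgB; [|exact: cvg_cst].
  have mE : t.2 j * nrm y @[t --> G] --> a j * nrm y by apply: cvgM; [|exact: cvg_cst].
  by apply: (lec _ _ _ _ _ GL nE mE) => t [_ [_ + _]]; apply.
- move=> J /=.
  have sumE : \sum_(j < J) w j * t.2 (nat_of_ord j) ^+ 2 @[t --> G] --> \sum_(j < J) w j * a j ^+ 2.
    apply: cvg_big => [|j _]; first exact: add_continuous.
    by apply: cvgM; [exact: cvg_cst|apply: cvgM; exact: aE].
  have mE : t.1.2 ^+ 2 + tau * (\sum_(j < J) w j * t.2 (nat_of_ord j) ^+ 2) @[t --> G] -->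
      s ^+ 2 + tau * (\sum_(j < J) w j * a j ^+ 2).
    by apply: cvgD; apply: cvgM => //; exact: cvg_cst.
  have oE : (1 : R) @[t --> G] --> (1 : R) by exact: cvg_cst.
  by have := lec _ _ _ _ _ GL mE oE; apply => t [_ [_ _ +]]; apply.
Unshelve. all: by end_near. Qed.


Let sum_split (c : R) (a : nat -> R) J :
  \sum_(j < J) w j * ((1 + c) * a j ^+ 2 + 2 * c) =
  (1 + c) * (\sum_(j < J) w j * a j ^+ 2) + 2 * c * \sum_(j < J) w j.
Proof.
by rewrite !mulr_sumr -big_split /=; apply: eq_bigr => j _; ring.
Qed.

Let w_sum_le J : \sum_(j < J) w j <= 2.
Proof. by rewrite /w sum_half; have := w0 J; rewrite /w; lra. Qed.

(** Slack in the quadratic constraint is room for scaling. The factor [1 + c] costs at most [3 * c]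
    in the square of the norm bound, and at most [c + 4 * c] in the weighted sum, by
    [(a + c) ^+ 2 <= (1 + c) * a ^+ 2 + 2 * c]: in all [8 * c]. *)
Let scale_LL t c g : LL t -> 0 <= c <= 1 -> 8 * c <= g ->
  (forall J, t.1.2 ^+ 2 + tau * (\sum_(j < J) w j * t.2 j ^+ 2) <= 1 - g) ->
  LL (fun x => (1 + c) * t.1.1 x, (1 + c) * t.1.2, fun j => t.2 j + c).
Proof.
move=> Lt /andP[c0 c1] cg tg; have s1 := LL_s1 Lt.
have [[tl s0 a0] [tn ta _]] := Lt; split; split => /=.
- by move=> b x y; rewrite tl; ring.
- by rewrite mulr_ge0 // addr_ge0.
- by move=> j; rewrite addr_ge0.
- move=> x; rewrite normrM ger0_norm ?addr_ge0 // -mulrA ler_wpM2l ?addr_ge0 //.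
- move=> j y My.
  have -> : (1 + c) * t.1.1 y - d j y = (t.1.1 y - d j y) + c * t.1.1 y by ring.
  apply: le_trans (ler_normD _ _) _; rewrite mulrDl lerD ?ta //.
  by rewrite normrM ger0_norm // ler_wpM2l // LL_nrm.
- move=> J.
  have aJ : \sum_(j < J) w j * (t.2 j + c) ^+ 2 <=
      \sum_(j < J) w j * ((1 + c) * t.2 j ^+ 2 + 2 * c).
    apply: ler_sum => j _; rewrite ler_pM2l //.
    have := mulr_ge0 c0 (sqr_ge0 (t.2 j - 1)).
    have : 0 <= c * (1 - c) by rewrite mulr_ge0 // subr_ge0.
    by rewrite !expr2; lra.
  rewrite sum_split in aJ.
  have := tg J; have := w_sum_le J.
  have : 0 <= \sum_(j < J) w j * t.2 j ^+ 2.
    by apply: sumr_ge0 => j _; apply: mulr_ge0; [exact: ltW|exact: sqr_ge0].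
  have : 0 <= \sum_(j < J) w j by apply: sumr_ge0 => j _; exact: ltW.
  move: (\sum_(j < J) w j) (\sum_(j < J) w j * t.2 j ^+ 2) aJ => W A aJ W0 A0 W2 AT.
  have h1 := ler_wpM2l (ltW tau0) aJ.
  have h2 : 0 <= tau * A by rewrite mulr_ge0 // ltW.
  have h3 : tau * W * c <= 2 * c.
    by rewrite ler_wpM2r //; have := ler_wpM2l (ltW tau0) W2; have := tau1; lra.
  have h4 : (1 + c) ^+ 2 * t.1.2 ^+ 2 <= t.1.2 ^+ 2 + 3 * c.
    have : c ^+ 2 <= c by rewrite expr2 ler_piMr.
    have : t.1.2 ^+ 2 <= 1 by rewrite expr_le1.
    have := sqr_ge0 t.1.2; move: (t.1.2 ^+ 2) => S S0' S1 cc.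
    have : 0 <= c * (1 - S) by rewrite mulr_ge0 // subr_ge0.
    have : (1 - S) * c ^+ 2 >= 0 by rewrite mulr_ge0 ?sqr_ge0 // subr_ge0.
    by nra.
  rewrite exprMn; have h5 : tau * A * c <= c.
    by rewrite ler_piMl //; have := sqr_ge0 t.1.2; lra.
  by nra.
Qed.

(** Smulian's criterion: functionals that nearly attain [Nn z] are close, along [M], to one that
    attains it. Otherwise their midpoint would leave slack in the quadratic constraint, and
    multiplied by [1 + c] it would exceed [Nn z]. *)
Let smooth_norm_smulian z : 0 < Nn z -> exists f, forall r, 0 < r ->
  exists2 g, 0 < g & forall t, LL t -> Nn z - g < t.1.1 z ->
    forall y, M y -> `|t.1.1 y - f y| <= r * nrm y.
Proof.
move=> Nz; have [[[f s] a] Lf fz] := smooth_norm_attained z; exists f => r r0.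
rewrite /= in fz; have := Lf => -[[/= fl s0 a0] [fn fa fq]].
have r3 : 0 < r / 3 by rewrite divr_gt0.
have [j fj] := ddense fl (fun x => LL_nrm x Lf) r3.
(* As [d j] is within [r / 3] of [f], the bound of index [j] may be lowered to [r / 3]. If the
   competing bound exceeds [2 * (r / 3)], the two differ by more than [r / 3], and the parallelogram
   identity yields [gain]. *)
pose b i := if i == j then Num.min (a j) (r / 3) else a i.
have ba i : b i <= a i by rewrite /b; case: eqP => // ->; rewrite ge_min lexx.
have b0 i : 0 <= b i by rewrite /b; case: eqP => // _; rewrite le_min a0 ltW.
pose gain := tau * w j * (r / 3) ^+ 2 / 4.
have gain0 : 0 < gain by rewrite divr_gt0 // mulr_gt0 ?exprn_gt0 // mulr_gt0.
pose c := Num.min (gain / 8) 1.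
have c0 : 0 < c by rewrite lt_min divr_gt0 //= ltr01.
have c1 : c <= 1 by rewrite ge_min lexx orbT.
exists (c * Nn z); first by rewrite mulr_gt0.
move=> [[g s'] a'] Lg /= gz y My.
have := Lg => -[[/= gl s'0 a'0] [gn ga gq]].
have [aj|aj] := leP (a' j) (2 * (r / 3)).
  have := ga j y My; have := fj y My; have := seminorm_ge0 nrms y.
  rewrite !ler_norml; move: (nrm y) => n n0 /andP[u1 u2] /andP[v1 v2].
  have : a' j * n <= 2 * (r / 3) * n by rewrite ler_wpM2r.
  by move=> ?; apply/andP; split; lra.
pose h := (fun x => (g x + f x) / 2, (s' + s) / 2, fun i => (a' i + b i) / 2).
have mid J : ((s' + s) / 2) ^+ 2 + tau * (\sum_(i < J) w i * ((a' i + b i) / 2) ^+ 2) <=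
    1 - (if (j < J)%N then gain else 0).
  have H : \sum_(i < J) w i * ((a' i + b i) / 2) ^+ 2 + (if (j < J)%N then gain / tau else 0)
      <= \sum_(i < J) w i * ((a' i ^+ 2 + a i ^+ 2) / 2).
    have -> : (if (j < J)%N then gain / tau else 0) =
        \sum_(i < J) (if (i : nat) == j then gain / tau else 0).
      case: ltnP => jJ; last first.
        rewrite big1 // => i _; case: eqP => // ij.
        by have := ltn_ord i; rewrite ij ltnNge jJ.
      rewrite (bigD1 (Ordinal jJ)) //= eqxx big1 ?addr0 // => i; rewrite -val_eqE /=.
      by case: eqP.
    rewrite -big_split /=; apply: ler_sum => i _.
    have bai : b i ^+ 2 <= a i ^+ 2 by rewrite ler_sqr ?nnegrE.
    have wi := w0 i; case: eqP => [ij|_].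
      have -> : gain / tau = w i * ((r / 3) ^+ 2 / 4).
        by rewrite /gain ij; field; rewrite gt_eqF.
      rewrite -mulrDr ler_pM2l //.
      have : b i <= r / 3 by rewrite /b ij eqxx ge_min lexx orbT.
      rewrite ij in bai *; move: (r / 3) r3 aj => q q0 aj bq.
      have : q ^+ 2 <= (a' j - b j) ^+ 2.
        by rewrite ler_sqr ?nnegrE //; have := b0 j; lra.
      by nra.
    rewrite addr0 ler_pM2l //.
    by have := sqr_ge0 (a' i - b i); nra.
  have Hs : \sum_(i < J) w i * ((a' i ^+ 2 + a i ^+ 2) / 2) =
      (\sum_(i < J) w i * a' i ^+ 2 + \sum_(i < J) w i * a i ^+ 2) / 2.
    by rewrite -big_split mulr_suml; apply: eq_bigr => i _ /=; field.
  rewrite Hs in H; have := fq J; have := gq J; move: H => /=.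
  move: (\sum_(i < J) w i * ((a' i + b i) / 2) ^+ 2) (\sum_(i < J) w i * a' i ^+ 2)
    (\sum_(i < J) w i * a i ^+ 2) => A1 A2 A3.
  have ss : ((s' + s) / 2) ^+ 2 <= (s' ^+ 2 + s ^+ 2) / 2.
    by have := sqr_ge0 (s' - s); nra.
  case: ifP => _ /(ler_wpM2l (ltW tau0)); last by move=> H1 H2 H3; nra.
  rewrite mulrDr mulrCA mulfV ?gt_eqF // mulr1 => H1 H2 H3.
  by nra.
have Lh : LL h.
  split; split=> //=.
  - by move=> k x u; rewrite gl fl; lra.
  - by rewrite divr_ge0 // addr_ge0.
  - by move=> i; rewrite divr_ge0 // addr_ge0.
  - move=> x; have := gn x; have := fn x; rewrite !ler_norml => /andP[u1 u2] /andP[v1 v2].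
    by apply/andP; split; lra.
  - move=> i u Mu; have := ga i u Mu.
    have : `|f u - d i u| <= b i * nrm u.
      rewrite /b; case: eqP => [->|_]; last exact: fa.
      by case: (leP (a j) (r / 3)) => _; [exact: fa|exact: fj].
    rewrite !ler_norml => /andP[u1 u2] /andP[v1 v2].
    by apply/andP; split; lra.
  - move=> J; apply: le_trans (mid J) _.
    by case: ifP => _; rewrite ?subr0 // gerBl ltW.
have midg J : h.1.2 ^+ 2 + tau * (\sum_(i < J) w i * h.2 i ^+ 2) <= 1 - gain.
  (* The gain appears only in partial sums that contain the index [j]; a shorter sum is bounded by
     one that does. *)
  apply: le_trans (_ : _ <= h.1.2 ^+ 2 + tau * (\sum_(i < J + j.+1) w i * h.2 i ^+ 2)) _.
    rewrite lerD2l ler_pM2l // big_split_ord /= lerDl; apply: sumr_ge0 => i _.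
    by apply: mulr_ge0; [exact: ltW|exact: sqr_ge0].
  by have := mid (J + j.+1)%N; rewrite leq_addl.
have cg : 8 * c <= gain by have : c <= gain / 8 by [rewrite ge_min lexx]; lra.
have c01 : 0 <= c <= 1 by rewrite ltW.
have := le_Nn z (scale_LL Lh c01 cg midg); rewrite /= fz.
have : 0 < (1 + c) * (g z - (Nn z - c * Nn z)) by rewrite mulr_gt0 ?subr_gt0 // addr_gt0.
have : 0 <= c * Nn z * (1 - c) by rewrite mulr_ge0 ?subr_ge0 // mulr_ge0 // ltW.
by nra.
Qed.

(** Functionals attaining [Nn] at [z + k] and [z - k] lose at most [2 * nrm k] at [z], so both are
    within [r / 2] of one [f] along [M]; their difference at [k] bounds the second difference. *)
Let smooth_norm_second_difference z r : 0 < Nn z -> 0 < r ->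
  exists2 g, 0 < g & forall k, M k -> nrm k <= g ->
    second_difference Nn z k <= r * nrm k.
Proof.
move=> Nz r0; have [f fP] := smooth_norm_smulian Nz.
have [g g0 gP] := fP (r / 2) (divr_gt0 r0 (ltr0Sn _ 1)).
exists (g / 3) => [|k Mk kg]; first by rewrite divr_gt0.
have n0 := seminorm_ge0 nrms k.
have [t1 L1 e1] := smooth_norm_attained (z + k).
have [t2 L2 e2] := smooth_norm_attained (z - k).
have [[t1l _ _] _] := L1; have [[t2l _ _] _] := L2.
have near t u : LL t -> is_linear t.1.1 -> t.1.1 (z + u) = Nn (z + u) -> nrm u <= g / 3 ->
    Nn z - g < t.1.1 z.
  move=> Lt tl; rewrite (is_linearD _ _ tl) => tE ug.
  have := smooth_norm_sublinear.1 (z + u) (- u); rewrite addrK.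
  have := smooth_norm_le (- u); rewrite (seminormN nrms).
  have := ler_norm (t.1.1 u); have := LL_nrm u Lt; have := g0; lra.
have := gP _ L1 (near _ _ L1 t1l e1 kg) _ Mk.
have := gP _ L2 (near _ (- k) L2 t2l e2 _) _ Mk; rewrite (seminormN nrms) => /(_ kg).
rewrite /second_difference -e1 -e2 (is_linearD _ _ t1l) (is_linearB _ _ t2l).
have := le_Nn z L1; have := le_Nn z L2; rewrite !ler_norml => ? ? /andP[? ?] /andP[? ?].
by lra.
Qed.

Lemma ex_smooth_norm : exists N : V -> R,
  [/\ sublinear N, (forall z, N z <= nrm z), (forall z, (1 - eps) * nrm z <= N z) &
   forall z r, 0 < N z -> 0 < r -> exists2 g, 0 < g &
     forall k, M k -> nrm k <= g -> second_difference N z k <= r * nrm k].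
Proof.
exists Nn; split=> [||z|].
- exact: smooth_norm_sublinear.
- exact: smooth_norm_le.
- have [f [fl fn <-]] := hahn_banach_at z (seminorm_sublinear nrms).
  exact: (le_Nn z (LL_scaled fl (is_linear_norm nrms fl fn))).
- exact: smooth_norm_second_difference.
Qed.

End SmoothNorm.

(** * The Borwein-Preiss variational principle *)

Lemma half_expn_small {R : realType} (C r : R) : 0 <= C -> 0 < r ->
  exists m : nat, 2^-1 ^+ m * C <= r.
Proof.
move=> C0 r0; exists (Num.truncn (C / r)); rewrite exprVn mulrC ler_pdivrMr ?exprn_gt0 //.
rewrite mulrC -ler_pdivrMr //; apply: ltW; apply: lt_le_trans (truncnS_gt _) _.
by rewrite -natrX ler_nat ltn_expl.
Qed.

Section BorweinPreiss.
Context {R : realType} {V : lmodType R}.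
Variables (nrm gauge F : V -> R) (D M : set V) (p0 : V) (A lam : R).
Hypotheses (nrms : seminorm nrm)
  (gauge0 : gauge 0 = 0) (gauge_ge : forall q, nrm q ^+ 2 <= 8 * gauge q)
  (gaugeD : forall p q, gauge (p + q) <= gauge p + 2 * nrm p * nrm q + nrm q ^+ 2)
  (gauge_convex : forall t p q, 0 <= t <= 1 ->
     gauge (t *: p + (1 - t) *: q) <= t * gauge p + (1 - t) * gauge q)
  (gauge_smooth : forall z r, 0 < r -> exists2 g, 0 < g &
     forall k, M k -> nrm k <= g -> second_difference gauge z k <= r * nrm k)
  (F0 : forall p, 0 <= F p) (F1 : forall p q, F p <= F q + nrm (p - q))
  (Dcomplete : forall (x : nat -> V) C, (forall k, D (x k)) ->
     (forall k l, (k <= l)%N -> nrm (x l - x k) <= C * 2^-1 ^+ k) ->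
     exists2 p, D p & forall k, nrm (p - x k) <= C * 2^-1 ^+ k)
  (Dp0 : D p0) (FA : F p0 <= A) (A0 : 0 < A) (lam0 : 0 < lam).

Let w (j : nat) : R := 2^-1 ^+ j.
Let w0 j : 0 < w j. Proof. by rewrite exprn_gt0 // invr_gt0. Qed.
Let w1 j : w j <= 1. Proof. by rewrite exprn_ile1 // ?invr_ge0 // invf_le1 // ler1n. Qed.
(* The squared weights leave a factor [w m] to absorb the terms [k >= m]. *)
Let delta (j : nat) : R := A / lam ^+ 2 * w j ^+ 2.
Let delta0 j : 0 < delta j.
Proof. by rewrite mulr_gt0 ?exprn_gt0 // divr_gt0 // exprn_gt0. Qed.

Let gauge_pos q : 0 <= gauge q.
Proof. by have := gauge_ge q; have := sqr_ge0 (nrm q); lra. Qed.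

(** 3 exceeds the square root of the 8 in [gauge_ge]; this is the source of the radius [3 * lam]. *)
Let gauge_le_sqr c q : 0 <= c -> gauge q <= c ^+ 2 -> nrm q <= 3 * c.
Proof.
move=> c0 qc; have c3 : 0 <= 3 * c by lra.
rewrite -ler_sqr ?nnegrE ?(seminorm_ge0 nrms) //.
by have := gauge_ge q; have := sqr_ge0 c; rewrite exprMn; lra.
Qed.

Let ex_near_minimiser (P : V -> R) (x : V) i e : 0 < e -> (forall y, 0 <= P y) -> D x ->
  exists y, [/\ D y, P y + delta i * gauge (y - x) <= P x &
    forall u, D u -> P u + delta i * gauge (u - x) <= P x ->
      P y + delta i * gauge (y - x) <= P u + delta i * gauge (u - x) + e].
Proof.
move=> e0 P0 Dx; pose Q y := P y + delta i * gauge (y - x).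
pose S := [set Q y | y in [set y | D y /\ Q y <= P x]].
have Sn : S !=set0.
  by exists (Q x), x => //; split; rewrite // /Q subrr gauge0 mulr0 addr0.
have Sb : has_lbound S.
  by exists 0 => _ [y _ <-]; rewrite addr_ge0 // mulr_ge0 // ltW.
have [_ [y [Dy yx] <-] ye] := inf_adherent e0 (conj Sn Sb).
exists y; split=> // u Du ux; apply/ltW; apply: lt_le_trans ye _.
by rewrite lerD2r; apply: ge_inf => //; exists u.
Qed.

(** With this tolerance, the competitors [u] still admissible at step [i] satisfy
    [gauge (u - x i) <= (lam * w i) ^+ 2]. At step 0 the same bound comes from [F p0 <= A]. *)
Let err (i : nat) : R := delta i * (lam * w i) ^+ 2.
Let err0 i : 0 < err i.
Proof. by rewrite mulr_gt0 // exprn_gt0 // mulr_gt0. Qed.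

Let partial (x : nat -> V) J p : R := \sum_(k < J) delta k * gauge (p - x k).

Let partial0 x J p : 0 <= partial x J p.
Proof. by apply: sumr_ge0 => k _; apply: mulr_ge0 => //; exact: ltW. Qed.

Let ex_sequence : exists x : nat -> V, [/\ x 0%N = p0, forall k, D (x k) &
  forall k, F (x k.+1) + partial x k.+1 (x k.+1) <= F (x k) + partial x k (x k) /\
   forall u, D u -> F u + partial x k.+1 u <= F (x k) + partial x k (x k) ->
     F (x k.+1) + partial x k.+1 (x k.+1) <= F u + partial x k.+1 u + err k.+1].
Proof.
have /choice[nx nxP] : forall a : nat * (V -> R) * V, exists y,
    (forall u, 0 <= a.1.2 u) -> D a.2 ->
    [/\ D y, a.1.2 y + delta a.1.1 * gauge (y - a.2) <= a.1.2 a.2 &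
    forall u, D u -> a.1.2 u + delta a.1.1 * gauge (u - a.2) <= a.1.2 a.2 ->
      a.1.2 y + delta a.1.1 * gauge (y - a.2) <=
      a.1.2 u + delta a.1.1 * gauge (u - a.2) + err a.1.1.+1].
  move=> [[i P] x] /=; have [[P0 Dx]|nPD] := pselect ((forall u, 0 <= P u) /\ D x).
    by have [y yP] := ex_near_minimiser i (err0 i.+1) P0 Dx; exists y.
  by exists 0 => P0 Dx; case: nPD.
pose st := fix st n : (V -> R) * V := if n is n'.+1 then
  (fun p => (st n').1 p + delta n' * gauge (p - (st n').2), nx (n', (st n').1, (st n').2))
  else (F, p0).
pose x n := (st n).2.
have stE n p : (st n).1 p = F p + partial x n p.
  elim: n => [|n IH] in p *; first by rewrite /partial big_ord0 addr0.
  by rewrite /= IH /partial big_ord_recr addrA.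
have st0 n p : 0 <= (st n).1 p by rewrite stE addr_ge0.
have Dx n : D (x n).
  by elim: n => [//|n IH]; have [] := nxP (n, (st n).1, (st n).2) (st0 n) IH.
exists x; split=> // k; have [_ h1 h2] := nxP (k, (st k).1, (st k).2) (st0 k) (Dx k).
have E u : (st k).1 u + delta k * gauge (u - (st k).2) = F u + partial x k.+1 u.
  by rewrite -stE.
split; first by move: h1; rewrite /= E stE.
by move=> u Du; have := h2 u Du; rewrite /= !E stE.
Qed.

(** [G] is the increment at [p] of the series with terms [delta k * gauge (q - x k)]. Since [p] is
    within [3 * lam] of each [x k], each gauge grows by at most [6 * lam * nrm q + nrm q ^+ 2]; the
    [delta k] sum to at most [2 * (A / lam ^+ 2)], whence the coefficients 12 and 2. *)
Lemma borwein_preiss : exists (p : V) (G : V -> R), [/\ D p, nrm (p - p0) <= 3 * lam,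
    forall q, D (p + q) -> F p <= F (p + q) + G q &
  [/\ forall t q q', 0 <= t <= 1 ->
     G (t *: q + (1 - t) *: q') <= t * G q + (1 - t) * G q', G 0 = 0,
   forall q, G q <= 12 * (A / lam) * nrm q + 2 * (A / lam ^+ 2) * nrm q ^+ 2 &
   forall r, 0 < r -> exists2 g, 0 < g &
     forall q, M q -> nrm q <= g -> G q + G (- q) <= r * nrm q]].
Proof.
have [x [x0 Dx xP]] := ex_sequence.
pose Phi k u := F u + partial x k u.
have PhiS k u : Phi k.+1 u = Phi k u + delta k * gauge (u - x k).
  by rewrite /Phi /partial big_ord_recr addrA.
pose S k u := D u /\ Phi k.+1 u <= Phi k (x k).
have Sx k : S k (x k) by split=> //; rewrite PhiS subrr gauge0 mulr0 addr0.
have SS k u : S k.+1 u -> S k u.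
  move=> [Du uk]; split=> //; apply: le_trans (xP k).1; apply: le_trans uk.
  by rewrite (PhiS k.+1) lerDl mulr_ge0 // ltW.
have Sle k l u : (k <= l)%N -> S l u -> S k u.
  by move=> /subnK <-; elim: (l - k)%N => [//|m IH] /SS.
have Snrm k u : S k u -> nrm (u - x k) <= 3 * lam * w k.
  move=> Sku; have Dk := delta0 k.
  rewrite -mulrA; apply: gauge_le_sqr; first by rewrite mulr_ge0 // ltW.
  rewrite -(ler_pM2l Dk); have [Du uk] := Sku; rewrite PhiS in uk.
  apply: (@le_trans _ _ (Phi k (x k) - Phi k u)); first by lra.
  case: k => [|k] in Sku uk Dk *.
    rewrite /Phi /partial !big_ord0 !addr0 x0 /delta /w expr0 expr1n !mulr1.
    by rewrite divfK ?expf_neq0 ?gt_eqF //; have := F0 u; have := FA; lra.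
  have [_ /(_ u Du (SS _ _ Sku).2)] := xP k.
  by rewrite -/(Phi k.+1 (x k.+1)) -/(Phi k.+1 u) /err; lra.
have xl k l : (k <= l)%N -> nrm (x l - x k) <= 3 * lam * w k.
  by move=> kl; apply: Snrm; exact: Sle kl (Sx l).
have [p Dp px] := Dcomplete Dx xl.
have px1 k : nrm (p - x k) <= 3 * lam.
  by apply: le_trans (px k) _; rewrite ler_piMr // mulr_ge0 // ltW.
(* [Phi k] is locally Lipschitz at [p], so the inequalities satisfied by the [x l] pass to their
   limit. *)
have PhiL k : exists2 K, 0 <= K & forall u, nrm (p - u) <= 1 -> Phi k p <= Phi k u + K * nrm (p - u).
  elim: k => [|k [K K0 KP]].
    by exists 1 => // u _; rewrite /Phi /partial !big_ord0 !addr0 mul1r.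
  exists (K + delta k * (2 * (3 * lam + 1) + 1)).
    by rewrite addr_ge0 // mulr_ge0 ?ltW // ltr_wpDl // mulr_ge0 // addr_ge0 // mulr_ge0 // ltW.
  move=> u pu; rewrite !PhiS; have h := KP u pu.
  have n0 := seminorm_ge0 nrms (p - u).
  have g1 : gauge (p - x k) <= gauge (u - x k) + (2 * (3 * lam + 1) + 1) * nrm (p - u).
    have := gaugeD (u - x k) (p - u); rewrite addrC addrA subrK.
    have : nrm (u - x k) <= 3 * lam + 1.
      have := nrms.1 (u - p) (p - x k); rewrite addrA subrK (seminorm_distC nrms u p).
      by have := px1 k; lra.
    move: (nrm (p - u)) n0 pu => n n0 n1 h1 h2.
    have : nrm (u - x k) * n <= (3 * lam + 1) * n by rewrite ler_wpM2r.
    have : n ^+ 2 <= n by rewrite expr2 ler_piMr.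
    by lra.
  have := ler_wpM2l (ltW (delta0 k)) g1; lra.
have Sp k : Phi k.+1 p <= Phi k (x k).
  have [K K0 KP] := PhiL k.+1; apply/ler_addgt0Pr => e e0.
  have [l1 hl1] := half_expn_small (mulr_ge0 K0 (mulr_ge0 (ler0n R 3) (ltW lam0))) e0.
  have [l2 hl2] := half_expn_small (mulr_ge0 (ler0n R 3) (ltW lam0)) (@ltr01 R).
  pose l := (k + (l1 + l2))%N.
  have wl m : (m <= l)%N -> w l <= w m.
    by move=> ml; rewrite ler_wiXn2l ?invr_ge0 // invf_le1 // ler1n.
  have pl : nrm (p - x l) <= 3 * lam * w l := px l.
  have l3 : 0 <= 3 * lam by rewrite mulr_ge0 // ltW.
  have l1l : (l1 <= l)%N by rewrite /l addnCA leq_addr.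
  have l2l : (l2 <= l)%N by rewrite /l addnA leq_addl.
  have pl1 : nrm (p - x l) <= 1.
    by have := ler_wpM2l l3 (wl _ l2l); move: hl2; rewrite -/(w l2); lra.
  have pl2 : K * nrm (p - x l) <= e.
    have := ler_wpM2l K0 pl; have := ler_wpM2l (mulr_ge0 K0 l3) (wl _ l1l).
    by move: hl1; rewrite -/(w l1); lra.
  have [_ Sl] := Sle k l _ (leq_addr _ _) (Sx l).
  by have := KP _ pl1; lra.
have Phimono k l u : (k <= l)%N -> Phi k u <= Phi l u.
  move=> /subnK <-; elim: (l - k)%N => [//|m IH]; apply: le_trans IH _.
  by rewrite addSn PhiS lerDl mulr_ge0 // ltW.
have xmono k l : (k <= l)%N -> Phi l (x l) <= Phi k (x k).
  move=> /subnK <-; elim: (l - k)%N => [//|m IH]; apply: le_trans _ IH.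
  by rewrite addSn; exact: (xP _).1.
(* Either [u] stays in every [S i], and then it is at seminorm distance 0 from [p]; or it is
   discarded at some [i], and its value already exceeds [Phi i (x i)], which bounds all later values
   at [p]. *)
have pmin u J : D u -> exists J', Phi J p <= Phi J' u.
  move=> Du; have [uS|/existsNP[i uSi]] := pselect (forall i, S i u).
    exists J; have up : nrm (p - u) <= 0.
      apply/ler_addgt0Pr => e e0; rewrite add0r.
      have [k hk] := half_expn_small (mulr_ge0 (ler0n R 6) (ltW lam0)) e0.
      have := Snrm k u (uS k); have := px k; have := seminormB nrms (p - x k) (u - x k).
      by rewrite opprB addrA subrK /w; lra.
    have up0 : nrm (p - u) = 0 by apply/eqP; rewrite eq_le up seminorm_ge0.
    have [K K0 /(_ u)] := PhiL J; rewrite up0 mulr0 addr0; exact.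
  exists i.+1; have ui : Phi i (x i) < Phi i.+1 u.
    by rewrite ltNge; apply/negP => ?; apply: uSi.
  apply: le_trans (Phimono J (i + J).+1 p _) _; first by rewrite -addnS (leq_trans (leqnSn J)) // leq_addl.
  apply: le_trans (Sp _) _; apply: le_trans (xmono i _ (leq_addr _ _)) (ltW ui).
have px0 : nrm (p - p0) <= 3 * lam by rewrite -x0.
have Al : 0 < A / lam ^+ 2 by rewrite divr_gt0 // exprn_gt0.
have sumd J : \sum_(k < J) delta k <= 2 * (A / lam ^+ 2).
  rewrite -mulr_sumr mulrC ler_pM2r //; apply: (@le_trans _ _ (\sum_(k < J) w k)).
    by apply: ler_sum => k _; rewrite expr2 ler_piMr // ltW.
  by rewrite /w sum_half; have := w0 J; rewrite /w; lra.
pose T u := sup (range (fun J => partial x J u)).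
have gq k q : gauge (p - x k + q) <= gauge (p - x k) + (6 * lam * nrm q + nrm q ^+ 2).
  apply: le_trans (gaugeD _ _) _; rewrite -addrA lerD2l lerD2r ler_wpM2r ?(seminorm_ge0 nrms) //.
  by have := px1 k; lra.
have g0 k : gauge (p - x k) <= 9 * lam ^+ 2.
  have := gaugeD 0 (p - x k); rewrite add0r gauge0 (seminorm0 nrms) mulr0 mul0r !add0r.
  have : nrm (p - x k) ^+ 2 <= (3 * lam) ^+ 2.
    by rewrite ler_sqr ?nnegrE ?(seminorm_ge0 nrms) // mulr_ge0 // ltW.
  by rewrite exprMn; lra.
have partD J q : partial x J (p + q) <=
    partial x J p + 2 * (A / lam ^+ 2) * (6 * lam * nrm q + nrm q ^+ 2).
  have c0 : 0 <= 6 * lam * nrm q + nrm q ^+ 2.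
    by rewrite addr_ge0 ?sqr_ge0 // mulr_ge0 ?(seminorm_ge0 nrms) // mulr_ge0 // ltW.
  apply: (@le_trans _ _ (partial x J p + (\sum_(k < J) delta k) * (6 * lam * nrm q + nrm q ^+ 2))).
    rewrite mulr_suml -big_split /=; apply: ler_sum => k _.
    by rewrite -mulrDr ler_pM2l // addrAC; exact: gq.
  by rewrite lerD2l ler_wpM2r.
have Tub u : has_ubound (range (fun J => partial x J u)).
  exists (2 * (A / lam ^+ 2) * (9 * lam ^+ 2) +
    2 * (A / lam ^+ 2) * (6 * lam * nrm (u - p) + nrm (u - p) ^+ 2)) => _ [J _ <-].
  have := partD J (u - p); rewrite addrC subrK.
  have : partial x J p <= 2 * (A / lam ^+ 2) * (9 * lam ^+ 2).
    apply: (@le_trans _ _ ((\sum_(k < J) delta k) * (9 * lam ^+ 2))).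
      by rewrite mulr_suml; apply: ler_sum => k _; rewrite ler_pM2l.
    by rewrite ler_wpM2r // mulr_ge0 // sqr_ge0.
  lra.
have Tne u : range (fun J => partial x J u) !=set0 by exists (partial x 0 u), 0%N.
have leT J u : partial x J u <= T u by apply: ub_le_sup => //; exists J.
have Tle u b : (forall J, partial x J u <= b) -> T u <= b.
  by move=> h; apply: ge_sup => // _ [J _ <-].
have partmono J J' u : (J <= J')%N -> partial x J u <= partial x J' u.
  by move=> /Phimono JJ; have := JJ u; rewrite lerD2l.
have Tadh u e : 0 < e -> exists J, T u - e < partial x J u.
  by move=> e0; have [_ [J _ <-] ?] := sup_adherent e0 (conj (Tne u) (Tub u)); exists J.
exists p, (fun q => T (p + q) - T p); split=> //.
  move=> q Dq; suff : F p + T p <= F (p + q) + T (p + q) by lra.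
  rewrite -lerBrDl; apply: Tle => J; have [J' h] := pmin _ J Dq.
  by have := leT J' (p + q); move: h; rewrite /Phi; lra.
split=> [t q q' /andP[t0 t1]||q|r r0].
- have u0 : 0 <= 1 - t by rewrite subr_ge0.
  suff : T (p + (t *: q + (1 - t) *: q')) <= t * T (p + q) + (1 - t) * T (p + q') by lra.
  apply: Tle => J; apply: (@le_trans _ _ (t * partial x J (p + q) + (1 - t) * partial x J (p + q'))).
    rewrite !mulr_sumr -big_split /=; apply: ler_sum => k _.
    rewrite 2!(mulrCA _ (delta k)) -mulrDr ler_pM2l //.
    have -> : p + (t *: q + (1 - t) *: q') - x k = t *: (p + q - x k) + (1 - t) *: (p + q' - x k).
      rewrite (addrAC p q) (addrAC p q') (addrAC p (_ + _)) 2!(scalerDr _ (p - x k)) [RHS]addrACA -scalerDl.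
      by rewrite (_ : t + (1 - t) = 1) ?scale1r //; ring.
    by apply: gauge_convex; rewrite t0.
  by apply: lerD; apply: ler_wpM2l.
- by rewrite addr0 subrr.
- have : T (p + q) <= T p + 2 * (A / lam ^+ 2) * (6 * lam * nrm q + nrm q ^+ 2).
    by apply: Tle => J; apply: le_trans (partD J q) _; rewrite lerD2r.
  have -> : A / lam = A / lam ^+ 2 * lam by field; rewrite gt_eqF.
  by lra.
(* A crude Lipschitz bound for second differences when [nrm q <= 1]: two increments of at most
   [6 * lam + 1] each. It handles the terms from [m] on; smoothness of the gauge handles the
   finitely many before. *)
pose C := 12 * lam + 2.
have C0 : 0 <= C by rewrite addr_ge0 // mulr_ge0 // ltW.
have a0 : 0 < A / lam ^+ 2 * 4 by rewrite mulr_gt0.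
have e0 : 0 < r / (A / lam ^+ 2 * 4) by rewrite divr_gt0.
have [m hm] := half_expn_small C0 e0.
have [g g0' gP] : exists2 g, 0 < g & forall k : nat, (k < m)%N -> forall q, M q -> nrm q <= g ->
    second_difference gauge (p - x k) q <= r / (A / lam ^+ 2 * 4) * nrm q.
  elim: m {hm} => [|m [g gp IH]]; first by exists 1.
  have [g' g'p hg'] := gauge_smooth (p - x m) e0.
  exists (Num.min g g') => [|k]; first by rewrite lt_min gp.
  rewrite ltnS leq_eqVlt => /predU1P[->|km] q Mq; rewrite le_min => /andP[qg qg'].
    exact: hg'.
  exact: IH.
exists (Num.min g 1) => [|q Mq]; first by rewrite lt_min g0' /=.
rewrite le_min => /andP[qg q1]; have n0 := seminorm_ge0 nrms q.
suff : T (p + q) + T (p - q) <= 2 * T p + r * nrm q by lra.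
apply/ler_addgt0Pr => e ep; have ep2 : 0 < e / 2 by rewrite divr_gt0.
have [J1 h1] := Tadh (p + q) _ ep2; have [J2 h2] := Tadh (p - q) _ ep2.
pose J := maxn J1 J2.
have := partmono J1 J (p + q) (leq_maxl _ _); have := partmono J2 J (p - q) (leq_maxr _ _).
have := leT J p.
suff : partial x J (p + q) + partial x J (p - q) - 2 * partial x J p <= r * nrm q by lra.
rewrite mulr_sumr -big_split -sumrB /=.
apply: (@le_trans _ _ (\sum_(k < J) A / lam ^+ 2 * w k * (2 * (r / (A / lam ^+ 2 * 4)) * nrm q))).
  apply: ler_sum => k _.
  have -> : delta k * gauge (p + q - x k) + delta k * gauge (p - q - x k)
      - 2 * (delta k * gauge (p - x k)) =
      A / lam ^+ 2 * w k * (w k * second_difference gauge (p - x k) q).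
    rewrite /second_difference /delta (addrAC p) (addrAC p (- q)) expr2; ring.
  have wk0 := w0 k; have wk1 := w1 k; rewrite ler_pM2l; last by rewrite mulr_gt0.
  have sdC : second_difference gauge (p - x k) q <= C * nrm q.
    have := gq k q; have := gq k (- q); rewrite (seminormN nrms) /second_difference /C.
    have : nrm q ^+ 2 <= nrm q by rewrite expr2 ler_piMr.
    by lra.
  have eq0 : 0 <= r / (A / lam ^+ 2 * 4) * nrm q by rewrite mulr_ge0 // ltW.
  have [km|mk] := ltnP k m.
    have := gP _ km _ Mq qg; move: eq0; move: (second_difference _ _ _) => s; rewrite -!mulrA.
    move: (r * _) => b b0 sb.
    apply: (@le_trans _ _ (w k * b)); first by rewrite ler_pM2l.
    by apply: (@le_trans _ _ b); [rewrite ler_piMl|lra].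
  apply: (@le_trans _ _ (w k * (C * nrm q))); first by rewrite ler_pM2l.
  have wm : w k <= w m by rewrite ler_wiXn2l ?invr_ge0 // invf_le1 // ler1n.
  apply: (@le_trans _ _ (w m * C * nrm q)).
    by rewrite -mulrA ler_wpM2r // mulr_ge0.
  apply: (@le_trans _ _ (r / (A / lam ^+ 2 * 4) * nrm q)); first by rewrite ler_wpM2r.
  by rewrite -mulrA; move: eq0; rewrite -mulrA; lra.
rewrite -mulr_suml -mulr_sumr.
have W2 : \sum_(k < J) w k <= 2 by rewrite /w sum_half; have := w0 J; rewrite /w; lra.
have -> : A / lam ^+ 2 * (\sum_(k < J) w k) * (2 * (r / (A / lam ^+ 2 * 4)) * nrm q) =
    (\sum_(k < J) w k) * (r * nrm q / 2) by field; rewrite !gt_eqF.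
have rn : 0 <= r * nrm q by rewrite mulr_ge0 // ltW.
have : 0 <= (2 - \sum_(k < J) w k) * (r * nrm q / 2).
  by rewrite mulr_ge0 ?subr_ge0 // divr_ge0.
by lra.
Qed.

End BorweinPreiss.

(** * The maximum norm and convex subgradients *)

Section MaxNorm.
Context {R : realType} {X : normedModType R} {n : nat}.
Implicit Types z : 'I_n -> X.

Lemma max_norm_leP z c : 0 <= c ->
  (max_norm z <= c) <-> (forall i, `|z i| <= c).
Proof.
move=> c0; split=> [zc i|zc]; last by apply: bigmax_le.
by apply: le_trans zc; exact: (@le_bigmax _ _ _ _ (fun i => `|z i|)).
Qed.

Lemma max_norm_ge0 z : 0 <= max_norm z.
Proof. exact: bigmax_ge_id. Qed.

Lemma le_max_norm z i : `|z i| <= max_norm z.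
Proof. exact: ((max_norm_leP z (max_norm_ge0 z)).1 (lexx _) i). Qed.

Lemma max_norm_seminorm : seminorm (@max_norm R X n).
Proof.
split=> [x y|t x].
  apply/max_norm_leP => [|i]; first by rewrite addr_ge0 ?max_norm_ge0.
  by apply: le_trans (ler_normD _ _) _; rewrite lerD ?le_max_norm.
apply/eqP; rewrite eq_le; apply/andP; split.
  apply/max_norm_leP => [|i]; first by rewrite mulr_ge0 ?max_norm_ge0.
  by rewrite normrZ ler_wpM2l // le_max_norm.
have [->|t0] := eqVneq t 0; first by rewrite normr0 mul0r max_norm_ge0.
rewrite -ler_pdivlMl ?normr_gt0 //; apply/max_norm_leP => [|i].
  by rewrite mulr_ge0 ?max_norm_ge0 // invr_ge0.
rewrite ler_pdivlMl ?normr_gt0 // -normrZ.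
exact: (le_max_norm (t *: x)).
Qed.

Lemma max_norm_eq0 z : max_norm z = 0 -> z = 0.
Proof.
move=> z0; apply/funext => i; apply/eqP; rewrite -normr_le0 -z0.
exact: le_max_norm.
Qed.

Definition diag (w : X) : 'I_n -> X := fun=> w.

Lemma diagD v w : diag (v + w) = diag v + diag w. Proof. by []. Qed.
Lemma diagZ t w : diag (t *: w) = t *: diag w. Proof. by []. Qed.
Lemma diagN w : diag (- w) = - diag w. Proof. by []. Qed.

Lemma max_norm_diag w : max_norm (diag w) <= `|w|.
Proof. by apply/max_norm_leP. Qed.

Definition single (i : 'I_n) (h : X) : 'I_n -> X := fun j => if j == i then h else 0.

Lemma max_norm_single i h : max_norm (single i h) = `|h|.
Proof.
apply/eqP; rewrite eq_le; apply/andP; split; last first.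
  by have := le_max_norm (single i h) i; rewrite /single eqxx.
by apply/max_norm_leP => // j; rewrite /single; case: eqP; rewrite ?normr0.
Qed.

Lemma single_linear i a x y : single i (a *: x + y) = a *: single i x + single i y.
Proof.
by apply/funext => j; rewrite /single !fctE; case: eqP; rewrite ?scaler0 ?addr0.
Qed.

Lemma sum_single z : z = \sum_i single i (z i).
Proof.
apply/funext => j; rewrite fct_sumE (bigD1 j) //= /single eqxx big1 ?addr0 // => i.
by rewrite eq_sym => /negbTE ->.
Qed.

End MaxNorm.

Section ConvexSubgradient.
Context {R : realType} {V : lmodType R}.

(** The cone is the one above the perspective [t * (Phi (t^-1 *: g) - Phi 0)], and convexity of
    [Phi] makes it closed under sums. The subgradient is algebraic; its bounds are derived where it
    is used. *)
Lemma convex_subgradient (Phi : V -> R) :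
  (forall t p q, 0 <= t <= 1 ->
     Phi (t *: p + (1 - t) *: q) <= t * Phi p + (1 - t) * Phi q) ->
  exists2 f, is_linear f & forall q, f q <= Phi q - Phi 0.
Proof.
move=> Pc; pose C := [set gr : V * R |
  exists2 t, 0 < t & t * (Phi (t^-1 *: gr.1) - Phi 0) <= gr.2].
have [||r|f fl fC] := @linear_below_cone _ _ C.
- split=> [g h r s [t /= t0 tr] [u /= u0 us]|t g r t0 [s /= s0 sr]].
    exists (t + u); rewrite /= ?addr_gt0 //.
    have tu : 0 < t + u by rewrite addr_gt0.
    have k01 : 0 <= t / (t + u) <= 1.
      rewrite ltW ?divr_gt0 //= ler_pdivrMr // mul1r lerDl; exact: ltW.
    have := Pc _ (t^-1 *: g) (u^-1 *: h) k01.
    have -> : 1 - t / (t + u) = u / (t + u) by field; rewrite gt_eqF.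
    have -> : (t / (t + u)) *: (t^-1 *: g) + (u / (t + u)) *: (u^-1 *: h) = (t + u)^-1 *: (g + h).
      by rewrite !scalerA !(mulrAC _ (t + u)^-1) !mulfV ?gt_eqF // !mul1r -scalerDr.
    move=> /(ler_wpM2l (ltW tu)).
    have -> : (t + u) * (t / (t + u) * Phi (t^-1 *: g) + u / (t + u) * Phi (u^-1 *: h)) =
        t * Phi (t^-1 *: g) + u * Phi (u^-1 *: h) by field; rewrite gt_eqF.
    by lra.
  exists (t * s); rewrite /= ?mulr_gt0 //.
  have -> : (t * s)^-1 *: (t *: g) = s^-1 *: g.
    by rewrite scalerA; congr (_ *: _); field; rewrite !gt_eqF.
  by rewrite -mulrA ler_pM2l.
- by move=> g; exists (Phi g - Phi 0); exists 1; rewrite //= invr1 scale1r mul1r.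
- by move=> [t t0 /=]; rewrite scaler0 subrr mulr0.
exists f => // q; apply: fC; exists 1 => //=.
by rewrite invr1 scale1r mul1r.
Qed.

End ConvexSubgradient.

Section GeometricCauchy.
Context {R : realType} {X : completeNormedModType R}.

Lemma geometric_cauchy (x : nat -> X) (C : R) :
  (forall k l, (k <= l)%N -> `|x l - x k| <= C * 2^-1 ^+ k) ->
  exists2 p, x @ \oo --> p & forall k, `|p - x k| <= C * 2^-1 ^+ k.
Proof.
move=> xC; have C0 : 0 <= C.
  by have := xC 0%N 0%N (leqnn _); rewrite subrr normr0 expr0 mulr1.
have xcvg : cvg (x @ \oo).
  apply: cauchy_cvg; apply: cauchy_exP => e e0.
  have [k hk] := half_expn_small C0 (divr_gt0 e0 (ltr0Sn R 1)).
  exists (x k); suff : \forall l \near \oo, ball (x k) e (x l) by [].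
  near=> l; rewrite -ball_normE /= distrC.
  apply: le_lt_trans (xC k l _) _; first by near: l; exact: nbhs_infty_ge.
  by rewrite mulrC; lra.
exists (lim (x @ \oo)); first exact: xcvg.
move=> k; have : `|x l - x k| @[l --> \oo] --> `|lim (x @ \oo) - x k|.
  by apply: cvg_norm; apply: cvgB => //; exact: cvg_cst.
move=> /cvgr_to_le; apply; near=> l; apply: xC.
by near: l; exact: nbhs_infty_ge.
Unshelve. all: by end_near. Qed.

End GeometricCauchy.

Section SublinearGauge.
Context {R : realType} {V : lmodType R}.
Variables (nrm N : V -> R) (M : set V).
Hypotheses (nrms : seminorm nrm) (Ns : sublinear N)
  (N1 : forall z, N z <= nrm z) (N2 : forall z, nrm z <= 2 * N z)
  (Nsmooth : forall z r, 0 < N z -> 0 < r -> exists2 g, 0 < g &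
     forall k, M k -> nrm k <= g -> second_difference N z k <= r * nrm k).

Let N0 z : 0 <= N z.
Proof. by have := seminorm_ge0 nrms z; have := N2 z; lra. Qed.

Lemma gauge_lipschitz z k : N (z + k) <= N z + nrm k.
Proof. by apply: le_trans (Ns.1 _ _) _; rewrite lerD2l. Qed.


Lemma sublinear_convex t p q : 0 <= t <= 1 ->
  N (t *: p + (1 - t) *: q) <= t * N p + (1 - t) * N q.
Proof.
have NZ s z : 0 <= s -> N (s *: z) = s * N z.
  rewrite le_eqVlt => /predU1P[<-|]; last exact: Ns.2.
  by rewrite scale0r mul0r (sublinear0 Ns).
by move=> /andP[t0 t1]; rewrite -!NZ ?subr_ge0 //; exact: Ns.1.
Qed.

Lemma sublinear_sqr_convex t p q : 0 <= t <= 1 ->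
  N (t *: p + (1 - t) *: q) ^+ 2 <= t * N p ^+ 2 + (1 - t) * N q ^+ 2.
Proof.
move=> t01; have c := sublinear_convex p q t01; have /andP[t0 t1] := t01.
apply: (@le_trans _ _ ((t * N p + (1 - t) * N q) ^+ 2)).
  by rewrite ler_sqr ?nnegrE // addr_ge0 // mulr_ge0 // subr_ge0.
have : 0 <= t * (1 - t) * (N p - N q) ^+ 2 by rewrite mulr_ge0 ?sqr_ge0 // mulr_ge0 // subr_ge0.
by nra.
Qed.

(** With [m = N z], [a = N (z + k)], [b = N (z - k)], one has [a ^+ 2 + b ^+ 2 - 2 * m ^+ 2 = 2 * m
    * (a + b - 2 * m) + (a - m) ^+ 2 + (b - m) ^+ 2]. The last two squares are at most [nrm k ^+ 2]
    each, and they alone remain when [m = 0]. *)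
Lemma sublinear_sqr_smooth z r : 0 < r -> exists2 g, 0 < g & forall k, M k -> nrm k <= g ->
  second_difference (fun x => N x ^+ 2) z k <= r * nrm k.
Proof.
move=> r0.
have bound k c : second_difference N z k <= c ->
    second_difference (fun x => N x ^+ 2) z k <= 2 * N z * c + 2 * nrm k ^+ 2.
  rewrite /second_difference => kc.
  have a1 := gauge_lipschitz z k; have a2 := gauge_lipschitz z (- k).
  have a3 := gauge_lipschitz (z + k) (- k); have a4 := gauge_lipschitz (z - k) k.
  move: a1 a2 a3 a4; rewrite subrK addrK (seminormN nrms).
  have := ler_wpM2l (N0 z) kc.
  move: (N z) (N (z + k)) (N (z - k)) (nrm k) (N0 z) => m a b e m0 h h1 h2 h3 h4.
  have sq c' : - e <= c' -> c' <= e -> c' ^+ 2 <= e ^+ 2.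
    move=> c1 c2; have : 0 <= (e - c') * (e + c') by rewrite mulr_ge0; lra.
    by rewrite !expr2; lra.
  have u1 : (a - m) ^+ 2 <= e ^+ 2 by apply: sq; lra.
  have u2 : (b - m) ^+ 2 <= e ^+ 2 by apply: sq; lra.
  by move: u1 u2; rewrite !expr2; lra.
have [z0|] := eqVneq (N z) 0.
  exists (r / 2) => [|k Mk kr]; first by rewrite divr_gt0.
  apply: le_trans (bound k _ (lexx _)) _; rewrite z0 mulr0 mul0r add0r.
  have n0 := seminorm_ge0 nrms k.
  have : nrm k * nrm k <= r / 2 * nrm k by rewrite ler_wpM2r.
  by rewrite expr2; lra.
move=> zn0; have z0 : 0 < N z by rewrite lt_def zn0 N0.
have r4 : 0 < r / (4 * N z) by rewrite divr_gt0 // mulr_gt0.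
have [g g0 gP] := Nsmooth z0 r4.
exists (Num.min g (r / 4)) => [|k Mk]; first by rewrite lt_min g0 divr_gt0.
rewrite le_min => /andP[kg kr]; apply: le_trans (bound k _ (gP k Mk kg)) _.
have n0 := seminorm_ge0 nrms k.
have : nrm k * nrm k <= r / 4 * nrm k by rewrite ler_wpM2r.
have -> : 2 * N z * (r / (4 * N z) * nrm k) = r / 2 * nrm k by field; rewrite gt_eqF.
by rewrite expr2; lra.
Qed.

End SublinearGauge.

(** * The minimiser *)

Section CoreMinimiser.
Context {R : realType} {X : completeNormedModType R} {n : nat}.
Variables (i0 : 'I_n) (Omega : 'I_n -> set X) (Y : set X) (M : set ('I_n -> X))
  (N : ('I_n -> X) -> R) (u a : 'I_n -> X) (lam : R).
Let mx := @max_norm R X n.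
Let dg := @diag R X n.
Hypotheses (Omega_closed : forall i, closed (Omega i)) (Y_closed : closed Y)
  (Ns : sublinear N) (N1 : forall z, N z <= mx z) (N2 : forall z, mx z <= 2 * N z)
  (Nsmooth : forall z r, 0 < N z -> 0 < r -> exists2 g, 0 < g &
     forall k, M k -> mx k <= g -> second_difference N z k <= r * mx k)
  (u_in : forall i, Omega i (u i) /\ Y (u i)) (Y0 : Y 0)
  (a0 : 0 < mx a) (lam0 : 0 < lam)
  (empty : forall w, `|w| <= 3 * lam -> exists i, ~ Omega i (w + u i + a i)).

Definition pair_norm (p : ('I_n -> X) * X) : R := max_norm p.1 + `|p.2|.

Lemma pair_norm_seminorm : seminorm pair_norm.
Proof.
have ms := @max_norm_seminorm R X n.
split=> [[x v] [y w]|t [x v]]; rewrite /pair_norm /=.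
  by rewrite addrACA lerD ?ms.1 // ler_normD.
by rewrite ms.2 normrZ mulrDr.
Qed.

(* Unlike [N], the square [N ^+ 2] is also smooth at 0. *)
Let gauge (p : ('I_n -> X) * X) : R := N p.1 ^+ 2 + N (dg p.2) ^+ 2.
Let ms := @max_norm_seminorm R X n.
Let ps := pair_norm_seminorm.

Let N0 z : 0 <= N z.
Proof. by have := max_norm_ge0 z; have := N2 z; rewrite /mx; lra. Qed.

Let mx_dg w : mx (dg w) = `|w|.
Proof.
apply/eqP; rewrite eq_le max_norm_diag /=.
exact: (le_max_norm (dg w) i0).
Qed.

Let gauge_ge q : pair_norm q ^+ 2 <= 8 * gauge q.
Proof.
have h1 : max_norm q.1 ^+ 2 <= (2 * N q.1) ^+ 2.
  by rewrite ler_sqr ?nnegrE ?N2 ?max_norm_ge0 // mulr_ge0.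
have h2 : `|q.2| ^+ 2 <= (2 * N (dg q.2)) ^+ 2.
  by rewrite ler_sqr ?nnegrE ?normr_ge0 -?mx_dg ?N2 // mulr_ge0.
rewrite /gauge /pair_norm; have := sqr_ge0 (max_norm q.1 - `|q.2|).
by move: h1 h2; rewrite !exprMn; nra.
Qed.

Let gaugeD p q : gauge (p + q) <= gauge p + 2 * pair_norm p * pair_norm q + pair_norm q ^+ 2.
Proof.
have ND z k : N (z + k) ^+ 2 <= N z ^+ 2 + 2 * mx z * mx k + mx k ^+ 2.
  have h := gauge_lipschitz Ns N1 z k; have k0 := max_norm_ge0 k.
  have : N (z + k) ^+ 2 <= (N z + mx k) ^+ 2.
    by rewrite ler_sqr ?nnegrE // addr_ge0 // max_norm_ge0.
  have := ler_wpM2r k0 (N1 z); rewrite sqrrD -mulr_natl /mx; lra.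
have h1 := ND p.1 q.1; have h2 := ND (dg p.2) (dg q.2); rewrite !mx_dg /mx in h1 h2.
rewrite /gauge /pair_norm /=.
have := max_norm_ge0 p.1; have := max_norm_ge0 q.1; have := normr_ge0 p.2.
have := normr_ge0 q.2; rewrite -[dg (_ + _)]/(dg p.2 + dg q.2).
move: h1 h2; move: (max_norm p.1) (max_norm q.1) (`|p.2|) (`|q.2|) => b c d e.
move=> h1 h2 e0 d0 c0 b0.
have := mulr_ge0 b0 e0; have := mulr_ge0 d0 c0; have := mulr_ge0 c0 e0.
by move: h1 h2; rewrite !expr2; lra.
Qed.

Let gauge_convex t p q : 0 <= t <= 1 ->
  gauge (t *: p + (1 - t) *: q) <= t * gauge p + (1 - t) * gauge q.
Proof.
move=> t01; have h1 := sublinear_sqr_convex ms Ns N2 p.1 q.1 t01.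
have := sublinear_sqr_convex ms Ns N2 (dg p.2) (dg q.2) t01.
by rewrite /gauge; move: h1; rewrite /=; lra.
Qed.

Let MM : set (('I_n -> X) * X) := [set k | M k.1 /\ M (dg k.2)].

Let gauge_smooth z r : 0 < r -> exists2 g, 0 < g &
  forall k, MM k -> pair_norm k <= g -> second_difference gauge z k <= r * pair_norm k.
Proof.
move=> r0.
have [g g0 gP] := sublinear_sqr_smooth ms Ns N1 N2 Nsmooth z.1 r0.
have [h h0 hP] := sublinear_sqr_smooth ms Ns N1 N2 Nsmooth (dg z.2) r0.
exists (Num.min g h) => [|k [Mk1 Mk2]]; first by rewrite lt_min g0.
rewrite le_min /pair_norm => /andP[kg kh].
have m0 := max_norm_ge0 k.1; have w0 := normr_ge0 k.2.
have h1 := gP k.1 Mk1; have h2 := hP (dg k.2) Mk2.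
have : second_difference gauge z k = second_difference (fun x => N x ^+ 2) z.1 k.1 +
    second_difference (fun x => N x ^+ 2) (dg z.2) (dg k.2).
  rewrite /second_difference /gauge /=.
  rewrite -[dg (_ + _)]/(dg z.2 + dg k.2) -[dg (_ - _)]/(dg z.2 - dg k.2); ring.
move=> ->; rewrite mulrDr lerD //.
  by apply: h1; rewrite /mx; lra.
by rewrite -mx_dg; apply: h2; rewrite -/(mx _) mx_dg; lra.
Qed.

Let D : set (('I_n -> X) * X) :=
  [set p | (forall i, Omega i (p.1 i) /\ Y (p.1 i)) /\ Y p.2].

Let Dcomplete (x : nat -> ('I_n -> X) * X) C : (forall k, D (x k)) ->
  (forall k l, (k <= l)%N -> pair_norm (x l - x k) <= C * 2^-1 ^+ k) ->
  exists2 p, D p & forall k, pair_norm (p - x k) <= C * 2^-1 ^+ k.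
Proof.
move=> Dx xC.
have /choice[p1 p1P] : forall i, exists p, (fun k => (x k).1 i) @ \oo --> p /\
    forall k, `|p - (x k).1 i| <= C * 2^-1 ^+ k.
  move=> i; have [k l kl|p pc pk] := @geometric_cauchy _ _ (fun k => (x k).1 i) C.
    apply: le_trans (xC k l kl); rewrite /pair_norm.
    have := le_max_norm (x l - x k).1 i; have := normr_ge0 (x l - x k).2; lra.
  by exists p.
have [k l kl|p2 p2c p2k] := @geometric_cauchy _ _ (fun k => (x k).2) C.
  apply: le_trans (xC k l kl); rewrite /pair_norm.
  by have := max_norm_ge0 (x l - x k).1; rewrite /=; lra.
have C0 : 0 <= C.
  have := xC 0%N 0%N (leqnn _); rewrite expr0 mulr1; apply: le_trans.
  exact: seminorm_ge0.
exists (p1, p2).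
  split=> [i|/=].
    have [pc _] := p1P i; split.
      have Dk : \forall k \near \oo, Omega i ((x k).1 i) by near=> k; have [/(_ i)[]] := Dx k.
      exact: (closed_cvg _ (@Omega_closed i) Dk _ pc).
    have Dk : \forall k \near \oo, Y ((x k).1 i) by near=> k; have [/(_ i)[]] := Dx k.
    exact: (closed_cvg _ Y_closed Dk _ pc).
  have Dk : \forall k \near \oo, Y (x k).2 by near=> k; case: (Dx k).
  exact: (closed_cvg _ Y_closed Dk _ p2c).
(* The limits of the two components only give the constant [2 * C]; passing through a later term
   [x l] restores [C]. *)
move=> k; apply/ler_addgt0Pr => e e0.
have [m hm] := half_expn_small (mulr_ge0 (ler0n R 2) C0) e0.
pose l := (k + m)%N.
have wl : 2^-1 ^+ l <= 2^-1 ^+ m :> R.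
  by rewrite ler_wiXn2l ?invr_ge0 // ?invf_le1 // ?ler1n // leq_addl.
have pl : pair_norm ((p1, p2) - x l) <= 2 * C * 2^-1 ^+ l.
  rewrite /pair_norm (_ : 2 * C * _ = C * 2^-1 ^+ l + C * 2^-1 ^+ l); last by ring.
  apply: lerD; last exact: p2k.
  apply/max_norm_leP => [|i]; first by rewrite mulr_ge0 // exprn_ge0 // invr_ge0.
  by have [_] := p1P i; apply.
have := ps.1 ((p1, p2) - x l) (x l - x k); rewrite addrA subrK.
have := xC k l (leq_addr _ _).
have := ler_wpM2l (mulr_ge0 (ler0n R 2) C0) wl.
lra.
Unshelve. all: by end_near. Qed.

Let F (p : ('I_n -> X) * X) : R := N (dg p.2 - p.1 + u + a).

(** Serves both cones. For Clarke normals, [Y] is the whole space, [M] is empty and [N] is the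
    maximum norm; for Frechet normals, [Y] is separable and [N] is smooth along [M], the vectors
    with entries in [Y]. If [v - x + u + a] were 0, then [v + u i + a i = x i] would be in [Omega i]
    for all [i], against [empty]. *)
Lemma core_minimiser : exists (x : 'I_n -> X) (v : X) (G : ('I_n -> X) * X -> R),
  [/\ (forall i, Omega i (x i) /\ Y (x i)) /\ Y v,
      max_norm (x - u) <= 3 * lam /\ `|v| <= 3 * lam,
      diag v - x + u + a <> 0,
      forall h w, (forall i, Y (x i + h i)) -> Y (v + w) ->
        (forall i, Omega i (x i + h i)) ->
        N (diag v - x + u + a) <= N (diag v - x + u + a + diag w - h) + G (h, w) &
  [/\ forall t q q', 0 <= t <= 1 ->
     G (t *: q + (1 - t) *: q') <= t * G q + (1 - t) * G q', G 0 = 0,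
   forall q, G q <= 12 * (mx a / lam) * pair_norm q +
     2 * (mx a / lam ^+ 2) * pair_norm q ^+ 2 &
   forall r, 0 < r -> exists2 g, 0 < g &
     forall h w, M h -> M (diag w) -> pair_norm (h, w) <= g ->
       G (h, w) + G (- h, - w) <= r * pair_norm (h, w)]].
Proof.
have gauge00 : gauge 0 = 0.
  by rewrite /gauge /= -[dg 0]/(0 : 'I_n -> X) (sublinear0 Ns) expr0n addr0.
have F1 p q : F p <= F q + pair_norm (p - q).
  have -> : F p = N ((dg q.2 - q.1 + u + a) + (dg (p.2 - q.2) - (p.1 - q.1))).
    rewrite /F; congr N; apply/funext => i; rewrite !fctE /dg /diag.
    have -> : p.2 - q.2 - (p.1 i - q.1 i) = (p.2 - p.1 i) - (q.2 - q.1 i).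
      by rewrite opprB [- (q.2 - _)]opprB addrACA [- q.2 + _]addrC addrACA.
    by rewrite [RHS]addrC -[q.2 - q.1 i + _ + _]addrA [RHS]addrA subrK addrA.
  apply: le_trans (gauge_lipschitz Ns N1 _ _) _; rewrite lerD2l.
  apply: le_trans (seminormB ms _ _) _; rewrite addrC /pair_norm lerD2l.
  by rewrite -/mx mx_dg.
have Dp0 : D (u, 0) by split.
have FA : F (u, 0) <= mx a.
  rewrite /F /=; apply: le_trans (N1 _) _.
  by rewrite -[dg 0]/(0 : 'I_n -> X) sub0r addNr add0r.
have [[x v] [G [Dp pl Gmin [Gc G0 Gle Gs]]]] := borwein_preiss ps gauge00 gauge_ge gaugeD
  gauge_convex gauge_smooth (fun p => N0 _) F1 Dcomplete Dp0 FA a0 lam0.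
have [Dx Yv] := Dp.
have xl : max_norm (x - u) <= 3 * lam /\ `|v| <= 3 * lam.
  move: pl; rewrite /pair_norm /= subr0.
  by have := max_norm_ge0 (x - u); have := normr_ge0 v; split; lra.
exists x, v, G; split=> //.
- move=> z0; have [i] := empty xl.2; apply.
  suff -> : v + u i + a i = x i by case: (Dx i).
  have := congr1 (fun f => f i) z0; rewrite !fctE /diag /= => /eqP.
  by rewrite -!addrA addrCA addrC subr_eq0 addrA => /eqP.
- move=> h w Yh Yw Oh.
  have := Gmin (h, w); rewrite /F /D /= => H; apply: le_trans (H _) _.
    by split=> // i; split; [exact: Oh|exact: Yh].
  rewrite lerD2r le_eqVlt; apply/orP; left; apply/eqP; congr N; apply/funext => i.
  rewrite !fctE /dg /diag opprD addrACA -[RHS]addrA.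
  by move: (v - x i) (w - h i) => s e; rewrite -!addrA; congr (_ + _); rewrite [LHS]addrC addrA.
- by split=> // r r0; have [g g0 gP] := Gs r r0; exists g => // h w Mh Mw; exact: (gP (h, w)).
Qed.

End CoreMinimiser.

(** * Dual functionals and Clarke normals *)

Section DualFunctional.
Context {R : realType} {X : normedModType R} {n : nat}.
Let ms := @max_norm_seminorm R X n.

(** The recession argument: a constant [c] disappears as [T] grows. *)
Lemma le_of_scaled (b c : R) : (forall T, 0 < T -> - c <= T * b) -> 0 <= b.
Proof.
move=> H; rewrite leNgt; apply/negP => b0; have nb : 0 < - b by lra.
have T0 : 0 < (`|c| + 1) / - b by rewrite divr_gt0 // ltr_wpDl.
have := H _ T0; rewrite invrN mulrN mulNr divfK ?lt_eqF //.
by have := ler_norm c; lra.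
Qed.

(** The four families of bounds on [f] generate the cone [C], and the hypothesis on [H] excludes a
    contradiction among them. Combinations that use [z] ([s > 0]) are rescaled to [s = 1]; those
    with [s = 0] are obtained in [base] from large multiples. *)
Lemma dual_functional (H : set (('I_n -> X) * R)) (z : 'I_n -> X) (eps : R) :
  convex_cone H -> H (0, 0) -> 0 <= eps ->
  (forall h r w, H (h, r) ->
     (1 - eps) * max_norm z <= (1 + eps) * max_norm (z - diag w - h) + eps * `|w| + r) ->
  exists f, [/\ is_linear f, forall h r, H (h, r) -> f h <= r,
    forall e, f e <= (1 + eps) * max_norm e, forall w, f (diag w) <= eps * `|w| &
    (1 - eps) * max_norm z <= f z].
Proof.
move=> [HD HZ] H0 e0 est; have e1 : 0 <= 1 + eps by lra.
pose C := [set gr : ('I_n -> X) * R | exists s h rh w e, [/\ 0 <= s, H (h, rh),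
  gr.1 = h + diag w + e - s *: z &
  rh + eps * `|w| + (1 + eps) * max_norm e - s * (1 - eps) * max_norm z <= gr.2]].
have base h r w : H (h, r) -> 0 <= r + eps * `|w| + (1 + eps) * max_norm (h + diag w).
  move=> Hh; apply: (@le_of_scaled _ (2 * eps * max_norm z)) => T T0.
  have := est _ _ (T *: w) (HZ T _ _ T0 Hh).
  have := seminormB ms z (T *: (h + diag w)); rewrite ms.2 normrZ gtr0_norm //.
  rewrite scalerDr opprD addrA addrAC -diagZ => h1 h2.
  have := ler_wpM2l e1 h1; lra.
have [||r|f fl fC] := @linear_below_cone _ _ C.
- split=> [g g' r r' [s [h [rh [w [e [/= s0 Hh -> hr]]]]]]
      [s' [h' [rh' [w' [e' [/= s0' Hh' -> hr']]]]]]|t g r t0 [s [h [rh [w [e [/= s0 Hh -> hr]]]]]]].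
    exists (s + s'), (h + h'), (rh + rh'), (w + w'), (e + e'); split=> /=.
    + exact: addr_ge0.
    + exact: HD.
    + by rewrite diagD scalerDl opprD addrACA; congr (_ + _);
        rewrite addrACA; congr (_ + _); rewrite addrACA.
    + have := ler_wpM2l e0 (ler_normD w w'); have := ler_wpM2l e1 (ms.1 e e'); lra.
  exists (t * s), (t *: h), (t * rh), (t *: w), (t *: e); split=> /=.
  + by rewrite mulr_ge0 // ltW.
  + exact: HZ.
  + by rewrite scalerBr !scalerDr scalerA.
  + by rewrite normrZ ms.2 gtr0_norm //; have := ler_wpM2l (ltW t0) hr; lra.
- move=> g; exists ((1 + eps) * max_norm g); exists 0, 0, 0, 0, g; split=> //=.
    by rewrite scale0r subr0 -[diag 0]/(0 : 'I_n -> X) !add0r.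
  by rewrite normr0; lra.
- move=> [s [h [rh [w [e [/= s0 Hh /esym gE hr]]]]]]; apply: le_trans hr.
  have eE : e = s *: z - (h + diag w).
    by apply/eqP; rewrite eq_sym subr_eq addrC eq_sym -subr_eq0; apply/eqP.
  have [sz|sn] := eqVneq s 0.
    have := base _ _ w Hh; rewrite eE sz scale0r sub0r (seminormN ms); lra.
  have sp : 0 < s by rewrite lt_def sn.
  have si : 0 < s^-1 by rewrite invr_gt0.
  have := est _ _ (s^-1 *: w) (HZ _ _ _ si Hh).
  have -> : z - diag (s^-1 *: w) - s^-1 *: h = s^-1 *: e.
    by rewrite eE scalerBr scalerA mulVf // scale1r -addrA -opprD (addrC (diag _)) scalerDr.
  rewrite ms.2 normrZ gtr0_norm //.
  move=> /(ler_wpM2l s0); rewrite (_ : s * ((1 + eps) * _ + _ + _) =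
    (1 + eps) * max_norm e + eps * `|w| + rh); last by field.
  lra.
have Cin s h rh w e : 0 <= s -> H (h, rh) -> f (h + diag w + e - s *: z) <=
    rh + eps * `|w| + (1 + eps) * max_norm e - s * (1 - eps) * max_norm z.
  by move=> s0 Hh; apply: fC; exists s, h, rh, w, e.
have d0 : diag 0 = 0 :> ('I_n -> X) by [].
have m0 : max_norm (0 : 'I_n -> X) = 0 by exact: seminorm0 ms.
exists f; split=> //.
- move=> h r Hh; have := Cin 0 h r 0 0 (lexx 0) Hh.
  by rewrite d0 m0 normr0 scale0r subr0 !addr0; lra.
- move=> e; have := Cin 0 0 0 0 e (lexx 0) H0.
  by rewrite d0 normr0 scale0r subr0 !add0r; lra.
- move=> w; have := Cin 0 0 0 w 0 (lexx 0) H0.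
  by rewrite m0 scale0r subr0 add0r addr0; lra.
- have := Cin 1 0 0 0 0 ler01 H0.
  by rewrite d0 m0 normr0 scale1r !add0r (is_linearN _ fl); lra.
Qed.

End DualFunctional.

Section ClarkeCone.
Context {R : realType} {X : normedModType R}.
Implicit Types (A : set X) (x : X).

Lemma clarke_tangent_cone0 A x : clarke_tangent_cone A x 0.
Proof.
move=> y t Ay yx t0 tc; exists (fun=> 0); first exact: cvg_cst.
by move=> k; rewrite scaler0 addr0.
Qed.

(** The points [y k + t k *: w k] again tend to [x] within [A], so the second tangent vector can be
    started from them. This freedom of the base points is what makes the Clarke cone convex. *)
Lemma clarke_tangent_coneD A x h k : clarke_tangent_cone A x h ->
  clarke_tangent_cone A x k -> clarke_tangent_cone A x (h + k).
Proof.
move=> Th Tk y t Ay yx t0 tc; have [w wh Aw] := Th y t Ay yx t0 tc.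
have [|w' wk Aw'] := Tk _ t Aw _ t0 tc.
  rewrite -[x in _ --> x]addr0 -(scale0r h).
  by apply: cvgD => //; apply: cvgZ.
exists (fun i => w i + w' i); first exact: cvgD.
by move=> i; rewrite scalerDr addrA.
Qed.

Lemma clarke_tangent_coneZ A x s h : 0 < s -> clarke_tangent_cone A x h ->
  clarke_tangent_cone A x (s *: h).
Proof.
move=> s0 Th y t Ay yx t0 tc; have [||w wh Aw] := Th y (fun k => t k * s) Ay yx.
- by move=> k; rewrite mulr_gt0.
- by rewrite -[X in _ --> X](mul0r s); apply: cvgM => //; exact: cvg_cst.
exists (fun k => s *: w k); first by apply: cvgZ => //; exact: cvg_cst.
by move=> k; rewrite scalerA.
Qed.

Lemma clarke_tangent_cone_near A x h e : A x -> clarke_tangent_cone A x h -> 0 < e ->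
  \forall k \near \oo, exists w, `|h - w| <= e /\ A (x + k.+1%:R^-1 *: w).
Proof.
move=> Ax Th e0; have tc : (fun k : nat => k.+1%:R^-1 : R) @ \oo --> (0 : R).
  exact: cvg_harmonic.
have t0 (k : nat) : 0 < k.+1%:R^-1 :> R by rewrite invr_gt0.
have [w wh Aw] := Th (fun=> x) (fun k => k.+1%:R^-1) (fun=> Ax) (cvg_cst x) t0 tc.
have H1 : \forall k \near \oo, `|h - w k| <= e by exact: cvgr_dist_le.
by apply: filterS H1 => k hk; exists (w k).
Qed.

End ClarkeCone.

Section DualEstimates.
Context {R : realType} {X : completeNormedModType R} {n : nat}.
Variables (i0 : 'I_n) (Omega : 'I_n -> set X) (u a : 'I_n -> X) (lam : R).
Hypotheses (Omega_closed : forall i, closed (Omega i))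
  (u_in : forall i, Omega i (u i)) (a0 : 0 < max_norm a) (lam0 : 0 < lam)
  (empty : forall w, `|w| <= 3 * lam -> exists i, ~ Omega i (w + u i + a i)).
Let ms := @max_norm_seminorm R X n.
Let kappa := 12 * (max_norm a / lam).
Let C2 := 2 * (max_norm a / lam ^+ 2).

Let kappa0 : 0 <= kappa.
Proof. by rewrite mulr_ge0 // divr_ge0 // ltW. Qed.
Let C20 : 0 <= C2.
Proof. by rewrite mulr_ge0 // divr_ge0 ?exprn_ge0 // ltW. Qed.

Lemma max_norm_le2 (z : 'I_n -> X) : max_norm z <= 2 * max_norm z.
Proof. by have := @max_norm_ge0 R X n z; lra. Qed.

(** Minimality is tested at a small multiple [t] of displacements close to tangent vectors;
    convexity of the norm and division by [t] give the first-order inequality [key], to which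
    [dual_functional] applies. *)
Lemma clarke_estimate : exists (x : 'I_n -> X) (v : X) (f : ('I_n -> X) -> R),
  [/\ forall i, Omega i (x i), max_norm (x - u) <= 3 * lam /\ `|v| <= 3 * lam,
    diag v - x + u + a <> 0, is_linear f &
   [/\ forall e, f e <= (1 + 2 * kappa) * max_norm e,
    forall w, f (diag w) <= 2 * kappa * `|w|,
    (1 - 2 * kappa) * max_norm (diag v - x + u + a) <= f (diag v - x + u + a) &
    forall i h, clarke_tangent_cone (Omega i) (x i) h -> f (single i h) <= 0]].
Proof.
have [||x [v [G [[xO _] xv z0 zmin [Gc G0 Gle _]]]]] := @core_minimiser R X n i0 Omega setT
  set0 (@max_norm R X n) u a lam Omega_closed closedT (seminorm_sublinear ms)
  (fun=> lexx _) max_norm_le2 _ _ I a0 lam0 empty.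
- by move=> z r _ _; exists 1.
- by move=> i; split.
set z := diag v - x + u + a in z0 zmin *.
have key h w : (forall i, clarke_tangent_cone (Omega i) (x i) (h i)) ->
    max_norm z <= max_norm (z + diag w - h) + kappa * (max_norm h + `|w|).
  move=> Th; apply/ler_addgt0Pr => e e0.
  (* Half of [e] pays for replacing [h] by the realised [h'], at a cost of [e' * (1 + kappa)]; the
     other half pays for the quadratic part of [G], through a small step [t]. *)
  pose e' := Num.min 1 (e / (2 * (1 + kappa))); pose P := max_norm h + 1 + `|w|.
  have k1 : 0 < 1 + kappa by rewrite ltr_pwDl.
  have e'0 : 0 < e' by rewrite lt_min ltr01 divr_gt0 // mulr_gt0.
  have P0 : 0 <= P by rewrite !addr_ge0 ?max_norm_ge0.
  have g0 : 0 < e / (2 * (C2 * P ^+ 2 + 1)).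
    by rewrite divr_gt0 // mulr_gt0 // ltr_wpDl // mulr_ge0 // sqr_ge0.
  have near1 : \forall k \near \oo, forall i,
      exists w', `|h i - w'| <= e' /\ Omega i (x i + k.+1%:R^-1 *: w').
    apply: filter_forall => i; apply: clarke_tangent_cone_near => //.
    by case: (xO i).
  have near2 : \forall k \near \oo, k.+1%:R^-1 < (PosNum g0)%:num.
    exact: near_infty_natSinv_lt.
  have [k [/choice[h' h'P] /= kg]] := filter_ex (filterI near1 near2).
  pose t : R := k.+1%:R^-1.
  have t0 : 0 < t by rewrite invr_gt0.
  have t1 : t <= 1 by rewrite invf_le1 // ler1n.
  have hh' : max_norm (h - h') <= e'.
    by apply/max_norm_leP => [|i]; [exact: ltW|case: (h'P i)].
  have h'O i : Omega i (x i + (t *: h') i) by have [] := h'P i.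
  have := zmin (t *: h') (t *: w) (fun=> I) I h'O.
  have -> : z + diag (t *: w) - t *: h' = t *: (z + diag w - h') + (1 - t) *: z.
    rewrite -(addrA z (diag w)) (scalerDr t z) scalerBl scale1r [RHS]addrC addrA subrK.
    by rewrite -addrA diagZ scalerBr.
  have zc : max_norm (t *: (z + diag w - h') + (1 - t) *: z) <=
      t * max_norm (z + diag w - h') + (1 - t) * max_norm z.
    by apply: le_trans (ms.1 _ _) _; rewrite !ms.2 !ger0_norm ?subr_ge0 // ltW.
  have zh : max_norm (z + diag w - h') <= max_norm (z + diag w - h) + e'.
    have := ms.1 (z + diag w - h) (h - h'); rewrite addrA subrK; lra.
  have h'h : max_norm h' <= max_norm h + e'.
    by have := seminormB ms h (h - h'); rewrite opprB addrC subrK; lra.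
  have e'1 : e' <= 1 by rewrite ge_min lexx.
  have pP : pair_norm (t *: h', t *: w) <= t * (max_norm h + e' + `|w|).
    rewrite /pair_norm /= ms.2 normrZ gtr0_norm // -mulrDr ler_pM2l //; lra.
  have p0 := seminorm_ge0 (pair_norm_seminorm (X := X) (n := n)) (t *: h', t *: w).
  have pP2 : pair_norm (t *: h', t *: w) ^+ 2 <= t ^+ 2 * P ^+ 2.
    have tP : 0 <= t * P by rewrite mulr_ge0 // ltW.
    rewrite -exprMn ler_sqr ?nnegrE //.
    by apply: le_trans pP _; rewrite ler_pM2l // /P; lra.
  have e'e : e' * (1 + kappa) <= e / 2.
    rewrite -ler_pdivlMr //; apply: le_trans (_ : _ <= e / (2 * (1 + kappa))) _.
      by rewrite ge_min lexx orbT.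
    by rewrite le_eqVlt; apply/orP; left; apply/eqP; field; rewrite gt_eqF.
  have tC : t * (C2 * P ^+ 2) <= e / 2.
    have c0 : 0 <= C2 * P ^+ 2 by rewrite mulr_ge0 // sqr_ge0.
    apply: (@le_trans _ _ (e / (2 * (C2 * P ^+ 2 + 1)) * (C2 * P ^+ 2))).
      by rewrite ler_wpM2r // ltW.
    move: (C2 * P ^+ 2) c0 => D c0; have D1 : 0 < D + 1 by lra.
    have -> : e / (2 * (D + 1)) * D = e / 2 * (D / (D + 1)) by field; rewrite gt_eqF.
    by rewrite ler_piMr ?divr_ge0 ?(ltW e0) // ler_pdivrMr // mul1r; lra.
  have := Gle (t *: h', t *: w); have := ler_wpM2l kappa0 pP; have := ler_wpM2l C20 pP2.
  rewrite -/kappa -/C2 => g1 g2 g3 g4.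
  have zt := ler_wpM2l (ltW t0) zh.
  rewrite -(ler_pM2l t0); have tt : t * (t * (C2 * P ^+ 2)) <= t * (e / 2) by rewrite ler_pM2l.
  have te : t * (e' * (1 + kappa)) <= t * (e / 2) by rewrite ler_pM2l.
  rewrite expr2 in g1; lra.
pose H : set (('I_n -> X) * R) :=
  [set hr | (forall i, clarke_tangent_cone (Omega i) (x i) (hr.1 i)) /\ hr.2 = 0].
have [||||f [fl fH f1 fd fz]] := @dual_functional R X n H z (2 * kappa).
- split=> [g h r s [/= Tg ->] [/= Th ->]|t g r t0 [/= Tg ->]].
    by split; rewrite /= ?addr0 // => i; exact: clarke_tangent_coneD.
  by split; rewrite /= ?mulr0 // => i; exact: clarke_tangent_coneZ.
- by split=> // i; exact: clarke_tangent_cone0.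
- by rewrite mulr_ge0.
- move=> h r w [/= Th ->]; have := key h (- w) Th; rewrite diagN normrN addr0.
  (* Trading [max_norm h] for the other quantities raises the coefficient of the norm of [w] to
     [2 * kappa], hence the value of [eps]. *)
  have : max_norm h <= max_norm (z - diag w - h) + max_norm z + `|w|.
    have := seminormB ms (z - diag w) (z - diag w - h); rewrite opprB addrC subrK.
    move=> h3; apply: le_trans h3 _; rewrite [leLHS]addrC -[leRHS]addrA lerD2l.
    by apply: le_trans (seminormB ms _ _) _; rewrite lerD2l; exact: max_norm_diag.
  by move=> /(ler_wpM2l kappa0); have := mulr_ge0 kappa0 (max_norm_ge0 (z - diag w - h));
    have := mulr_ge0 kappa0 (max_norm_ge0 z); lra.
exists x, v, f; split=> //; first by move=> i; case: (xO i).
split=> // i h Th; apply: fH; split=> // j /=; rewrite /single.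
by case: eqP => [->//|_]; exact: clarke_tangent_cone0.
Qed.

End DualEstimates.

(** * Frechet normals relative to a subspace *)

Lemma le_of_small {R : realFieldType} (b c D : R) :
  (forall t, 0 < t <= 1 -> t * b <= t * c + D * t ^+ 2) -> b <= c.
Proof.
move=> H; apply/ler_addgt0Pr => e e0.
have D0 : 0 < `|D| + 1 by rewrite ltr_wpDl.
have g0 : 0 < e / (`|D| + 1) by rewrite divr_gt0.
pose t := Num.min 1 (e / (`|D| + 1)).
have t0 : 0 < t by rewrite lt_min ltr01.
have t1 : 0 < t <= 1 by rewrite t0 ge_min lexx.
have te : t * (`|D| + 1) <= e by rewrite -ler_pdivlMr // ge_min lexx orbT.
rewrite -(ler_pM2l t0); apply: le_trans (H t t1) _.
rewrite mulrDr lerD2l mulrC expr2 -mulrA ler_pM2l //; apply: le_trans te.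
by rewrite ler_pM2l //; have := ler_norm D; lra.
Qed.

Section FrechetRelative.
Context {R : realType} {X : completeNormedModType R} {n : nat}.
Variables (i0 : 'I_n) (Omega : 'I_n -> set X) (u a : 'I_n -> X) (lam e0 : R)
  (Y : set X) (N : ('I_n -> X) -> R).
Let ms := @max_norm_seminorm R X n.
Hypotheses (Omega_closed : forall i, closed (Omega i)) (Y_closed : closed Y)
  (sY : subspace Y)
  (Ns : sublinear N) (N1 : forall z, N z <= max_norm z)
  (N2 : forall z, (1 - e0) * max_norm z <= N z) (e02 : e0 <= 2^-1)
  (Nsmooth : forall z r, 0 < N z -> 0 < r -> exists2 g, 0 < g &
     forall k, (forall i, Y (k i)) -> max_norm k <= g ->
       second_difference N z k <= r * max_norm k)
  (u_in : forall i, Omega i (u i) /\ Y (u i)) (a_in : forall i, Y (a i))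
  (a0 : 0 < max_norm a) (lam0 : 0 < lam)
  (empty : forall w, `|w| <= 3 * lam -> exists i, ~ Omega i (w + u i + a i)).
Let kappa := 12 * (max_norm a / lam).
Let C2 := 2 * (max_norm a / lam ^+ 2).

Let kappa0 : 0 <= kappa.
Proof. by rewrite mulr_ge0 // divr_ge0 // ltW. Qed.
Let C20 : 0 <= C2.
Proof. by rewrite mulr_ge0 // divr_ge0 ?exprn_ge0 // ltW. Qed.

(** [f0] is a subgradient at 0 of the minimised function in its displacements. On feasible
    displacements [q], minimality gives [Phi q >= Phi 0], so [f0 (- q)] is at most the second
    difference of [Phi], which is small along [Y]. The functional sought is [- f0 (h, 0)]. *)
Lemma frechet_relative : exists (x : 'I_n -> X) (v : X) (f : ('I_n -> X) -> R),
  [/\ forall i, Omega i (x i) /\ Y (x i), Y v /\ is_linear f,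
    max_norm (x - u) <= 3 * lam /\ `|v| <= 3 * lam, diag v - x + u + a <> 0 &
   [/\ forall e, f e <= (1 + kappa) * max_norm e,
    forall w, Y w -> f (diag w) <= 2 * kappa * `|w|,
    (1 - e0 - kappa) * max_norm (diag v - x + u + a) <= f (diag v - x + u + a) &
    forall r, 0 < r -> exists2 g, 0 < g & forall i h, Y h -> Omega i (x i + h) ->
      `|h| <= g -> f (single i h) <= r * `|h|]].
Proof.
have [Y0 YD YZ] := sY.
have YN y : Y y -> Y (- y) by rewrite -scaleN1r; exact: YZ.
have N2' z : max_norm z <= 2 * N z.
  have := N2 z; have := max_norm_ge0 z; have := e02 => h1 h2 h3.
  have : 0 <= (2^-1 - e0) * max_norm z by rewrite mulr_ge0 // subr_ge0.
  by lra.
pose M := [set k : 'I_n -> X | forall i, Y (k i)].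
have [x [v [G [[xO Yv] xv z0 zmin [Gc G0 Gle Gs]]]]] := @core_minimiser R X n i0 Omega Y
  M N u a lam Omega_closed Y_closed Ns N1 N2' Nsmooth u_in Y0 a0 lam0 empty.
set z := diag v - x + u + a in z0 zmin *.
have Yz i : Y (z i).
  have [_ ?] := xO i; have [_ ?] := u_in i; have ? := a_in i.
  by rewrite /z !fctE /diag; do 3 apply/YD => //; exact: (YN).
have zp : 0 < N z.
  have : max_norm z != 0 by apply/eqP => /max_norm_eq0.
  by rewrite neq_lt ltNge max_norm_ge0 /=; have := N2' z; lra.
have zE : diag v - x + u + a = z by [].
clearbody z.
pose Phi (q : ('I_n -> X) * X) := N (z + (diag q.2 - q.1)) + G q.
have Phi0 : Phi 0 = N z by rewrite /Phi /= -[diag 0]/(0 : 'I_n -> X) subr0 addr0 G0 addr0.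
have [t p q t01|f0 f0l f0P] := @convex_subgradient _ _ Phi.
  have := Gc t p q t01; have := sublinear_convex Ns (z + (diag p.2 - p.1)) (z + (diag q.2 - q.1)) t01.
  rewrite /Phi /=.
  suff -> : z + (diag (t *: p.2 + (1 - t) *: q.2) - (t *: p.1 + (1 - t) *: q.1)) =
      t *: (z + (diag p.2 - p.1)) + (1 - t) *: (z + (diag q.2 - q.1)) by lra.
  rewrite diagD !diagZ opprD addrACA -!scalerBr !scalerDr [RHS]addrACA -scalerDl.
  by rewrite (_ : t + (1 - t) = 1) ?scale1r //; ring.
have f0Z t q : f0 (t *: q) = t * f0 q by exact: is_linearZ.
have smooth r : 0 < r -> exists2 g, 0 < g & forall h w, (forall i, Y (h i)) -> Y w ->
    (forall i, Omega i (x i + h i)) -> pair_norm (h, w) <= g ->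
    - f0 (h, w) <= r * pair_norm (h, w).
  move=> r0; have r2 : 0 < r / 2 by rewrite divr_gt0.
  have [g1 g10 g1P] := Nsmooth zp r2; have [g2 g20 g2P] := Gs _ r2.
  exists (Num.min g1 g2) => [|h w Yh Yw Oh]; first by rewrite lt_min g10.
  rewrite le_min => /andP[hg1 hg2].
  have hw : max_norm (diag w - h) <= pair_norm (h, w).
    by apply: le_trans (seminormB ms _ _) _; rewrite /pair_norm addrC lerD2l max_norm_diag.
  have s1 : second_difference N z (diag w - h) <= r / 2 * max_norm (diag w - h).
    apply: g1P; last exact: le_trans hw hg1.
    by move=> i; apply/YD => //; exact: (YN).
  have := g2P h w Yh (fun=> Yw) hg2; move: s1; rewrite /second_difference.
  have := ler_wpM2l (ltW r2) hw.
  have xh i : Y (x i + h i) by apply/YD => //; case: (xO i).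
  have := zmin h w xh (YD _ _ Yv Yw) Oh; rewrite -addrA.
  have := f0P (- (h, w)); rewrite (is_linearN _ f0l) Phi0 /Phi /= diagN.
  have -> : - diag w - - h = - (diag w - h) by rewrite opprB opprK addrC.
  lra.
have bound q c : N (z + (diag q.2 - q.1)) - N z <= c -> f0 q <= c + G q.
  by have := f0P q; rewrite Phi0 /Phi; lra.
(* Only [v] moves here, so both [w] and [- w] are feasible and [f0] vanishes on these directions. *)
have f0w w : Y w -> 0 <= f0 (0, w).
  move=> Yw; rewrite -oppr_le0; apply/ler_addgt0Pr => r r0; rewrite add0r.
  have r0' : 0 < r / (`|w| + 1) by rewrite divr_gt0 // ltr_wpDl.
  have [g g0 gP] := smooth _ r0'.
  have w1 : 0 < `|w| + 1 by rewrite ltr_wpDl.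
  pose t := g / (`|w| + 1); have t0 : 0 < t by rewrite divr_gt0.
  have pn : pair_norm (0 : 'I_n -> X, t *: w) = t * `|w|.
    by rewrite /pair_norm /= (seminorm0 ms) add0r normrZ gtr0_norm.
  have := gP 0 (t *: w) (fun=> Y0) (YZ _ _ Yw).
  rewrite pn (_ : (0, t *: w) = t *: (0, w)); last by congr pair; rewrite scaler0.
  rewrite f0Z -mulrN mulrCA ler_pM2l // => H; apply: le_trans (H _ _) _.
  - by move=> i; rewrite addr0; case: (xO i).
  - rewrite /t -mulrA ler_piMr ?(ltW g0) // mulrC ler_pdivrMr // mul1r; lra.
  - by rewrite -mulrA ler_piMr ?(ltW r0) // mulrC ler_pdivrMr // mul1r; lra.
have f0w0 w : Y w -> f0 (0, w) = 0.
  move=> Yw; apply/eqP; rewrite eq_le f0w // andbT.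
  have := f0w _ (YN _ Yw); rewrite (_ : (0, - w) = - (0, w)); last by congr pair; rewrite oppr0.
  by rewrite (is_linearN _ f0l) oppr_ge0.
(* Testing along [t *: q] and letting [t] tend to 0 removes the quadratic part of the bound on
   [G]. *)
have gen q b : (forall t, 0 < t <= 1 -> N (z + t *: (diag q.2 - q.1)) - N z <= t * b) ->
    f0 q <= b + kappa * pair_norm q.
  move=> H; apply: (@le_of_small _ _ _ (C2 * pair_norm q ^+ 2)) => t t01.
  have /andP[t0 t1] := t01; have := Gle (t *: q); rewrite -/kappa -/C2.
  have pn : pair_norm (t *: q) = t * pair_norm q.
    by rewrite (pair_norm_seminorm (X := X) (n := n)).2 gtr0_norm.
  rewrite pn exprMn -f0Z; have := @bound (t *: q) (t * b).
  by rewrite /= diagZ -scalerBr => /(_ (H t t01)); lra.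
have fl : is_linear (fun h => - f0 (h, 0)).
  move=> c h k; rewrite (_ : (c *: h + k, 0) = c *: (h, 0) + (k, 0)) ?f0l; first by ring.
  by congr pair; rewrite /= ?scaler0 ?addr0.
have fN h : - f0 (h, 0) = f0 (- h, 0).
  by rewrite -(is_linearN _ f0l); congr f0; congr pair; rewrite oppr0.
have pn0 (h : 'I_n -> X) : pair_norm (- h, 0 : X) = max_norm h.
  by rewrite /pair_norm /= normr0 addr0; exact: (seminormN ms).
exists x, v, (fun h => - f0 (h, 0)); rewrite zE; split=> //; split.
- move=> e; rewrite fN mulrDl mul1r -pn0; apply: gen => t /andP[t0 _] /=.
  have := gauge_lipschitz Ns N1 z (t *: (diag 0 - - e)).
  by rewrite ms.2 gtr0_norm // -[diag 0]/(0 : 'I_n -> X) sub0r opprK pn0; lra.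
- move=> w Yw; rewrite fN.
  (* Moving [v] and all [x i] by the same vector leaves the argument of [N] unchanged, so only the
     slope of [G] counts. *)
  have -> : f0 (- diag w, 0) = f0 (diag (- w), - w).
    rewrite (_ : (diag (- w), - w) = (- diag w, 0) + (0, - w)); last first.
      by congr pair; rewrite ?addr0 ?add0r.
    by rewrite (is_linearD _ _ f0l) (f0w0 _ (YN _ Yw)) addr0.
  apply: (@le_trans _ _ (0 + kappa * pair_norm (diag (- w), - w))).
    by apply: gen => t _ /=; rewrite subrr scaler0 addr0 subrr mulr0.
  rewrite add0r (mulrC 2) -[leRHS]mulrA ler_wpM2l //.
  by rewrite /pair_norm /= normrN; have := max_norm_diag (n := n) (- w); rewrite normrN; lra.
- have := @gen (z, 0) (- N z); rewrite /=.
  have -> : pair_norm (z, 0 : X) = max_norm z by rewrite /pair_norm /= normr0 addr0.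
  move=> H; have := N2 z; suff : f0 (z, 0) <= - N z + kappa * max_norm z by lra.
  apply: H => t /andP[t0 t1]; rewrite -[diag 0]/(0 : 'I_n -> X) sub0r scalerN.
  rewrite -[X in X - t *: _]scale1r -scalerBl.
  have [->|t1'] := eqVneq t 1; first by rewrite subrr scale0r (sublinear0 Ns); lra.
  by rewrite Ns.2 ?subr_gt0 1?lt_neqAle ?t1' //; lra.
- move=> r r0; have [g g0 gP] := smooth r r0; exists g => // i h Yh Oh hg.
  have ph : pair_norm (single i h, 0 : X) = `|h|.
    by rewrite /pair_norm /= normr0 addr0 max_norm_single.
  rewrite -ph; apply: gP => //; last by rewrite ph.
  + by move=> j; rewrite /single; case: eqP.
  + by move=> j; rewrite /single; case: eqP => [->//|_]; rewrite addr0; case: (xO j).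
Qed.

End FrechetRelative.

(** * Separable reduction *)

Section GeneratedSequence.
Variables (T : countType) (X : choiceType) (x0 : X) (wit : T -> seq X -> X).

Fixpoint eval_tree (t : GenTree.tree unit) : X :=
  match t with
  | GenTree.Leaf _ => x0
  | GenTree.Node k l => if unpickle k is Some c then wit c (map eval_tree l) else x0
  end.

(** All terms built from the operations [wit] are enumerated, with [GenTree] as their countable
    syntax; [x0] is a junk value for invalid codes. *)
Lemma generated_sequence : exists e : nat -> X, forall c s,
  (forall x, x \in s -> exists j, e j = x) -> exists j, e j = wit c s.
Proof.
pose e (j : nat) := if unpickle j is Some t then eval_tree t else x0.
have eP x : (exists j, e j = x) <-> exists t, eval_tree t = x.
  split=> [[j <-]|[t <-]]; last by exists (pickle t); rewrite /e pickleK.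
  by rewrite /e; case: unpickle => [t|]; [exists t|exists (GenTree.Leaf tt)].
exists e => c s se; apply/eP.
suff [l <-] : exists l, map eval_tree l = s.
  by exists (GenTree.Node (pickle c) l); rewrite /= pickleK.
elim: s se => [|x s IH] se; first by exists [::].
have [|l lE] := IH; first by move=> y ys; apply: se; rewrite inE ys orbT.
have /eP[t tE] := se x (mem_head _ _).
by exists (t :: l); rewrite /= tE lE.
Qed.

End GeneratedSequence.

Lemma seminorm_sum {R : realType} {V : lmodType R} (nrm : V -> R) J (F : nat -> V) :
  seminorm nrm -> nrm (\sum_(j < J) F j) <= \sum_(j < J) nrm (F j).
Proof.
move=> ns; elim: J => [|J IH]; first by rewrite !big_ord0 (seminorm0 ns).
by rewrite !big_ord_recr /=; apply: le_trans (ns.1 _ _) _; rewrite lerD2r.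
Qed.

Lemma seminorm_sub_sum {R : realType} {V : lmodType R} (nrm : V -> R) z z' w J (F F' : nat -> V) :
  seminorm nrm -> nrm (z - w - \sum_(j < J) F j) <=
    nrm (z' - w - \sum_(j < J) F' j) + nrm (z - z') + \sum_(j < J) nrm (F j - F' j).
Proof.
move=> ns; have -> : z - w - \sum_(j < J) F j =
    (z' - w - \sum_(j < J) F' j) + (z - z') - \sum_(j < J) (F j - F' j).
  rewrite sumrB; move: (\sum_(j < J) F j) (\sum_(j < J) F' j) => S S'.
  by rewrite opprB [RHS]addrAC [_ + (S' - S)]addrA subrK [RHS]addrC !addrA subrK.
apply: le_trans (seminormB ns _ _) _; apply: lerD; first exact: ns.1.
exact: (seminorm_sum J (fun j => F j - F' j)).
Qed.

Section SeparableReduction.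
Context {R : realType} {X : completeNormedModType R} {n : nat}.
Variables (i0 : 'I_n) (Omega : 'I_n -> set X).
Let ms := @max_norm_seminorm R X n.

(** The dual form, through [dual_functional], of the existence of a functional with the required
    bounds, at least [(1 - eps) * max_norm z] at [z], and at most [mu] of the norm of [h] at
    [single i h] when [x i + h] is in [Omega i]. *)
Definition rel_estimate (Y : set X) (x z : 'I_n -> X) (eps : R) (mu : R -> R) : Prop :=
  forall w J (i : nat -> 'I_n) (h : nat -> X) (l : nat -> R), Y w ->
    (forall j, (j < J)%N -> [/\ Y (h j), Omega (i j) (x (i j) + h j) & 0 <= l j]) ->
    (1 - eps) * max_norm z <=
    (1 + eps) * max_norm (z - diag w - \sum_(j < J) l j *: single (i j) (h j)) +
    eps * `|w| + \sum_(j < J) l j * mu `|h j|.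

(* A code [(l, (q, q'))] lists triples (index, weight, radius) of rationals;
   [W 0] stands for [w] and [W j.+1] for a point of [Omega (i j)]. *)
Definition feasible (c : seq ('I_n * rat * rat) * (rat * rat)) (x z : 'I_n -> X)
    (W : nat -> X) : Prop :=
  [/\ max_norm (z - diag (W 0%N) - \sum_(j < size c.1)
        ratr (nth (i0, 0, 0) c.1 j).1.2 *: single (nth (i0, 0, 0) c.1 j).1.1
          (W j.+1 - x (nth (i0, 0, 0) c.1 j).1.1)) < ratr c.2.1,
      `|W 0%N| < ratr c.2.2 &
      forall j, (j < size c.1)%N -> Omega (nth (i0, 0, 0) c.1 j).1.1 (W j.+1) /\
        `|W j.+1 - x (nth (i0, 0, 0) c.1 j).1.1| < ratr (nth (i0, 0, 0) c.1 j).2].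

Lemma ex_separable_support (b : nat -> X) : exists e : nat -> X,
  [/\ forall k, exists j, e j = b k,
    forall (q1 q2 : rat) j1 j2, exists j, e j = ratr q1 *: e j1 + ratr q2 *: e j2 &
    forall c (jx jz : 'I_n -> nat), (exists W, feasible c (e \o jx) (e \o jz) W) ->
      exists2 W, feasible c (e \o jx) (e \o jz) W & forall k, exists j, e j = W k].
Proof.
pose xs (s : seq X) (i : 'I_n) := nth 0 s i.
pose zs (s : seq X) (i : 'I_n) := nth 0 s (n + i).
have /choice[Wit WitP] : forall cs : (seq ('I_n * rat * rat) * (rat * rat)) * seq X,
    exists W, (exists W, feasible cs.1 (xs cs.2) (zs cs.2) W) ->
      feasible cs.1 (xs cs.2) (zs cs.2) W.
  move=> cs; have [[W WP]|nW] := pselect (exists W, feasible cs.1 (xs cs.2) (zs cs.2) W).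
    by exists W.
  by exists (fun=> 0) => W; case: nW.
(* Three kinds of operations: the given points [b k], rational combinations of two arguments, and
   entry [k] of a feasible witness. In the last case the arguments list the [n] entries of [x] and
   then those of [z]. *)
pose wit (c : nat + (rat * rat) + (seq ('I_n * rat * rat) * (rat * rat)) * nat) (s : seq X) : X :=
  match c with
  | inl (inl k) => b k
  | inl (inr q) => ratr q.1 *: nth 0 s 0 + ratr q.2 *: nth 0 s 1
  | inr ck => Wit (ck.1, s) ck.2
  end.
have [e eP] := generated_sequence 0 wit.
exists e; split.
- by move=> k; have := eP (inl (inl k)) [::]; apply.
- move=> q1 q2 j1 j2; have := eP (inl (inr (q1, q2))) [:: e j1; e j2]; apply => x.
  by rewrite !inE => /orP[] /eqP ->; [exists j1|exists j2].
move=> c jx jz Wex.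
pose s := [seq e (jx i) | i <- enum 'I_n] ++ [seq e (jz i) | i <- enum 'I_n].
have sz (f : 'I_n -> nat) : size [seq e (f i) | i <- enum 'I_n] = n.
  by rewrite size_map size_enum_ord.
have nthE (f : 'I_n -> nat) (i : 'I_n) : nth 0 [seq e (f i) | i <- enum 'I_n] i = e (f i).
  by rewrite (nth_map i) ?size_enum_ord // nth_ord_enum.
have xsE : xs s = e \o jx.
  by apply/funext => i; rewrite /xs nth_cat sz ltn_ord nthE.
have zsE : zs s = e \o jz.
  by apply/funext => i; rewrite /zs nth_cat sz ltnNge leq_addr /= addKn nthE.
exists (Wit (c, s)); first by rewrite -xsE -zsE; apply: (WitP (c, s)); rewrite /= xsE zsE.
move=> k; have := eP (inr (c, k)) s; apply => x.
by rewrite mem_cat => /orP[] /mapP[i _ ->]; [exists (jx i)|exists (jz i)].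
Qed.

Section Support.
Variables (e : nat -> X).
Hypotheses
  (elin : forall (q1 q2 : rat) j1 j2, exists j, e j = ratr q1 *: e j1 + ratr q2 *: e j2)
  (ewit : forall c (jx jz : 'I_n -> nat), (exists W, feasible c (e \o jx) (e \o jz) W) ->
      exists2 W, feasible c (e \o jx) (e \o jz) W & forall k, exists j, e j = W k).

Definition support : set X := [set y | forall r, 0 < r -> exists j, `|y - e j| < r].

Lemma support_seq j : support (e j).
Proof. by move=> r r0; exists j; rewrite subrr normr0. Qed.

Lemma support_closed : closed support.
Proof.
move=> y cy r r0; have r2 : 0 < r / 2 by rewrite divr_gt0.
have [z [/(_ _ r2)[j zj]]] := cy _ (nbhsx_ballx y _ r2).
rewrite -ball_normE /= => yz; exists j.
by have := ler_normD (y - z) (z - e j); rewrite addrA subrK; lra.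
Qed.

Lemma support_subspace : subspace support.
Proof.
have [j0 j0E] := elin 0 0 0 0.
have Y0 : support 0.
  by rewrite (_ : 0 = e j0); [exact: support_seq|rewrite j0E rmorph0 !scale0r addr0].
have YD x y : support x -> support y -> support (x + y).
  move=> sx sy r r0; have r2 : 0 < r / 2 by rewrite divr_gt0.
  have [j xj] := sx _ r2; have [k yk] := sy _ r2; have [m mE] := elin 1 1 j k.
  exists m; rewrite mE rmorph1 !scale1r opprD addrACA.
  by have := ler_normD (x - e j) (y - e k); lra.
split=> // t x sx r r0.
have c0 : 0 < `|t| + 1 by rewrite ltr_wpDl.
have d0 : 0 < `|x| + 1 by rewrite ltr_wpDl.
have r1 : 0 < Num.min 1 (r / 2 / (`|t| + 1)) by rewrite lt_min ltr01 !divr_gt0.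
have [j] := sx _ r1; rewrite lt_min => /andP[xj1]; rewrite ltr_pdivlMr // => xj.
have r3 : t < t + r / 2 / (`|x| + 1) by rewrite ltrDl !divr_gt0.
have [q] := rat_in_itvoo r3; rewrite in_itv /= => /andP[q1 q2].
have [m mE] := elin q 0 j j; exists m; rewrite mE rmorph0 scale0r addr0.
have -> : t *: x - ratr q *: e j = t *: (x - e j) + (t - ratr q) *: e j.
  by rewrite scalerBr scalerBl addrA subrK.
apply: le_lt_trans (ler_normD _ _) _; rewrite !normrZ.
have h1 : `|t| * `|x - e j| <= `|x - e j| * (`|t| + 1).
  by have := normr_ge0 (x - e j); lra.
have ej : `|e j| <= `|x| + 1.
  by have := ler_normD x (e j - x); rewrite addrC subrK (distrC (e j)); lra.
have tq : `|t - ratr q| <= r / 2 / (`|x| + 1).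
  by rewrite ler_norml; apply/andP; split; lra.
have h2 : `|t - ratr q| * `|e j| <= r / 2.
  rewrite -[leRHS](@divfK _ (`|x| + 1)) ?gt_eqF //; exact: ler_pM.
lra.
Qed.

Lemma singleZB (i : 'I_n) c d (x y : X) :
  c *: single i x - d *: single i y = single i (c *: x - d *: y).
Proof.
apply/funext => j; rewrite !fctE /single; case: eqP => // _.
by rewrite !scaler0 subr0.
Qed.

(** Rational weight and radius for one term. If [hn] is nonzero, the radius is below
    [hn + 2 * th <= 3 * hn]; with a further error [th] this gives the 4 of [rel_estimate_transfer].
    A zero vector admits no such bound, but contributes nothing and receives weight 0. *)
Let approx_pair (th l hn : R) : 0 < th -> 0 <= l -> 0 <= hn -> (hn != 0 -> th <= hn) ->
  exists lr : rat * rat, [/\ 0 <= ratr lr.1 :> R, ratr lr.1 <= l, (l - ratr lr.1) * hn <= th * hn,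
    hn + th < ratr lr.2 & ratr lr.1 = 0 :> R \/ ratr lr.2 + th <= 4 * hn].
Proof.
move=> th0 l0 hn0 thn.
have lt1 : hn + th < hn + 2 * th by lra.
have [r] := rat_in_itvoo lt1; rewrite in_itv /= => /andP[r1 r2].
have [h0|h0] := eqVneq hn 0.
  exists (0, r); rewrite /= rmorph0 h0; split=> //; rewrite ?mulr0 //; last by left.
  by move: r1; rewrite h0.
have thh := thn h0.
have [lth|lth] := leP l th.
  exists (0, r); rewrite /= rmorph0; split=> //; last by left.
  by rewrite subr0 ler_wpM2r.
have lt2 : l - th < l by lra.
have [q] := rat_in_itvoo lt2; rewrite in_itv /= => /andP[q1 q2].
exists (q, r); split=> //=; [lra|exact: ltW| |right; lra].
by rewrite ler_wpM2r //; lra.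
Qed.

(** Any data in [X] are a feasible witness for some rational code, so the same code has a witness in
    the support; the estimate there differs from the desired one by arbitrarily small errors and the
    factor 4 in [mu]. *)
Lemma rel_estimate_transfer x z eps mu : (forall i, support (x i)) ->
  (forall i, support (z i)) -> 0 <= eps -> (forall t, 0 <= t -> 0 <= mu t) ->
  (forall s t, 0 <= s -> s <= t -> mu s <= mu t) ->
  rel_estimate support x z eps mu -> rel_estimate setT x z eps (fun t => mu (4 * t)).
Proof.
move=> xY zY e0 mu0 mumono est w J i h l _ hl; apply/ler_addgt0Pr => eta eta0.
pose B1 := \sum_(j < J) `|h j|; pose B2 := \sum_(j < J) l j.
have B10 : 0 <= B1 by apply: sumr_ge0.
have B20 : 0 <= B2 by apply: sumr_ge0 => j _; case: (hl j (ltn_ord j)).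
(* All approximations have the same accuracy [th], and their errors add up to at most [th * K]. In
   addition [th] is below every nonzero norm of an [h j], as [approx_pair] requires. *)
pose K := (1 + eps) * (3 + B1 + 2 * B2) + eps.
have K0 : 0 < K by rewrite ltr_pwDl // mulr_gt0 //; lra.
have [th1 th10 th1P] : exists2 th, 0 < th & forall j, (j < J)%N -> `|h j| != 0 -> th <= `|h j|.
  elim: (J) => [|m [th th0 IH]]; first by exists 1.
  have [hm|hm] := eqVneq `|h m| 0.
    exists th => // j; rewrite ltnS leq_eqVlt => /predU1P[->|/IH//].
    by rewrite hm eqxx.
  exists (Num.min th `|h m|) => [|j]; first by rewrite lt_min th0 lt_def hm normr_ge0.
  rewrite ltnS leq_eqVlt => /predU1P[->|jm] hj; first by rewrite ge_min lexx orbT.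
  by rewrite ge_min IH.
pose th := Num.min th1 (eta / K).
have th0 : 0 < th by rewrite lt_min th10 divr_gt0.
have thK : th * K <= eta by rewrite -ler_pdivlMr // ge_min lexx orbT.
have thh j : (j < J)%N -> `|h j| != 0 -> th <= `|h j|.
  by move=> jJ hj; apply: le_trans (th1P j jJ hj); rewrite ge_min lexx.
have /choice[lr lrP] : forall j, exists lr : rat * rat, (j < J)%N ->
    [/\ 0 <= ratr lr.1 :> R, ratr lr.1 <= l j, (l j - ratr lr.1) * `|h j| <= th * `|h j|,
    `|h j| + th < ratr lr.2 & ratr lr.1 = 0 :> R \/ ratr lr.2 + th <= 4 * `|h j|].
  move=> j; case: (ltnP j J) => jJ; last by exists (0, 0).
  have [_ _ lj] := hl j jJ.
  by have [lr ?] := approx_pair th0 lj (normr_ge0 (h j)) (thh j jJ); exists lr.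
have /choice[jx jxP] : forall k, exists m, `|x k - e m| < th by move=> k; exact: xY.
have /choice[jz jzP] : forall k, exists m, `|z k - e m| < th by move=> k; exact: zY.
pose cl := mkseq (fun j => (i j, (lr j).1, (lr j).2)) J.
pose lam j : R := ratr (lr j).1.
have szcl : size cl = J by rewrite size_mkseq.
have nthcl j : (j < J)%N -> nth (i0, 0, 0) cl j = (i j, (lr j).1, (lr j).2).
  exact: nth_mkseq.
pose Q W := max_norm (e \o jz - diag (W 0%N) - \sum_(j < J)
        lam j *: single (i j) (W j.+1 - e (jx (i j)))).
have QE W : max_norm (e \o jz - diag (W 0%N) - \sum_(j < size cl)
        ratr (nth (i0, 0, 0) cl j).1.2 *: single (nth (i0, 0, 0) cl j).1.1
          (W j.+1 - e (jx (nth (i0, 0, 0) cl j).1.1))) = Q W.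
  rewrite szcl /Q; congr (max_norm (_ - _)); apply: eq_bigr => j _.
  by rewrite nthcl.
pose W' k := if k is j.+1 then x (i j) + h j else w.
have Qlt : Q W' < Q W' + th by rewrite ltrDl.
have wlt : `|w| < `|w| + th by rewrite ltrDl.
have [q] := rat_in_itvoo Qlt; rewrite in_itv /= => /andP[q1 q2].
have [q'] := rat_in_itvoo wlt; rewrite in_itv /= => /andP[q'1 q'2].
have [|W] := @ewit (cl, (q, q')) jx jz.
  exists W'; split=> [||j]; [by have := q1; rewrite -(QE W')|by []|].
  rewrite /= szcl => jJ; rewrite nthcl //=.
  have [_ Oj _] := hl j jJ; have [_ _ _ rj _] := lrP j jJ; split=> //.
  have := ler_normD (h j) (x (i j) - e (jx (i j))); rewrite addrA [h j + _]addrC.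
  by have := jxP (i j); lra.
move=> [Qq Wq' WO] We; have {}Qq : Q W < ratr q by rewrite -(QE W); exact: Qq.
rewrite /= szcl in Wq' WO.
have YW k : support (W k) by have [j <-] := We k; exact: support_seq.
have [Y0 YD YZ] := support_subspace.
have lam0 j : (j < J)%N -> 0 <= lam j by move=> /lrP[].
have lamB2 : \sum_(j < J) lam j <= B2 by apply: ler_sum => j _; have [] := lrP j (ltn_ord j).
have Wj j : (j < J)%N -> [/\ support (W j.+1 - x (i j)),
    Omega (i j) (x (i j) + (W j.+1 - x (i j))) & 0 <= lam j].
  move=> jJ; have := WO j jJ; rewrite nthcl //= => -[Oj _]; split; last exact: lam0.
    by rewrite -[- x _]scaleN1r; apply/YD/YZ.
  by rewrite addrC subrK.
apply: le_trans (est (W 0%N) J i (fun j => W j.+1 - x (i j)) lam (YW 0%N) Wj) _.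
pose ez : 'I_n -> X := e \o jz.
have mz : max_norm (z - ez) <= th.
  by apply/max_norm_leP => [|k]; [exact: ltW|apply: ltW; exact: jzP].
have zm : max_norm (ez - z) <= th by rewrite (seminorm_distC ms).
have step1 : max_norm (z - diag (W 0%N) - \sum_(j < J) lam j *: single (i j) (W j.+1 - x (i j))) <=
    ratr q + th + th * B2.
  apply: le_trans (seminorm_sub_sum z ez (diag (W 0%N)) J
    (fun j => lam j *: single (i j) (W j.+1 - x (i j)))
    (fun j => lam j *: single (i j) (W j.+1 - e (jx (i j)))) ms) _.
  rewrite -/(Q W); apply: lerD; first by apply: lerD => //; exact: ltW.
  apply: le_trans (_ : \sum_(j < J) th * lam j <= _); last first.
    by rewrite -mulr_sumr ler_pM2l.
  apply: ler_sum => j _; have lj := lam0 j (ltn_ord j).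
  rewrite singleZB max_norm_single -scalerBr normrZ ger0_norm // mulrC ler_wpM2r //.
  rewrite opprB [X in `|X|]addrC addrA subrK distrC; apply: ltW.
  exact: jxP.
have step2 : Q W' <= max_norm (z - diag w - \sum_(j < J) l j *: single (i j) (h j)) +
    th + th * (B1 + B2).
  apply: le_trans (seminorm_sub_sum ez z (diag w) J
    (fun j => lam j *: single (i j) (W' j.+1 - e (jx (i j))))
    (fun j => l j *: single (i j) (h j)) ms) _.
  apply: lerD; first by rewrite lerD2l.
  apply: le_trans (_ : \sum_(j < J) th * (`|h j| + l j) <= _); last first.
    by rewrite -mulr_sumr big_split.
  apply: ler_sum => j _; have [lj ljl ljh _ _] := lrP j (ltn_ord j).
  have lj' : 0 <= l j - lam j by rewrite subr_ge0.
  rewrite singleZB max_norm_single /W' /=.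
  have -> : lam j *: (x (i j) + h j - e (jx (i j))) - l j *: h j =
      lam j *: (x (i j) - e (jx (i j))) - (l j - lam j) *: h j.
    by rewrite addrAC scalerDr scalerBl opprB addrA.
  apply: le_trans (ler_normB _ _) _.
  have -> : `|lam j *: (x (i j) - e (jx (i j)))| = lam j * `|x (i j) - e (jx (i j))|.
    by rewrite normrZ ger0_norm.
  have -> : `|(l j - lam j) *: h j| = (l j - lam j) * `|h j| by rewrite normrZ ger0_norm.
  rewrite [leRHS]mulrDr [leLHS]addrC; apply: lerD => //.
  by rewrite mulrC; apply: ler_pM => //; exact: ltW (jxP (i j)).
have step3 : \sum_(j < J) lam j * mu `|W j.+1 - x (i j)| <= \sum_(j < J) l j * mu (4 * `|h j|).
  apply: ler_sum => j _; have [lj ljl _ _ lor] := lrP j (ltn_ord j).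
  have mh : 0 <= mu (4 * `|h j|) by apply: mu0; rewrite mulr_ge0.
  have lj' : 0 <= l j by apply: le_trans lj ljl.
  have [lz|lr4] := lor; first by rewrite /lam lz mul0r mulr_ge0.
  apply: ler_pM => //; first exact: mu0.
  apply: mumono => //; have := WO j (ltn_ord j); rewrite nthcl //= => -[_ Wj'].
  apply: le_trans lr4; have := ler_normD (W j.+1 - e (jx (i j))) (e (jx (i j)) - x (i j)).
  by rewrite addrA subrK (distrC (e _)); have := jxP (i j); lra.
have e1 : 0 <= 1 + eps by lra.
have s12 : max_norm (z - diag (W 0%N) - \sum_(j < J) lam j *: single (i j) (W j.+1 - x (i j))) <=
    max_norm (z - diag w - \sum_(j < J) l j *: single (i j) (h j)) + th * (3 + B1 + 2 * B2) by lra.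
have W0 : `|W 0%N| <= `|w| + th by lra.
have := ler_wpM2l e1 s12; have := ler_wpM2l e0 W0; move: thK; rewrite /K; lra.
Qed.

End Support.
End SeparableReduction.

(** * Frechet normals in Asplund spaces *)

(** [mu t] is the supremum of the [y] paired in [A] with some [s <= t], finite by the linear bound.
    Monotonicity is needed because the transfer to [X] rounds norms upwards. *)
Lemma ex_modulus {R : realType} (A : set (R * R)) (C : R) : 0 <= C -> A (0, 0) ->
  (forall s y, A (s, y) -> 0 <= s /\ y <= C * s) ->
  (forall r, 0 < r -> exists2 g, 0 < g & forall s y, A (s, y) -> s <= g -> y <= r * s) ->
  exists mu : R -> R, [/\ forall t, 0 <= t -> 0 <= mu t,
    forall s t, 0 <= s -> s <= t -> mu s <= mu t, forall s y, A (s, y) -> y <= mu s &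
    forall r, 0 < r -> exists2 g, 0 < g & forall t, 0 <= t -> t <= g -> mu t <= r * t].
Proof.
move=> C0 A0 Ale Asmall; pose S t := [set y | exists2 s, s <= t & A (s, y)].
have S0 t : 0 <= t -> S t 0 by move=> t0; exists 0.
have Sub t : has_ubound (S t).
  exists (C * t) => y [s st /Ale[_ yC]]; apply: le_trans yC _.
  exact: ler_wpM2l.
exists (fun t => sup (S t)); split.
- by move=> t t0; apply: ub_le_sup => //; exact: S0.
- move=> s t s0 st; apply: ge_sup => [|y [s' s's Ay]]; first by exists 0; exact: S0.
  by apply: ub_le_sup => //; exists s' => //; exact: le_trans st.
- by move=> s y Ay; apply: ub_le_sup => //; exists s.
- move=> r r0; have [g g0 gP] := Asmall r r0; exists g => // t t0 tg.
  apply: ge_sup => [|y [s st Ay]]; first by exists 0; exact: S0.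
  apply: le_trans (gP s y Ay (le_trans st tg)) _.
  by rewrite ler_pM2l.
Qed.

Section DualDensity.
Context {R : realType} {X : completeNormedModType R} {n : nat}.
Variables (Y : set X) (g : nat -> X -> R).
Hypotheses (gb : forall j, dual_ball (g j))
  (gdense : forall f r, dual_ball f -> 0 < r ->
      exists j, forall y, Y y -> `|f y - g j y| <= r * `|y|).

(** A functional is the sum of its coordinate parts, each approximated separately; the choices of
    indices form a countable type. *)
Lemma product_dual_dense : exists2 d : nat -> ('I_n -> X) -> R,
  (forall j e, `|d j e| <= n%:R * max_norm e) &
  forall f r, is_linear f -> (forall e, `|f e| <= max_norm e) -> 0 < r ->
    exists j, forall y, (forall i, Y (y i)) -> `|f y - d j y| <= r * max_norm y.
Proof.
pose D (c : {ffun 'I_n -> nat}) (e : 'I_n -> X) : R := \sum_i g (c i) (e i).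
have sumn_le (b : 'I_n -> R) m : (forall i, b i <= m) -> \sum_i b i <= n%:R * m.
  move=> bm; apply: le_trans (ler_sum _ (fun i _ => bm i)) _.
  by rewrite sumr_const card_ord mulr_natl.
exists (fun j => if unpickle j is Some c then D c else fun=> 0) => [j e|f r fl fb r0].
  case: unpickle => [c|]; last by rewrite normr0 mulr_ge0 ?max_norm_ge0.
  apply: le_trans (ler_norm_sum _ _ _) _; apply: sumn_le => i.
  by apply: le_trans ((gb (c i)).2 _) (le_max_norm _ _).
have n1 : 0 < n%:R + 1 :> R by rewrite ltr_wpDl.
have rn : 0 < r / (n%:R + 1) by rewrite divr_gt0.
have /choice[c cP] : forall i : 'I_n, exists j, forall y, Y y ->
    `|f (single i y) - g j y| <= r / (n%:R + 1) * `|y|.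
  move=> i; apply: gdense => //; split=> [a x y|x].
    by rewrite single_linear fl.
  by apply: le_trans (fb _) _; rewrite max_norm_single.
exists (pickle [ffun i => c i]) => y Yy; rewrite pickleK.
have fE : f y = \sum_i f (single i (y i)).
  rewrite [in LHS](sum_single y) (big_morph f (fun s t => is_linearD s t fl) (is_linear0 fl)) //.
rewrite fE /D -sumrB; apply: le_trans (ler_norm_sum _ _ _) _.
apply: (@le_trans _ _ (n%:R * (r / (n%:R + 1) * max_norm y))).
  apply: sumn_le => i; rewrite ffunE; apply: le_trans (cP i _ (Yy i)) _.
  by rewrite ler_pM2l // le_max_norm.
have -> : n%:R * (r / (n%:R + 1) * max_norm y) = n%:R / (n%:R + 1) * (r * max_norm y).
  by field; rewrite gt_eqF.
rewrite ler_piMl ?mulr_ge0 ?max_norm_ge0 ?(ltW r0) // ler_pdivrMr // mul1r.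
by rewrite lerDl.
Qed.

End DualDensity.

Section FrechetEstimate.
Context {R : realType} {X : completeNormedModType R} {n : nat}.
Let ms := @max_norm_seminorm R X n.

Lemma weighted_sums_cone (P : 'I_n -> X -> Prop) (mu : R -> R) :
  convex_cone [set hr : ('I_n -> X) * R | exists J (i : nat -> 'I_n) (h : nat -> X) (l : nat -> R),
    [/\ forall j, (j < J)%N -> P (i j) (h j) /\ 0 <= l j,
      hr.1 = \sum_(j < J) l j *: single (i j) (h j) &
      hr.2 = \sum_(j < J) l j * mu `|h j|]].
Proof.
split=> [g h r s [J [i [k [l [/= ih -> ->]]]]] [J' [i' [k' [l' [/= ih' -> ->]]]]]|
    t g r t0 [J [i [k [l [/= ih -> ->]]]]]].
  pose c T (f f' : nat -> T) j := if (j < J)%N then f j else f' (j - J)%N.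
  have cl T (f f' : nat -> T) (j : 'I_J) : c T f f' (lshift J' j) = f j.
    by rewrite /c /= ltn_ord.
  have cr T (f f' : nat -> T) (j : 'I_J') : c T f f' (rshift J j) = f' j.
    by rewrite /c /= ltnNge leq_addr /= addKn.
  exists (J + J')%N, (c _ i i'), (c _ k k'), (c _ l l'); split=> [j jJ||] /=.
  - rewrite /c; case: ltnP => jJ'; first exact: ih.
    by apply: ih'; rewrite ltn_subLR.
  - by rewrite big_split_ord /=; congr (_ + _); apply: eq_bigr => j _; rewrite ?cl ?cr.
  - by rewrite big_split_ord /=; congr (_ + _); apply: eq_bigr => j _; rewrite ?cl ?cr.
exists J, i, k, (fun j => t * l j); split=> [j jJ||] /=.
- by have [? ?] := ih j jJ; split=> //; rewrite mulr_ge0 // ltW.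
- by rewrite scaler_sumr; apply: eq_bigr => j _; rewrite scalerA.
- by rewrite mulr_sumr; apply: eq_bigr => j _; rewrite mulrA.
Qed.

Variables (i0 : 'I_n) (Omega : 'I_n -> set X) (u a : 'I_n -> X) (lam e0 : R).
Hypotheses (aX : asplund X) (Omega_closed : forall i, closed (Omega i))
  (u_in : forall i, Omega i (u i)) (a0 : 0 < max_norm a) (lam0 : 0 < lam)
  (empty : forall w, `|w| <= 3 * lam -> exists i, ~ Omega i (w + u i + a i))
  (e00 : 0 < e0) (e02 : e0 <= 2^-1).
Let kappa := 12 * (max_norm a / lam).
Let eps := e0 + 2 * kappa.

Let kappa0 : 0 <= kappa.
Proof. by rewrite mulr_ge0 // divr_ge0 // ltW. Qed.
Let eps0 : 0 <= eps.
Proof. by apply: addr_ge0; [exact: ltW|apply: mulr_ge0]. Qed.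

(** The functional [f] found relative to [Y] only serves to verify [rel_estimate] on [Y]; the final
    [f'] comes from the transferred estimate and need not extend [f]. *)
Lemma frechet_estimate : exists (x : 'I_n -> X) (v : X) (f : ('I_n -> X) -> R),
  [/\ forall i, Omega i (x i), max_norm (x - u) <= 3 * lam /\ `|v| <= 3 * lam,
    diag v - x + u + a <> 0, is_linear f &
   [/\ forall e, f e <= (1 + eps) * max_norm e,
    forall w, f (diag w) <= eps * `|w|,
    (1 - eps) * max_norm (diag v - x + u + a) <= f (diag v - x + u + a) &
    forall r, 0 < r -> exists2 g, 0 < g & forall i h, Omega i (x i + h) ->
      `|h| <= g -> f (single i h) <= r * `|h|]].
Proof.
pose us := codom u ++ codom a.
have [e [eb elin ewit]] := ex_separable_support i0 Omega (fun k => nth 0 us k).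
have sY := support_subspace elin; set Y := support e in sY.
have clY : closed Y := support_closed (e := e).
have mem_us y : y \in us -> Y y.
  move=> yus; have [j ej] := eb (index y us).
  by rewrite nth_index // in ej; rewrite -ej; exact: support_seq.
have uY i : Y (u i) by apply: mem_us; rewrite mem_cat codom_f.
have aY i : Y (a i) by apply: mem_us; rewrite mem_cat codom_f orbT.
have [g gb gdense] := @separable_dual R X Y e aX sY (fun y r yY r0 => yY r r0).
have [d dB ddense] := product_dual_dense (n := n) gb gdense.
pose M := [set k : 'I_n -> X | forall i, Y (k i)].
have e01 : e0 <= 1 by have := e02; lra.
have [N [Ns N1 N2 Nsm]] := @ex_smooth_norm R _ (@max_norm R X n) M d n%:R e0 ms dB ddense
  (ler0n _ _) e00 e01.
have uin i : Omega i (u i) /\ Y (u i) by split.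
have [x [v [f [xO [Yv fl] xv z0 [f1 fd fz fsmall]]]]] := @frechet_relative R X n i0 Omega u a lam
  e0 Y N Omega_closed clY sY Ns N1 N2 e02 Nsm uin aY a0 lam0 empty.
rewrite -/kappa in f1 fd fz.
have zE : exists z, diag v - x + u + a = z by exists (diag v - x + u + a).
have {zE}[z zE] := zE; rewrite zE in z0 fz.
have [Y0 YD YZ] := sY.
have YN y : Y y -> Y (- y) by rewrite -scaleN1r; exact: YZ.
have Yz i : Y (z i).
  rewrite -zE !fctE /diag; apply/YD => //; apply/YD => //; apply/YD => //.
  by apply: (YN); case: (xO i).
pose A := [set sy : R * R | exists i h, [/\ Y h, Omega i (x i + h), sy.1 = `|h| &
  sy.2 = f (single i h)]].
have single0 i : single i (0 : X) = 0 by apply/funext => j; rewrite /single; case: eqP.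
have k1 : 0 <= 1 + kappa by rewrite addr_ge0.
have [|s y [i [h [/= Yh Oh -> ->]]]|r r0|mu [mu0 mumono muA musmall]] := @ex_modulus _ A (1 + kappa) k1.
- exists i0, 0; split; rewrite ?normr0 ?single0 ?(is_linear0 fl) //.
  by rewrite addr0; case: (xO i0).
- by split=> //; apply: le_trans (f1 _) _; rewrite max_norm_single.
- have [t t0 tP] := fsmall r r0; exists t => // s y [i [h [/= Yh Oh -> ->]]].
  exact: tP.
have relY : rel_estimate Omega Y x z eps mu.
  move=> w J i h l Yw hl.
  set S := \sum_(j < J) _; set m := max_norm _.
  have fS : f S <= \sum_(j < J) l j * mu `|h j|.
    rewrite /S (big_morph f (fun s t => is_linearD s t fl) (is_linear0 fl)); apply: ler_sum => j _.
    have [Yh Oh lj] := hl j (ltn_ord j); rewrite (is_linearZ _ _ fl) ler_wpM2l //.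
    by apply: muA; exists (i j), (h j).
  have fzE : f z = f (z - diag w - S) + f (diag w) + f S.
    by rewrite -!(is_linearD _ _ fl) addrAC !subrK.
  have m0 : 0 <= max_norm (z - diag w - S) by exact: max_norm_ge0.
  have := f1 (z - diag w - S); have := fd w Yw; move: fz; rewrite fzE /m.
  have : 0 <= kappa * max_norm z by rewrite mulr_ge0 ?max_norm_ge0.
  have : 0 <= kappa * max_norm (z - diag w - S) by rewrite mulr_ge0.
  have : 0 <= e0 * max_norm (z - diag w - S) by rewrite mulr_ge0 // ltW.
  have : 0 <= e0 * `|w| by rewrite mulr_ge0 // ltW.
  by rewrite /eps; lra.
have relX := rel_estimate_transfer elin ewit (fun i => (xO i).2) Yz eps0 mu0 mumono relY.
pose mu4 t := mu (4 * t).
have [||f' [fl' fH f1' fd' fz']] := dual_functional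
  (weighted_sums_cone (fun i h => Omega i (x i + h)) mu4) _ eps0 (z := z).
- by exists 0%N, (fun=> i0), (fun=> 0), (fun=> 0); split; rewrite //= big_ord0.
- move=> h r w [J [i [k [l [/= ih -> ->]]]]].
  by apply: relX => // j jJ; have [] := ih j jJ.
exists x, v, f'; rewrite zE; split=> //; first by move=> i; case: (xO i).
split=> // r r0; have r4 : 0 < r / 4 by rewrite divr_gt0.
(* The divisions by 4 undo the factor inside [mu4]. *)
have [t t0 tP] := musmall _ r4; exists (t / 4) => [|i h Oh ht]; first by rewrite divr_gt0.
apply: (@le_trans _ _ (mu4 `|h|)).
  apply: fH; exists 1%N, (fun=> i), (fun=> h), (fun=> 1); split=> //=.
  - by rewrite big_ord1 scale1r.
  - by rewrite big_ord1 mul1r.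
apply: le_trans (tP _ _ _) _; [by rewrite mulr_ge0|lra|lra].
Qed.

End FrechetEstimate.

(** * Dual norms and normalisation *)

Section DualNorm.
Context {R : realType} {X : normedModType R}.
Implicit Types f : X -> R.

Lemma is_linear_pack f (C : R) : is_linear f -> (forall x, `|f x| <= C * `|x|) ->
  exists2 F : {linear X -> R^o}, (forall x, F x = f x) & dual_space F.
Proof.
move=> fl fC.
pose Fm := GRing.isLinear.Build R X R^o *:%R f fl.
pose F : {linear X -> R^o} := HB.pack f Fm.
exists F => //; rewrite /dual_space /=.
apply: (linear_bounded_continuous F).1; apply/linear_boundedP.
apply: filterS (nbhs_pinfty_ge (num_real C)) => r Cr x.
by apply: le_trans (fC x) _; rewrite ler_wpM2r.
Qed.

Section Bounded.
Variables (f : X -> R) (C : R).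
Hypotheses (fl : is_linear f) (fC : forall x, `|f x| <= C * `|x|) (C0 : 0 <= C).

Let S := [set `|f z| | z in [set z : X | `|z| <= 1]].

Let S_ub : has_ubound S.
Proof.
by exists C => _ [z /= z1 <-]; apply: le_trans (fC z) _; rewrite ler_piMr.
Qed.

Let S0 : S 0.
Proof. by exists 0; rewrite /= ?normr0 // (is_linear0 fl) normr0. Qed.

Lemma dual_norm_ge0 : 0 <= dual_norm f.
Proof. exact: (ub_le_sup S_ub S0). Qed.

Lemma le_dual_norm x : f x <= dual_norm f * `|x|.
Proof.
have [->|x0] := eqVneq x 0; first by rewrite (is_linear0 fl) normr0 mulr0.
have xp : 0 < `|x| by rewrite normr_gt0.
rewrite -ler_pdivrMr // mulrC -(is_linearZ _ _ fl); apply: le_trans (ler_norm _) _.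
apply: ub_le_sup => //; exists (`|x|^-1 *: x) => //=.
by rewrite normrZ ger0_norm ?invr_ge0 // mulVf // gt_eqF.
Qed.

Lemma dual_norm_le b : (forall x, `|f x| <= b * `|x|) -> 0 <= b -> dual_norm f <= b.
Proof.
move=> fb b0; apply: ge_sup; first by exists 0.
by move=> _ [z /= z1 <-]; apply: le_trans (fb z) _; rewrite ler_piMr.
Qed.

Lemma dual_norm_adherent e : 0 < e -> exists2 x, `|x| <= 1 & dual_norm f - e < f x.
Proof.
move=> e0; have [_ [z /= z1 <-] ze] := sup_adherent e0 (conj (ex_intro _ _ S0) S_ub).
have [fz|fz] := leP 0 (f z); first by exists z => //; move: ze; rewrite ger0_norm.
exists (- z); first by rewrite normrN.
by move: ze; rewrite (is_linearN _ fl) ltr0_norm.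
Qed.

Lemma dual_normZ c : 0 <= c -> dual_norm (fun x => c * f x) = c * dual_norm f.
Proof.
rewrite le_eqVlt => /predU1P[<-|c0].
  rewrite mul0r; apply/eqP; rewrite eq_le; apply/andP; split.
    apply: ge_sup; first by exists 0, 0; rewrite /= ?normr0 // mul0r normr0.
    by move=> _ [z _ <-]; rewrite mul0r normr0.
  apply: ub_le_sup; first by exists 0 => _ [z _ <-]; rewrite mul0r normr0.
  by exists 0; rewrite /= ?normr0 // mul0r normr0.
have nE z : `|c * f z| = c * `|f z| by rewrite normrM gtr0_norm.
apply/eqP; rewrite eq_le; apply/andP; split.
  apply: ge_sup; first by exists `|c * f 0|, 0 => //=; rewrite normr0.
  move=> _ [z z1 <-]; rewrite nE ler_pM2l //.
  by apply: ub_le_sup => //; exists z.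
rewrite -ler_pdivlMl //; apply: ge_sup; first by exists 0.
move=> _ [z z1 <-]; rewrite ler_pdivlMl // -nE.
apply: ub_le_sup; last by exists z.
exists (c * C) => _ [y /= y1 <-]; rewrite nE ler_pM2l //.
by apply: le_trans (fC y) _; rewrite ler_piMr.
Qed.

End Bounded.

Lemma eq_dual_norm f g : f =1 g -> dual_norm f = dual_norm g.
Proof. by move=> /funext ->. Qed.

Lemma frechet_normal_coneP (A : set X) x (F : {linear X -> R^o}) : dual_space F ->
  (forall r, 0 < r -> exists2 g, 0 < g & forall h, A (x + h) -> `|h| <= g -> F h <= r * `|h|) ->
  frechet_normal_cone A x F.
Proof.
move=> Fd Fr; split=> //; apply/lee_addgt0Pr => r r0; rewrite add0e.
have [g g0 gP] := Fr r r0; apply: ge_ereal_inf.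
exists (ereal_sup ((fun y => (F (y - x) / `|y - x|)%:E) @`
  [set y | [/\ A y, y != x & `|y - x| <= g]])).
  exists [set y | [/\ A y, y != x & `|y - x| <= g]] => //.
  have xg : \forall y \near x, `|x - y| <= g by exact: (cvgr_dist_le _ _ (@cvg_id _ (nbhs x))).
  by apply: filterS xg => y yg yx Ay; rewrite /= distrC.
apply: ge_ereal_sup => _ [y [Ay yx yg] <-]; rewrite lee_fin.
have yp : 0 < `|y - x| by rewrite normr_gt0 subr_eq0.
rewrite ler_pdivrMr //; apply: gP => //.
by rewrite addrC subrK.
Qed.

End DualNorm.

Section Normalisation.
Context {R : realType} {X : normedModType R} {n : nat}.
Variables (f : ('I_n -> X) -> R) (z : 'I_n -> X) (eps : R).
Hypotheses (fl : is_linear f) (z0 : z <> 0) (e0 : 0 < eps) (e1 : eps <= 2^-1)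
  (f1 : forall e, f e <= (1 + eps) * max_norm e)
  (fd : forall w, f (diag w) <= eps * `|w|)
  (fz : (1 - eps) * max_norm z <= f z).
Let ms := @max_norm_seminorm R X n.
Let fi i h := f (single i h).

Let fsum e : f e = \sum_i fi i (e i).
Proof.
by rewrite [in LHS](sum_single e) (big_morph f (fun s t => is_linearD s t fl) (is_linear0 fl)).
Qed.

Let fil i : is_linear (fi i).
Proof. by move=> a x y; rewrite /fi single_linear fl. Qed.

Let fiC i x : `|fi i x| <= (1 + eps) * `|x|.
Proof.
rewrite ler_norml lerNl -(is_linearN _ (fil i)) /fi; apply/andP; split.
  by rewrite -normrN -(max_norm_single i) f1.
by rewrite -(max_norm_single i) f1.
Qed.

Let e10 : 0 <= 1 + eps. Proof. by have := e0; lra. Qed.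

Let s := \sum_i dual_norm (fi i).

Let zp : 0 < max_norm z.
Proof. by rewrite lt_def max_norm_ge0 andbT; apply/eqP => /max_norm_eq0. Qed.

Let s_ge : 1 - eps <= s.
Proof.
rewrite -(ler_pM2r zp); apply: le_trans fz _; rewrite fsum mulr_suml.
apply: ler_sum => i _; apply: le_trans (le_dual_norm (fil i) (fiC i) e10 _) _.
by rewrite ler_wpM2l ?le_max_norm // (dual_norm_ge0 (fil i) (fiC i) e10).
Qed.

Let s0 : 0 < s.
Proof. by have := s_ge; have := e1; lra. Qed.

(** The sum of the dual norms is dual to the maximum norm: nearly norming unit vectors of the
    coordinates form a single vector of the unit ball. *)
Let s_le : s <= 1 + eps.
Proof.
apply/ler_addgt0Pr => r r0; have n1 : 0 < n%:R + 1 :> R by rewrite ltr_wpDl.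
have rn : 0 < r / (n%:R + 1) by rewrite divr_gt0.
have /choice[x xP] : forall i, exists x, `|x| <= 1 /\
    dual_norm (fi i) - r / (n%:R + 1) < fi i x.
  by move=> i; have [x ? ?] := dual_norm_adherent (fil i) (fiC i) e10 rn; exists x.
have : f x <= 1 + eps.
  apply: le_trans (f1 x) _; rewrite ler_piMr //.
  by apply/max_norm_leP => // i; case: (xP i).
have : s - n%:R * (r / (n%:R + 1)) <= f x.
  have -> : n%:R * (r / (n%:R + 1)) = \sum_(i < n) r / (n%:R + 1).
    by rewrite sumr_const card_ord mulr_natl.
  rewrite fsum -sumrB.
  by apply: ler_sum => i _; apply: ltW; case: (xP i).
have : n%:R * (r / (n%:R + 1)) <= r.
  by rewrite mulrCA ler_piMr ?(ltW r0) // ler_pdivrMr // mul1r lerDl.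
lra.
Qed.

(** The factor is [s^-1] with [s] between [1 - eps] and [1 + eps]. The two constants [2 * eps] come
    from [s^-1 <= 2] and from [(1 - 2 * eps) * (1 + eps) <= 1 - eps]. *)
Lemma normalise : exists c (F : 'I_n -> {linear X -> R^o}), 0 < c /\
  [/\ forall i h, F i h = c * f (single i h), forall i, dual_space (F i),
    \sum_i dual_norm (F i) = 1,
    0 <= dual_norm (fun y => \sum_i F i y) <= 2 * eps &
    `|1 - (\sum_i F i (z i)) / max_norm z| <= 2 * eps].
Proof.
have c0 : 0 < s^-1 by rewrite invr_gt0.
have /choice[F FP] : forall i, exists F : {linear X -> R^o},
    (forall h, F h = s^-1 * fi i h) /\ dual_space F.
  move=> i; have [||F ? ?] := @is_linear_pack R X (fun h => s^-1 * fi i h) (s^-1 * (1 + eps)).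
  - by move=> a x y; rewrite fil; ring.
  - by move=> x; rewrite normrM gtr0_norm // -mulrA ler_pM2l.
  - by exists F.
have FE i h : F i h = s^-1 * fi i h by case: (FP i).
have Fsum y : \sum_i F i (y i) = s^-1 * f y.
  by rewrite fsum mulr_sumr; apply: eq_bigr => i _.
have s2 : s^-1 <= 2.
  by rewrite invf_ple ?posrE //; have := s_ge; have := e1; lra.
exists s^-1, F; split=> //; split.
- exact: FE.
- by move=> i; case: (FP i).
- rewrite (eq_bigr (fun i => s^-1 * dual_norm (fi i))); last first.
    move=> i _; rewrite (eq_dual_norm (FE i)).
    by rewrite (dual_normZ (fil i) (fiC i)) // ltW.
  by rewrite -mulr_sumr mulVf // gt_eqF.
- have dE : dual_norm (fun y => \sum_i F i y) = dual_norm (fun y => s^-1 * f (diag y)).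
    by apply: eq_dual_norm => y; rewrite -Fsum.
  have dl : is_linear (fun y => s^-1 * f (diag y)).
    by move=> a x y; rewrite diagD diagZ fl; ring.
  have dC y : `|s^-1 * f (diag y)| <= 2 * eps * `|y|.
    rewrite normrM gtr0_norm // -mulrA; apply: ler_pM => //; first exact: ltW.
    rewrite ler_norml fd andbT lerNl -(is_linearN _ fl) -diagN.
    by apply: le_trans (fd _) _; rewrite normrN.
  have ee : 0 <= 2 * eps by rewrite mulr_ge0 // ltW.
  by rewrite dE (dual_norm_ge0 dl dC ee) (dual_norm_le dl dC ee).
- rewrite Fsum; have h1 : s^-1 * f z / max_norm z <= 1.
    rewrite ler_pdivrMr // mul1r mulrC ler_pdivrMr // fsum mulrC mulr_suml.
    apply: ler_sum => i _; apply: le_trans (le_dual_norm (fil i) (fiC i) e10 _) _.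
    by rewrite ler_wpM2l ?le_max_norm // (dual_norm_ge0 (fil i) (fiC i) e10).
  have h2 : 1 - 2 * eps <= s^-1 * f z / max_norm z.
    rewrite ler_pdivlMr // ler_pdivlMl //.
    apply: le_trans fz; rewrite mulrA ler_pM2r //.
    have e2 : 0 <= 1 - 2 * eps by have := e1; lra.
    apply: le_trans (ler_wpM2r e2 s_le) _.
    by have := sqr_ge0 eps; rewrite expr2; lra.
  by rewrite ger0_norm; lra.
Qed.

End Normalisation.

Section UnitNormals.
Context {R : realType} {X : completeNormedModType R} {n : nat}.
Variables (i0 : 'I_n) (Omega : 'I_n -> set X)
  (N : set X -> X -> set {linear X -> R^o}) (u a : 'I_n -> X) (eps : R).
Hypotheses (Omega_closed : forall i, closed (Omega i))
  (NE : N = clarke_normal_cone \/ (asplund X /\ N = frechet_normal_cone))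
  (u_in : forall i, Omega i (u i)) (a0 : a <> 0) (e0 : 0 < eps) (e1 : eps <= 2^-1)
  (empty : forall w, `|w| <= 144 / eps * max_norm a -> exists i, ~ Omega i (w + u i + a i)).

Lemma unit_normals : exists (x : 'I_n -> X) (v : X) (F : 'I_n -> {linear X -> R^o}),
  [/\ forall i, Omega i (x i) /\ N (Omega i) (x i) (F i),
    \sum_i dual_norm (F i) = 1,
    max_norm (x - u) <= 144 / eps * max_norm a /\ `|v| <= 144 / eps * max_norm a &
   [/\ diag v - x + u + a <> 0,
    0 <= dual_norm (fun y => \sum_i F i y) <= 2 * eps &
    `|1 - (\sum_i F i ((diag v - x + u + a) i)) / max_norm (diag v - x + u + a)| <= 2 * eps]].
Proof.
have ap : 0 < max_norm a.
  by rewrite lt_def max_norm_ge0 andbT; apply/eqP => /max_norm_eq0.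
(* The minimiser stays within [3 * lam] of [(u, 0)], and the perturbation has
   slope [12 * (max_norm a / lam) = eps / 4] there. *)
pose lam := 48 / eps * max_norm a.
have lam0 : 0 < lam by rewrite mulr_gt0 // divr_gt0.
have lamE : 3 * lam = 144 / eps * max_norm a by rewrite /lam; field; rewrite gt_eqF.
have kE : 12 * (max_norm a / lam) = eps / 4.
  by rewrite /lam; field; rewrite !gt_eqF.
have empty' w : `|w| <= 3 * lam -> exists i, ~ Omega i (w + u i + a i).
  by rewrite lamE; exact: empty.
(* Normality is asked of the positive multiples of the coordinate functionals, packed as linear
   maps, since this is what [normalise] returns. *)
suff [x [v [f [xO xv z0 fl [f1 fd fz normal]]]]] : exists (x : 'I_n -> X) (v : X)
    (f : ('I_n -> X) -> R), [/\ forall i, Omega i (x i),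
    max_norm (x - u) <= 3 * lam /\ `|v| <= 3 * lam, diag v - x + u + a <> 0, is_linear f &
    [/\ forall e, f e <= (1 + eps) * max_norm e, forall w, f (diag w) <= eps * `|w|,
    (1 - eps) * max_norm (diag v - x + u + a) <= f (diag v - x + u + a) &
    forall c (F : 'I_n -> {linear X -> R^o}), 0 < c -> (forall i h, F i h = c * f (single i h)) ->
      (forall i, dual_space (F i)) -> forall i, N (Omega i) (x i) (F i)]].
  have [c [F [c0 [FE Fd Fs Fsum Fz]]]] := normalise fl z0 e0 e1 f1 fd fz.
  exists x, v, F; rewrite -lamE; split=> // i.
  by split; [exact: xO|exact: (normal c)].
case: NE => [->|[aX ->]].
- have [x [v [f [xO xv z0 fl [f1 fd fz ft]]]]] :=
    clarke_estimate i0 Omega_closed u_in ap lam0 empty'.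
  rewrite kE in f1 fd fz; exists x, v, f; split=> //; split.
  + by move=> e; have := f1 e; have := mulr_ge0 (ltW e0) (max_norm_ge0 e); lra.
  + by move=> w; have := fd w; have := mulr_ge0 (ltW e0) (normr_ge0 w); lra.
  + by have := mulr_ge0 (ltW e0) (max_norm_ge0 (diag v - x + u + a)); move: fz; lra.
  + move=> c F c0 FE Fd i; split=> // h Th; rewrite FE.
    by rewrite mulr_ge0_le0 ?(ltW c0) //; exact: ft.
(* Half of [eps] is spent on the gauge and half on [2 * kappa], as [kappa = eps / 4]. *)
- have e20 : 0 < eps / 2 by rewrite divr_gt0.
  have e22 : eps / 2 <= 2^-1 by have := e1; have := e0; lra.
  have [x [v [f [xO xv z0 fl [f1 fd fz fr]]]]] :=
    frechet_estimate i0 aX Omega_closed u_in ap lam0 empty' e20 e22.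
  have eE : eps / 2 + 2 * (eps / 4) = eps by field.
  rewrite kE eE in f1 fd fz; exists x, v, f; split=> //; split=> // c F c0 FE Fd i.
  apply: frechet_normal_coneP => // r r0; have rc : 0 < r / c by rewrite divr_gt0.
  have [g g0 gP] := fr _ rc; exists g => // h Oh hg; rewrite FE.
  apply: le_trans (ler_wpM2l (ltW c0) (gP i h Oh hg)) _.
  by rewrite mulrA mulrCA mulfV ?gt_eqF // mulr1.
Qed.

End UnitNormals.

(** * Extremality *)

Section ExtremalityConditions.
Context {R : realType} {X : normedModType R} {n : nat}.
Variables (Omega : 'I_n -> set X) (sa : nat -> 'I_n -> X).
Hypothesis sa0 : null_perturbation sa.

Definition separated_within (C : R) (u a : 'I_n -> X) : Prop :=
  forall w, `|w| <= C * max_norm a -> exists i, ~ Omega i (w + u i + a i).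

Lemma zeta_le (x : 'I_n -> X) w : (forall i, Omega i (w + x i)) ->
  (zeta Omega x <= `|w|%:E)%E.
Proof.
move=> Ow; apply: (le_trans (edist_inf_triangle _ _ w)).
rewrite edist_inf0 ?adde0; last by move=> i _; exists (w + x i); rewrite ?addrK.
apply/lee_addgt0Pr => e e0; apply: ge_ereal_inf.
exists (`|w| + e)%:E; last by rewrite EFinD.
exists (`|w| + e) => //; split; first by rewrite ltr_wpDl.
by rewrite -ball_normE /= sub0r normrN ltrDl.
Qed.

Let sap k : 0 < max_norm (sa k).
Proof.
rewrite lt_def max_norm_ge0 andbT; apply/eqP => /max_norm_eq0.
exact: sa0.1.
Qed.

Lemma not_separated_within C u a : ~ separated_within C u a ->
  (zeta Omega (u + a)%R <= (C * max_norm a)%:E)%E.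
Proof.
move=> /existsNP[w /not_implyP[wC Ow]]; apply: (@le_trans _ _ `|w|%:E).
  apply: zeta_le => i; rewrite addrA; apply: contrapT => nO; apply: Ow.
  by exists i.
by rewrite lee_fin.
Qed.

(** A common point in the ball would give [zeta <= C * max_norm a], hence a quotient of at least
    [C^-1]; for [zeta = 0] the quotient is [+oo]. *)
Lemma alpha_separated su C : 0 < C -> (alpha Omega su sa < (C^-1)%:E)%E ->
  \forall k \near \oo, separated_within C (su k) (sa k).
Proof.
move=> C0 /ereal_inf_lt[_ [V Voo <-] supV]; apply: filterS Voo => k Vk.
apply: contrapT => /not_separated_within zC.
have : ((max_norm (sa k))%:E / zeta Omega (su k + sa k)%R < (C^-1)%:E)%E.
  by apply: le_lt_trans supV; apply: ereal_sup_ubound; exists k.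
have : (0 <= zeta Omega (su k + sa k)%R)%E by exact: edist_inf_ge0.
move: zC; case: (zeta _ _) => [r| |] //; rewrite !lee_fin => rC r0.
have [->|rn] := eqVneq r 0.
  by rewrite inve0 mulry gtr0_sg // mul1e ltNge leey.
have rp : 0 < r by rewrite lt_def rn.
rewrite inver (negbTE rn) -EFinM lte_fin ltr_pdivrMr //.
by rewrite ltr_pdivlMl // ltNge rC.
Qed.

Lemma extremal_separated su C : 0 < C -> extremal_wrt Omega su sa ->
  \forall k \near \oo, separated_within C (su k) (sa k).
Proof.
move=> C0; rewrite /extremal_wrt /rho /limn_einf oppe_gt0.
move=> /ereal_inf_lt[y [V Voo <-] supV].
have [c c0 cV] : exists2 c : R, 0 < c & forall k, V k -> (c%:E <= zeta Omega (su k + sa k)%R)%E.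
  have Vz k : V k -> (- zeta Omega (su k + sa k)%R <=
      ereal_sup [set (\- (fun k => zeta Omega (su k + sa k)%R))%E x | x in V])%E.
    by move=> Vk; apply: ereal_sup_ubound; exists k.
  move: supV Vz; case: (ereal_sup _) => [r|//|] supV Vz.
    by exists (- r) => [|k Vk]; [rewrite oppr_gt0 -lte_fin|rewrite EFinN leeNl; exact: Vz].
  (* Here the supremum is [-oo], so [zeta] is [+oo] on [V] and any positive bound serves. *)
  exists 1 => // k Vk; rewrite -[leRHS]oppeK leeNr; apply: le_trans (Vz k Vk) _.
  exact: leNye.
have cC : 0 < c / C by rewrite divr_gt0.
have small : \forall k \near \oo, `|0 - max_norm (sa k)| < c / C.
  exact: (cvgr_dist_lt _ _ sa0.2).
apply: filterS2 Voo small => k Vk; rewrite sub0r normrN ger0_norm ?max_norm_ge0 // => sk.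
apply: contrapT => /not_separated_within zC; have := le_trans (cV k Vk) zC.
by rewrite lee_fin leNgt mulrC -ltr_pdivlMr ?sk.
Qed.

End ExtremalityConditions.

(** * Diagonal choice and passage to sequences *)

(** [phi k] is the largest [m <= k] whose threshold [K m] has been passed. Before [K 0] there may be
    no such [m], so [P] holds only eventually. *)
Lemma ex_diagonal (P : nat -> nat -> Prop) :
  (forall m, \forall k \near \oo, P m k) ->
  exists phi : nat -> nat, (forall m, \forall k \near \oo, (m <= phi k)%N) /\
    \forall k \near \oo, P (phi k) k.
Proof.
move=> Pm; have /choice[K KP] : forall m, exists K, forall k, (K <= k)%N -> P m k.
  by move=> m; have [K _ KP] := Pm m; exists K => k /KP.
pose phi k := \max_(m < k.+1 | (K m <= k)%N) m.
exists phi; split=> [m|].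
  exists (maxn m (K m)) => //= k /=; rewrite geq_max => /andP[mk Kk].
  exact: (@leq_bigmax_cond _ (fun i : 'I_k.+1 => K i <= k)%N (fun i => nat_of_ord i)
    (Ordinal (mk : m < k.+1)%N)).
exists (K 0%N) => //= k K0; apply: KP.
have [|m Km mE] := @eq_bigmax_cond _ (fun i : 'I_k.+1 => K i <= k)%N (fun i => nat_of_ord i).
  by apply/card_gt0P; exists ord0.
have -> : phi k = m := mE.
exact: Km.
Qed.

Lemma cvg_of_rate {R : realType} {V : normedModType R} (f : nat -> V) l (phi : nat -> nat) (C : R) :
  (forall m, \forall k \near \oo, (m <= phi k)%N) -> 0 <= C ->
  (\forall k \near \oo, `|l - f k| <= C / (phi k).+1%:R) -> f @ \oo --> l.
Proof.
move=> phioo C0 fC; apply/cvgrPdist_le => e e0.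
apply: filterS2 fC (phioo (Num.truncn (C / e))) => k fk mk; apply: le_trans fk _.
rewrite ler_pdivrMr // mulrC -ler_pdivrMr //; apply: ltW.
by apply: lt_le_trans (truncnS_gt _) _; rewrite ler_nat ltnS.
Qed.

Theorem corollary3p1 (R : realType) (X : completeNormedModType R) (n : nat)
    (Omega : 'I_n -> set X) (x0 : nat -> 'I_n -> X)
    (N : set X -> X -> set {linear X -> R^o}) :
  (1 < n)%N ->
  (forall i, Omega i !=set0) ->
  (forall i, closed (Omega i)) ->
  (forall k, product_set Omega (x0 k)) ->
  (N = clarke_normal_cone \/ (asplund X /\ N = frechet_normal_cone)) ->
  let normal_sequences (x : nat -> 'I_n -> X)
      (xs : nat -> 'I_n -> {linear X -> R^o}) :=
    [/\ (forall k i, Omega i (x k i)),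
        (forall k i, N (Omega i) (x k i) (xs k i)),
        (forall i, (fun k => x k i - x0 k i) @ \oo --> (0 : X)),
        (fun k => dual_norm (fun y => \sum_(i < n) xs k i y)) @ \oo
          --> (0 : R) &
        (forall k, \sum_(i < n) dual_norm (xs k i) = 1)] in
  (approx_stationary Omega x0 \/ stationary Omega x0 \/ extremal Omega x0 ->
     exists x xs, normal_sequences x xs) /\
  (forall a : nat -> 'I_n -> X,
     null_perturbation a ->
     approx_stationary_wrt Omega x0 a \/ stationary_wrt Omega x0 a \/
       extremal_wrt Omega x0 a ->
     exists x xs (u : nat -> 'I_n -> X) (v : nat -> X),
       let z (k : nat) (i : 'I_n) := v k - x k i + u k i + a k i in
       normal_sequences x xs /\
       (forall k, product_set Omega (u k)) /\
       (fun k => max_norm (u k - x0 k)) @ \oo --> (0 : R) /\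
       (stationary_wrt Omega x0 a \/ extremal_wrt Omega x0 a -> u = x0) /\
       v @ \oo --> (0 : X) /\
       (\forall k \near \oo, z k <> 0) /\
       (fun k => (\sum_(i < n) xs k i (z k i)) / max_norm (z k)) @ \oo
         --> (1 : R)).
Proof.
move=> n1 Omega0 Ocl x0O NE normal_sequences.
have i0 : 'I_n by exact: (Ordinal (ltnW n1)).
suff main a : null_perturbation a -> approx_stationary_wrt Omega x0 a \/
    stationary_wrt Omega x0 a \/ extremal_wrt Omega x0 a ->
  exists x xs (u : nat -> 'I_n -> X) (v : nat -> X),
  let z (k : nat) (i : 'I_n) := v k - x k i + u k i + a k i in
  normal_sequences x xs /\ (forall k, product_set Omega (u k)) /\
  (fun k => max_norm (u k - x0 k)) @ \oo --> (0 : R) /\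
  (stationary_wrt Omega x0 a \/ extremal_wrt Omega x0 a -> u = x0) /\
  v @ \oo --> (0 : X) /\ (\forall k \near \oo, z k <> 0) /\
  (fun k => (\sum_(i < n) xs k i (z k i)) / max_norm (z k)) @ \oo --> (1 : R).
  split=> // h.
  have [a a0 aP] : exists2 a, null_perturbation a & approx_stationary_wrt Omega x0 a \/
      stationary_wrt Omega x0 a \/ extremal_wrt Omega x0 a.
    by case: h => [[a a0 aP]|[[a a0 aP]|[a a0 aP]]]; exists a => //; [left|right; left|right; right].
  by have [x [xs [u [v [xP _]]]]] := main a a0 aP; exists x, xs.
(* The index [m.+2] keeps [eps m] at most [2^-1], as [unit_normals] requires. *)
move=> a0 aP; pose eps (m : nat) : R := m.+2%:R^-1.
have eps0 m : 0 < eps m by rewrite invr_gt0.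
have eps1 m : eps m <= 2^-1 by rewrite lef_pV2 ?posrE // ler_nat.
have C0 m : 0 < 144 / eps m by rewrite divr_gt0.
have [U [UO UP]] : exists U : nat -> nat -> 'I_n -> X,
    (forall m k, product_set Omega (U m k)) /\
    [/\ (stationary_wrt Omega x0 a \/ extremal_wrt Omega x0 a) -> forall m, U m = x0,
     forall m, (fun k => max_norm (U m k - x0 k)) @ \oo --> (0 : R) &
     forall m, \forall k \near \oo, separated_within Omega (144 / eps m) (U m k) (a k)].
  (* [x0] is kept whenever it qualifies, which is the claim [u = x0]; otherwise the infimum
     [alpha_tilde = 0] yields a separate sequence for each accuracy. *)
  have [se|nse] := pselect (stationary_wrt Omega x0 a \/ extremal_wrt Omega x0 a).
    exists (fun=> x0); split=> //; split=> // m.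
      under eq_fun do rewrite subrr (seminorm0 (@max_norm_seminorm R X n)).
      exact: cvg_cst.
    case: se => [st|ex]; last exact: extremal_separated.
    by apply: alpha_separated => //; rewrite st lte_fin invr_gt0.
  have ap : approx_stationary_wrt Omega x0 a by case: aP => // /nse.
  have /choice[U UP] : forall m, exists su, [/\ forall k, product_set Omega (su k),
      (fun k => max_norm (su k - x0 k)) @ \oo --> (0 : R) &
      (alpha Omega su a < ((144 / eps m)^-1)%:E)%E].
    move=> m; have : (alpha_tilde Omega x0 a < ((144 / eps m)^-1)%:E)%E.
      by rewrite ap lte_fin invr_gt0.
    by move=> /ereal_inf_lt[_ [su [suO suc] <-] sua]; exists su.
  exists U; split=> [m|]; first by case: (UP m).
  split=> // m; first by case: (UP m).
  by have [_ _] := UP m; exact: alpha_separated.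
have [UE Uc Us] := UP.
have Pm m : \forall k \near \oo, [/\ separated_within Omega (144 / eps m) (U m k) (a k),
    144 / eps m * max_norm (a k) <= m.+1%:R^-1 & max_norm (U m k - x0 k) <= m.+1%:R^-1].
  have m0 : 0 < m.+1%:R^-1 :> R by rewrite invr_gt0.
  have mC : 0 < m.+1%:R^-1 / (144 / eps m) by rewrite divr_gt0.
  have aC := cvgr_dist_le _ _ a0.2 _ mC; have UC := cvgr_dist_le _ _ (Uc m) _ m0.
  near=> k; split; first by near: k; exact: Us.
    rewrite mulrC -ler_pdivlMr //.
    have : `|0 - max_norm (a k)| <= m.+1%:R^-1 / (144 / eps m) by near: k; exact: aC.
    by rewrite sub0r normrN ger0_norm ?max_norm_ge0.
  have : `|0 - max_norm (U m k - x0 k)| <= m.+1%:R^-1 by near: k; exact: UC.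
  by rewrite sub0r normrN ger0_norm ?max_norm_ge0.
have [phi [phioo phiP]] := ex_diagonal Pm.
have [K _ KP] := phiP.
(* Below [K] the data of index [K] are reused: normals of total norm 1 are
   required for every [k]. *)
have /choice[dat datP] : forall k, exists d : ('I_n -> X) * X * ('I_n -> {linear X -> R^o}),
  let k' := maxn K k in let u := U (phi k') k' in let e := eps (phi k') in
  let z := diag d.1.2 - d.1.1 + u + a k' in
  [/\ forall i, Omega i (d.1.1 i) /\ N (Omega i) (d.1.1 i) (d.2 i),
    \sum_i dual_norm (d.2 i) = 1,
    max_norm (d.1.1 - u) <= 144 / e * max_norm (a k') /\
      `|d.1.2| <= 144 / e * max_norm (a k') &
   [/\ z <> 0, 0 <= dual_norm (fun y => \sum_i d.2 i y) <= 2 * e &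
    `|1 - (\sum_i d.2 i (z i)) / max_norm z| <= 2 * e]].
  move=> k /=; set k' := maxn K k; have [sep _ _] := KP k' (leq_maxl _ _).
  have [x [v [F H]]] := unit_normals i0 Ocl NE (UO (phi k') k') (a0.1 k') (eps0 _) (eps1 _) sep.
  by exists (x, v, F).
(* Below [K] the claims on [z] are void and [u k] only has to lie in the product; the value [x0 k]
   also preserves [u = x0]. *)
pose u k := if (K <= k)%N then U (phi k) k else x0 k.
have nearK : \forall k \near \oo, (K <= k)%N by exists K.
have eps_le m : eps m <= m.+1%:R^-1 by rewrite lef_pV2 ?posrE // ler_nat.
have uc : \forall k \near \oo, max_norm (u k - x0 k) <= (phi k).+1%:R^-1.
  by apply: filterS nearK => k Kk; rewrite /u Kk; case: (KP k Kk).
exists (fun k => (dat k).1.1), (fun k => (dat k).2), u, (fun k => (dat k).1.2) => /=.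
split; [split|split; [|split; [|split; [|split; [|split]]]]].
- by move=> k i; have [/(_ i)[]] := datP k.
- by move=> k i; have [/(_ i)[]] := datP k.
- move=> i; apply: (cvg_of_rate (C := 2) phioo) => //.
  apply: filterS nearK => k Kk; rewrite sub0r normrN.
  have := datP k; rewrite (maxn_idPr Kk) /= => -[_ _ [h4' _] _].
  have [_ h1 h2] := KP k Kk.
  have := le_max_norm ((dat k).1.1 - U (phi k) k) i.
  have := le_max_norm (U (phi k) k - x0 k) i; rewrite !fctE => h4 h3.
  rewrite -(subrK (U (phi k) k i) ((dat k).1.1 i)) -addrA.
  apply: le_trans (ler_normD _ _) _.
  have h5 := le_trans (le_trans h3 h4') h1; have h6 := le_trans h4 h2.
  by rewrite mulr_natl mulr2n; apply: lerD.
- apply: (cvg_of_rate (C := 2) phioo) => //.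
  apply: filterS nearK => k Kk; have := datP k; rewrite (maxn_idPr Kk) /= => -[_ _ _ [_ /andP[d0 d1] _]].
  by rewrite sub0r normrN ger0_norm //; apply: le_trans d1 _; rewrite ler_pM2l // eps_le.
- by move=> k; case: (datP k).
- by move=> k; rewrite /u; case: ifP => _; [exact: UO|exact: x0O].
- apply: (cvg_of_rate (C := 1) phioo) => //; apply: filterS uc => k uk.
  by rewrite sub0r normrN ger0_norm ?max_norm_ge0 // mul1r.
- move=> se; apply/funext => k; rewrite /u; case: ifP => // _.
  by rewrite UE.
- apply: (cvg_of_rate (C := 1) phioo) => //; apply: filterS nearK => k Kk.
  rewrite sub0r normrN mul1r; have := datP k; rewrite (maxn_idPr Kk) /= => -[_ _ [_ vk] _].
  by have [_ h1 _] := KP k Kk; exact: le_trans vk h1.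
- apply: filterS nearK => k Kk; have := datP k; rewrite (maxn_idPr Kk) /= => -[_ _ _ [zk _ _]].
  by rewrite /u Kk.
- apply: (cvg_of_rate (C := 2) phioo) => //; apply: filterS nearK => k Kk.
  have := datP k; rewrite (maxn_idPr Kk) /= => -[_ _ _ [_ _ zk]].
  by rewrite /u Kk; apply: le_trans zk _; rewrite ler_pM2l // eps_le.
Unshelve. all: by end_near. Qed.
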